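(* Assume that the entries of $E$ are independent $N(0,\sigma^2)$ random variables. Let $r=r(A)\ge 1$ and $q=r(X)$. (1) Let $\theta>0$, $\delta\in(0,1]$ and set $$\mu=(1+\theta)^2\sigma^2(\sqrt{n}+\sqrt{q})^2/\delta^2 .$$ Suppose there is an index $1\le s\le r$ with $d_s(XA)>(1+\delta)\sqrt{\mu}$ and $d_{s+1}(XA)<(1-\delta)\sqrt{\mu}$, and let $r_e(\mu)=s$ be this index (the effective rank of $A$ relative to $\mu$). Then $$\mathbb{P}\{\hat k\ne r_e(\mu)\}\le\exp\left(-\tfrac12\theta^2(n+q)\right),$$ and this bound tends to $0$ as $q+n\to\infty$. (2) In particular, if $\theta>0$, $\sqrt{\mu}=(1+\theta)\sigma(\sqrt{n}+\sqrt{q})$ and $d_r(XA)>2\sqrt{\mu}$, then $$\mathbb{P}\{\hat k\ne r\}\le\exp\left(-\tfrac12\theta^2(n+q)\right),$$ and this bound tends to $0$ as $q+n\to\infty$.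
   Context: Multivariate response regression model: $Y=XA+E$, where $Y$ is the $m\times n$ response matrix, $X$ is a fixed (nonrandom) $m\times p$ matrix, $A$ is an unknown fixed $p\times n$ matrix, and $E$ is a random $m\times n$ matrix. $P$ is the orthogonal projection matrix onto the column space of $X$. For a matrix $C$, $r(C)$ is its rank, $\|C\|_F$ its Frobenius norm, and $d_1(C)\ge d_2(C)\ge\cdots$ its singular values in decreasing order ($d_j(C)=0$ for $j$ larger than the rank of $C$). The Rank Selection Criterion (RSC) estimator with tuning parameter $\mu>0$ is a minimizer $\hat A$ of $\|Y-XB\|_F^2+\mu\, r(B)$ over all $p\times n$ matrices $B$, and $\hat k=r(\hat A)$; equivalently, $\hat k=\max\{k: d_k(PY)\ge\sqrt{\mu}\}$, the number of singular values of $PY$ that are at least $\sqrt\mu$ ($\hat k=0$ if there are none; if the minimizer is not unique, $\hat A$ is taken to be a minimizer with this rank). *)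

(* Defs.v *)
From HB Require Import structures.
From mathcomp Require Import all_boot all_order all_algebra.
From mathcomp Require Import polyrcf.
From mathcomp Require Import all_classical all_reals all_analysis.

Set Implicit Arguments.
Unset Strict Implicit.
Unset Printing Implicit Defensive.

Import Order.TTheory GRing.Theory Num.Theory.
Import numFieldNormedType.Exports.

Local Open Scope classical_set_scope.
Local Open Scope ring_scope.

Section SingularValues.
Variables (R : realType) (m n : nat).
Implicit Types C : 'M[R]_(m, n).

(* The n eigenvalues of C^T C, repeated according to algebraic multiplicity,
   in decreasing order: rootsR lists each root of the characteristic polynomial
   once, and mup x p is the multiplicity of x as a root of p. *)
Definition gram_eigenvalues C : seq R :=
  let p := char_poly (C^T *m C) in
  sort >=%R (flatten [seq nseq (mup x p) x | x <- rootsR p]).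

Definition singular_values C : seq R :=
  [seq Num.sqrt x | x <- gram_eigenvalues C].

(* The list is indexed from 0 but d_1, d_2, ... are numbered from 1, so this is
   to be used with 1 <= j; it is 0 for j beyond the rank of C. *)
Definition sing_val C (j : nat) : R := (singular_values C)`_j.-1.

Definition frob C : R := Num.sqrt (\sum_i \sum_j C i j ^+ 2).

End SingularValues.

(* In the row-vector convention of mxalgebra, <<X^T>> is the column space of X
   and kermx X = {u | u *m X = 0} is its orthogonal complement; proj_mx acts on
   rows on the right, hence the outer transpose. *)
Definition col_proj (R : realType) (m p : nat) (X : 'M[R]_(m, p)) : 'M[R]_m :=
  (proj_mx <<X^T>>%MS (kermx X))^T.

Section RankSelection.
Variables (R : realType) (m p n : nat).
Variables (mu : R) (X : 'M[R]_(m, p)) (Y : 'M[R]_(m, n)).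

Definition rsc_criterion (B : 'M[R]_(p, n)) : R :=
  frob (Y - X *m B) ^+ 2 + mu * (\rank B)%:R.

Definition rsc_minimizer (B : 'M[R]_(p, n)) : Prop :=
  forall B' : 'M[R]_(p, n), rsc_criterion B <= rsc_criterion B'.

(* max {k : d_k(PY) >= sqrt mu}, with value 0 if there is no such k. *)
Definition rsc_rank : nat :=
  count (fun x => Num.sqrt mu <= x) (singular_values (col_proj X *m Y)).

(* The second clause is the tie-breaking rule for non-unique minimizers: the
   selected one has rank rsc_rank whenever some minimizer does.  That such a
   minimizer always exists is a theorem (Eckart-Young), not an assumption. *)
Definition rsc_estimate (B : 'M[R]_(p, n)) : Prop :=
  rsc_minimizer B /\
  ((exists2 B', rsc_minimizer B' & \rank B' = rsc_rank) -> \rank B = rsc_rank).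

End RankSelection.

Section GaussianNoise.
Context {d : measure_display} {T : measurableType d} {R : realType}.
Variable P : probability T R.

Definition mutually_independent (I : finType) (Z : I -> {RV P >-> R}) : Prop :=
  forall (J : {set I}) (B : I -> set R), (forall i, measurable (B i)) ->
    P [set w | forall i, i \in J -> B i (Z i w)] =
    (\prod_(i in J) P (Z i @^-1` B i))%E.

(* The second parameter of normal_prob is the standard deviation. *)
Definition gaussian_noise (m n : nat) (sigma : R)
    (E : 'I_m * 'I_n -> {RV P >-> R}) : Prop :=
  mutually_independent E /\
  forall (ij : 'I_m * 'I_n) (B : set R), measurable B ->
    distribution P (E ij) B = normal_prob 0 sigma B.

Definition response (m p n : nat) (X : 'M[R]_(m, p)) (A : 'M[R]_(p, n))
    (E : 'I_m * 'I_n -> {RV P >-> R}) (w : T) : 'M[R]_(m, n) :=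
  X *m A + \matrix_(i, j) E (i, j) w.

End GaussianNoise.

Definition tail_bound (R : realType) (theta : R) (N : nat) : R :=
  expR (- (2^-1 * theta ^+ 2 * N%:R)).

(* Main.v *)
(* By Weyl's inequality the number of singular values of PY = XA + PE above
   sqrt mu is s as soon as |x (PE)^T| < delta sqrt mu |x| for all x <> 0, and by
   Eckart-Young this number is the rank of a minimizer of the criterion.  So it
   suffices to bound the probability that the norm of the q x n standard Gaussian
   matrix G = Q^T E / sigma, where P = Q Q^T, exceeds (1 + theta) (sqrt n + sqrt q), which
   is at least sqrt n + sqrt q + theta sqrt (n + q).

   Instead of concentration for Lipschitz functions, one exponential moment is
   estimated and Chernoff's bound is applied.  For finitely many pairs of unit
   vectors (u_a, w_a), a < N, Slepian's comparison is proved for the functions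
   (sum_a exp (beta z_a))^alpha with alpha <= 1, which approximate
   exp (alpha beta max_a z_a) up to the factor N^alpha; with lambda = alpha beta
   fixed and alpha -> 0 this gives
     E exp (lambda max_a u_a^T G w_a)
       <= exp (lambda (sqrt n + sqrt q) + lambda^2 / 2),
   and lambda = theta sqrt (n + q) is the optimal choice.  The comparison itself
   replaces the covariance of a Gaussian vector in small independent steps: over
   a step of variance e^2 the second-order Taylor expansion has error O(e^3) and
   there are e^-2 steps. *)

Require Import Defs.
From HB Require Import structures.
From mathcomp Require Import all_boot all_order all_algebra.
From mathcomp Require Import all_classical all_reals all_analysis.
From mathcomp Require Import polyrcf complex measurable_realfun ring lra zify.

Set Implicit Arguments.
Unset Strict Implicit.
Unset Printing Implicit Defensive.

Import Order.TTheory GRing.Theory Num.Theory.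
Import numFieldNormedType.Exports.

Local Open Scope classical_set_scope.
Local Open Scope ring_scope.

(** * Gaussian integrals *)

(** Only nonnegative functions are integrated, so Tonelli and monotonicity hold without
    integrability conditions; in return, signed terms have to be moved across inequalities or
    cancelled by the symmetry x -> -x before integrating. The soft maximum is multiplicative: its
    value at z + h is its value at z times a weighted soft maximum of h. One step of the comparison
    therefore has a relative error independent of z, and the errors of all steps multiply up to exp
    (O(e)). Slepian's comparison needs equal variances, whereas u^T G w has half the variance of <g,
    u> + <h, w>; one common extra variable repairs this at a cost known exactly, which is where
    lambda^2 / 2 instead of lambda^2 comes from. The rank of the estimate is not assumed measurable:
    it equals [rsc_rank], and events on that count are, by Weyl's inequality, countable unions over
    rational matrices. Likewise the norm is tested on countably many rational directions, which
    costs a strict inequality; the room for it is that between sqrt (n + q) and sqrt n + sqrt q. *)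

Section NormalIntegrals.
Context {R : realType}.
Local Notation leb := (@lebesgue_measure R).
Local Open Scope ereal_scope.
Implicit Types (s a b : R) (G : R -> \bar R).

Lemma ge0_integral_normal_prob s G : measurable_fun setT G ->
  (forall x, 0 <= G x) ->
  \int[normal_prob 0 s]_x G x = \int[leb]_x (G x * (normal_pdf 0 s x)%:E).
Proof.
move=> mG G0.
have dom := @normal_prob_dominates R 0 s.
rewrite -(@Radon_Nikodym_SigmaFinite.change_of_variables _ _ R
  (normal_prob 0 s) leb dom G setT G0 measurableT mG).
have mpdf : measurable_fun setT (EFin \o normal_pdf 0 s).
  by apply/measurable_EFinP; exact: measurable_normal_pdf.
have iRN := @Radon_Nikodym_SigmaFinite.f_integrable _ _ R (normal_prob 0 s) leb dom.
apply: ae_eq_integral => //.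
- by apply: emeasurable_funM => //; exact: (measurable_int leb).
- exact: emeasurable_funM.
(* The Radon-Nikodym derivative and the density have the same integral over every measurable set, so
   they agree almost everywhere. *)
- apply: ae_eqe_mul2l => /=.
  apply: integral_ae_eq => //= B _ mB.
  by rewrite -Radon_Nikodym_SigmaFinite.f_integral.
Qed.

Lemma measurable_affine a b : measurable_fun setT (fun x : R => (a * x + b)%R).
Proof. by apply: measurable_funD => //; exact: measurable_funM. Qed.

(* The image of a * leb under x |-> a x + b is translation invariant and gives
   mass 1 to unit intervals. *)
Lemma ge0_integral_affine a b G : (0 < a)%R -> measurable_fun setT G ->
  (forall x, 0 <= G x) ->
  \int[leb]_x G x = a%:E * \int[leb]_x G (a * x + b)%R.
Proof.
move=> a0 mG G0.
pose phi (x : measurableTypeR R) : measurableTypeR R := (a * x + b)%R.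
have mphi : measurable_fun setT phi := measurable_affine a b.
have muE A : measurable A -> leb A = mscale (NngNum (ltW a0))
    (pushforward leb phi) A.
  move=> mA; apply: lebesgue_measure_unique => // {mA A} _ [[x y] _ <-] /=.
  rewrite /mscale/= /pushforward.
  rewrite [X in _ * leb X](_ : _ = `](x - b) / a, (y - b) / a]%classic)%R; last first.
    apply/seteqP; split=> z; rewrite /preimage /phi /= !in_itv/= ltr_pdivrMr// ler_pdivlMr//;
      by move=> /andP[? ?]; apply/andP; split; lra.
  rewrite !lebesgue_measure_itv/= !lte_fin ltr_pM2r ?invr_gt0// ltrD2r.
  case: ifPn => _; last by rewrite mule0.
  by rewrite -!EFinD -EFinM; congr EFin; field; rewrite gt_eqF.
have := ge0_integral_pushforward mphi leb measurableT mG; rewrite preimage_setT => <-//.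
rewrite -(ge0_integral_mscale _ _ (NngNum (ltW a0)))//.
by apply: eq_measure_integral => A mA _; exact: muE.
Qed.

Lemma ge0_integral_opp G : measurable_fun setT G -> (forall x, 0 <= G x) ->
  \int[leb]_x G x = \int[leb]_x G (- x)%R.
Proof.
move=> mG G0.
have mN : measurable_fun [set: measurableTypeR R] (-%R : _ -> measurableTypeR R).
  exact: oppr_measurable.
have := @ge0_integral_pushforward _ _ (measurableTypeR R) (measurableTypeR R) R _ mN leb _ G measurableT mG.
rewrite preimage_setT => <-//.
by apply: eq_measure_integral => A mA _; exact/esym/lebesgue_measureN.
Qed.

Let measurable_pdf s : measurable_fun setT (fun x => (normal_pdf 0 s x)%:E).
Proof. by apply/measurable_EFinP; exact: measurable_normal_pdf. Qed.

Lemma normal_pdfN s x : s != 0%R -> normal_pdf 0 s (- x)%R = normal_pdf 0 s x.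
Proof.
by move=> s0; rewrite !normal_pdfE// /normal_fun !subr0 sqrrN.
Qed.

Lemma ge0_integral_normal_opp s G : s != 0%R -> measurable_fun setT G ->
  (forall x, 0 <= G x) ->
  \int[normal_prob 0 s]_x G (- x)%R = \int[normal_prob 0 s]_x G x.
Proof.
move=> s0 mG G0.
have mGN : measurable_fun setT (fun x : R => G (- x)%R).
  by apply: measurableT_comp => //; exact: oppr_measurable.
rewrite !ge0_integral_normal_prob//.
transitivity (\int[leb]_x (G (- x)%R * (normal_pdf 0 s (- x))%:E)).
  by apply: eq_integral => x _; rewrite normal_pdfN.
apply/esym/(ge0_integral_opp (G := fun x => G x * (normal_pdf 0 s x)%:E)).
- exact: emeasurable_funM.
- by move=> x; rewrite mule_ge0// lee_fin normal_pdf_ge0.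
Qed.

(* x^2 + (sqrt 2 u - x)^2 = u^2 + (sqrt 2 x - u)^2 *)
Lemma normal_pdf_rotation s x u : s != 0%R ->
  (normal_pdf 0 s x * normal_pdf 0 s (Num.sqrt 2 * u - x) =
   normal_pdf 0 s u * normal_pdf 0 s (Num.sqrt 2 * x - u))%R.
Proof.
move=> s0; rewrite !normal_pdfE// /normal_fun !subr0.
rewrite [LHS]mulrACA [RHS]mulrACA -!expRD; congr (_ * expR _)%R.
have s2 : (Num.sqrt 2 ^+ 2 = 2 :> R)%R by rewrite sqr_sqrtr.
rewrite -!mulrDl; congr (_ / _)%R; rewrite !sqrrB !exprMn !s2; ring.
Qed.

(** Rotation invariance of the planar Gaussian law, after the substitution y = sqrt 2 u - x. It lets
    a Gaussian step be cut into two independent ones of half the variance. *)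
Lemma ge0_integral_normal_add s G : s != 0%R -> measurable_fun setT G ->
  (forall x, 0 <= G x) ->
  \int[normal_prob 0 s]_x \int[normal_prob 0 s]_y G (x + y)%R =
  \int[normal_prob 0 s]_u G (Num.sqrt 2 * u)%R.
Proof.
move=> s0 mG G0.
have r2 : (0 < Num.sqrt 2 :> R)%R by rewrite sqrtr_gt0.
have pdf0 x : (0 <= (normal_pdf 0 s x)%:E) by rewrite lee_fin normal_pdf_ge0.
have mshift (x : R) : measurable_fun setT (fun y : R => G (x + y)%R).
  by apply: measurableT_comp => //; exact: measurable_funD.
have madd : measurable_fun setT (fun p : R * R => G (p.1 + p.2)%R).
  by apply: measurableT_comp => //; apply: measurable_funD.
have mmul c : measurable_fun setT (fun y : R => G (c * y)%R).
  by apply: measurableT_comp => //; exact: measurable_funM.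
rewrite ge0_integral_normal_prob; last 2 first.
- exact: (measurable_fun_fubini_tonelli_F (m2 := normal_prob 0 s) _ madd).
- by move=> x; apply: integral_ge0.
have mpdfs (c : R) : measurable_fun setT (fun y : R => (normal_pdf 0 s (Num.sqrt 2 * y + c))%:E).
  by apply: (measurableT_comp (measurable_pdf s)); exact: measurable_affine.
pose H (p : R * R) := (Num.sqrt 2)%:E * (G (Num.sqrt 2 * p.2)%R *
  ((normal_pdf 0 s p.2)%:E * (normal_pdf 0 s (Num.sqrt 2 * p.1 - p.2))%:E)).
have mH : measurable_fun setT H.
  apply: emeasurable_funM => //; apply: emeasurable_funM.
    by apply: (measurableT_comp (mmul _)).
  apply: emeasurable_funM; first exact: (measurableT_comp (measurable_pdf s)).
  apply: (measurableT_comp (measurable_pdf s)).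
  by apply: measurable_funB => //; exact: measurable_funM.
have H0 p : 0 <= H p by rewrite !mule_ge0// lee_fin// ltW.
transitivity (\int[leb]_x \int[leb]_u H (x, u)).
  apply: eq_integral => x _.
  rewrite ge0_integral_normal_prob//.
  have mGx : measurable_fun setT (fun y => G (x + y)%R * (normal_pdf 0 s y)%:E).
    exact: emeasurable_funM.
  have mGs := measurableT_comp mGx (measurable_affine (Num.sqrt 2) (- x)%R).
  rewrite (ge0_integral_affine (- x)%R r2 mGx); last by move=> y; rewrite mule_ge0.
  rewrite -ge0_integralZl//=; last by move=> y _; rewrite mule_ge0.
  rewrite -ge0_integralZr//=; last 2 first.
  - by apply: emeasurable_funM => //; exact: mGs.
  - by move=> y _; rewrite !mule_ge0// lee_fin ltW.
  apply: eq_integral => u _; rewrite /H/=.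
  rewrite -EFinM -normal_pdf_rotation// EFinM addrCA subrr addr0.
  by rewrite -!muleA [(_%:E * (normal_pdf 0 s x)%:E)]muleC.
apply: (eq_trans (@fubini_tonelli _ _ (measurableTypeR R) (measurableTypeR R) R leb leb H mH H0)).
rewrite ge0_integral_normal_prob//.
apply: eq_integral => u _.
transitivity (\int[leb]_x ((G (Num.sqrt 2 * u)%R * (normal_pdf 0 s u)%:E) * ((Num.sqrt 2)%:E *
   (normal_pdf 0 s (Num.sqrt 2 * x - u))%:E))).
  by apply: eq_integral => x _; rewrite /H/= [in LHS](muleA (G _)) muleCA.
rewrite ge0_integralZl//=; last 3 first.
- by apply: emeasurable_funM => //; exact: mpdfs (- u)%R.
- by move=> x _; rewrite mule_ge0// lee_fin ltW.
- by rewrite mule_ge0.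
rewrite ge0_integralZl//=; last exact: mpdfs (- u)%R.
(* The factor sqrt 2 is the Jacobian of x -> sqrt 2 x - u, and the density integrates to 1. *)
rewrite -(@ge0_integral_affine _ (- u)%R (fun x => (normal_pdf 0 s x)%:E) r2)//.
by rewrite integral_normal_pdf mule1.
Qed.

(** Completing the square: the exponential tilts the density to mean c s^2. *)
Lemma integral_normal_expR_mul s c : s != 0%R ->
  \int[normal_prob 0 s]_x (expR (c * x))%:E = (expR (c ^+ 2 * s ^+ 2 / 2))%:E.
Proof.
move=> s0.
rewrite ge0_integral_normal_prob; last 2 first.
- by apply/measurable_EFinP; apply: measurableT_comp => //; exact: measurable_funM.
- by move=> x; rewrite lee_fin expR_ge0.
transitivity (\int[leb]_x ((expR (c ^+ 2 * s ^+ 2 / 2))%:E * (normal_pdf (c * s ^+ 2) s x)%:E)).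
  apply: eq_integral => x _; rewrite -!EFinM; congr EFin.
  rewrite !normal_pdfE// /normal_fun mulrCA [RHS]mulrCA -!expRD; congr (_ * expR _)%R.
  by field.
rewrite ge0_integralZl//=.
- by rewrite integral_normal_pdf mule1.
- by apply/measurable_EFinP; exact: measurable_normal_pdf.
- by move=> x _; rewrite lee_fin normal_pdf_ge0.
Qed.

(** Exponential times density is D^-1 times the density of standard deviation s / D. *)
Lemma integral_normal_expR_sqr s c : (0 < s)%R -> (c * s ^+ 2 *+ 2 < 1)%R ->
  \int[normal_prob 0 s]_x (expR (c * x ^+ 2))%:E =
  ((Num.sqrt (1 - c * s ^+ 2 *+ 2))^-1)%:E.
Proof.
move=> s0 cs; set D := Num.sqrt _.
have D0 : (0 < D)%R by rewrite sqrtr_gt0; lra.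
have D2 : (D ^+ 2 = 1 - c * s ^+ 2 *+ 2)%R by rewrite sqr_sqrtr//; lra.
have sn0 : (s != 0)%R by rewrite gt_eqF.
have sD : (s / D != 0)%R by rewrite gt_eqF// divr_gt0.
rewrite ge0_integral_normal_prob; last 2 first.
- apply/measurable_EFinP; apply: measurableT_comp => //; apply: measurable_funM => //; exact: measurable_funX.
- by move=> x; rewrite lee_fin expR_ge0.
transitivity (\int[leb]_x ((D^-1)%:E * (normal_pdf 0 (s / D) x)%:E)).
  apply: eq_integral => x _; rewrite -!EFinM; congr EFin.
  rewrite !normal_pdfE// /normal_fun mulrCA -expRD [RHS]mulrA; congr (_ * _)%R; last congr expR.
    rewrite /normal_peak (_ : (s / D) ^+ 2 * pi *+ 2 = D^-1 ^+ 2 * (s ^+ 2 * pi *+ 2))%R; last by field; rewrite gt_eqF.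
    by rewrite sqrtrM ?sqr_ge0// sqrtr_sqr gtr0_norm ?invr_gt0// invfM invrK mulKf// gt_eqF.
  rewrite !subr0 expr_div_n D2; field.
  by rewrite sn0 andbT mulr_natr gt_eqF// subr_gt0.
rewrite ge0_integralZl//=.
- by rewrite integral_normal_pdf mule1.
- by apply/measurable_EFinP; exact: measurable_normal_pdf.
- by move=> x _; rewrite lee_fin normal_pdf_ge0.
- by rewrite lee_fin invr_ge0 ltW.
Qed.

End NormalIntegrals.

(** * Smoothing along independent Gaussian directions *)

Section GaussianSmoothing.
Context {R : realType} (s : R) (s_gt0 : 0 < s) (N : nat).
Local Notation V := (N.-tuple R).
Local Notation gam := (normal_prob 0 s).
Implicit Types (z h : V) (x : R) (b c : 'I_N -> R) (bs cs : seq ('I_N -> R)).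
Implicit Types (f g : V -> \bar R).

Definition tshift z x b : V := [tuple tnth z i + x * b i | i < N].
Definition tadd z h : V := [tuple tnth z i + tnth h i | i < N].
Definition topp z : V := [tuple - tnth z i | i < N].
Definition tzero : V := [tuple 0 | i < N].

Definition scale_dirs (e : R) bs := [seq (fun i => e * b i) | b <- bs].

(* E f(z + sum_k X_k b_k), the X_k being independent N(0,s^2) *)
Definition gsmooth bs f : V -> \bar R :=
  foldr (fun b g z => (\int[gam]_x g (tshift z x b))%E) f bs.

Definition nnmeas f := measurable_fun setT f /\ forall z, (0 <= f z)%E.

Let s_neq0 : s != 0. Proof. by rewrite gt_eqF. Qed.

Lemma tshiftC z x y b c : tshift (tshift z x b) y c = tshift (tshift z y c) x b.
Proof. by apply: eq_from_tnth => i; rewrite !tnth_mktuple addrAC. Qed.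

Lemma tshift_add z h x b : tshift (tadd z h) x b = tadd z (tshift h x b).
Proof. by apply: eq_from_tnth => i; rewrite !tnth_mktuple addrA. Qed.

Lemma tadd0 z : tadd z tzero = z.
Proof. by apply: eq_from_tnth => i; rewrite !tnth_mktuple addr0. Qed.

Let mR := measurableTypeR R.

Lemma measurable_tshift b : measurable_fun setT (fun p : V * R => tshift p.1 p.2 b).
Proof.
apply/measurable_fun_tnthP => i /=.
rewrite (_ : _ \o _ = fun p : V * R => tnth p.1 i + p.2 * b i); last first.
  by apply/funext => p /=; rewrite tnth_mktuple.
apply: measurable_funD.
  by apply: (measurableT_comp (f := fun z : V => tnth z i)) => //; exact: measurable_tnth.
by apply: measurable_funM.
Qed.

Lemma measurable_tshift_r z b : measurable_fun setT (fun x : R => tshift z x b).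
Proof.
apply/measurable_fun_tnthP => i /=.
rewrite (_ : _ \o _ = fun x : R => tnth z i + x * b i); last first.
  by apply/funext => p /=; rewrite tnth_mktuple.
by apply: measurable_funD => //; apply: measurable_funM.
Qed.

Lemma measurable_tshift2 z b c :
  measurable_fun setT (fun p : R * R => tshift (tshift z p.1 b) p.2 c).
Proof.
apply/measurable_fun_tnthP => i /=.
rewrite (_ : _ \o _ = fun p : R * R => tnth z i + p.1 * b i + p.2 * c i); last first.
  by apply/funext => p /=; rewrite !tnth_mktuple.
by do !apply: measurable_funD => //; apply: measurable_funM.
Qed.

Lemma measurable_tadd z : measurable_fun setT (tadd z).
Proof.
apply/measurable_fun_tnthP => i /=.
rewrite (_ : _ \o _ = fun h : V => tnth z i + tnth h i); last first.
  by apply/funext => p /=; rewrite tnth_mktuple.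
by apply: measurable_funD => //; exact: measurable_tnth.
Qed.

Lemma measurable_topp : measurable_fun setT topp.
Proof.
apply/measurable_fun_tnthP => i /=.
rewrite (_ : _ \o _ = fun h : V => - tnth h i); last first.
  by apply/funext => p /=; rewrite tnth_mktuple.
by apply: measurableT_comp; [exact: oppr_measurable|exact: measurable_tnth].
Qed.

Lemma nnmeas_line f z b : nnmeas f ->
  measurable_fun setT (fun x : R => f (tshift z x b)).
Proof. by move=> [mf _]; apply: (measurableT_comp mf); exact: measurable_tshift_r. Qed.

Lemma nnmeas_gsmooth bs f : nnmeas f -> nnmeas (gsmooth bs f).
Proof.
move=> f0; elim: bs => // b bs [mg g0]; split=> [|z] /=; last exact: integral_ge0.
have mF : measurable_fun setT (fun p : V * R => gsmooth bs f (tshift p.1 p.2 b)).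
  by apply: (measurableT_comp mg); exact: measurable_tshift.
exact: (measurable_fun_fubini_tonelli_F (m2 := gam) _ mF).
Qed.

Lemma gsmooth_cat bs cs f : gsmooth (bs ++ cs) f = gsmooth bs (gsmooth cs f).
Proof. exact: foldr_cat. Qed.

Lemma gsmooth_le bs f g : nnmeas f -> nnmeas g -> (forall z, (f z <= g z)%E) ->
  forall z, (gsmooth bs f z <= gsmooth bs g z)%E.
Proof.
move=> f0 g0 fg; elim: bs => //= b bs IH z.
have mf := nnmeas_gsmooth bs f0; have mg := nnmeas_gsmooth bs g0.
by apply: ge0_le_integral => //; [move=> x _; apply: mf.2|exact: nnmeas_line..].
Qed.

Lemma gsmoothD bs f g : nnmeas f -> nnmeas g ->
  forall z, (gsmooth bs (fun y => f y + g y) z = gsmooth bs f z + gsmooth bs g z)%E.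
Proof.
move=> f0 g0; elim: bs => //= b bs IH z.
have mf := nnmeas_gsmooth bs f0; have mg := nnmeas_gsmooth bs g0.
under eq_integral do rewrite IH.
by rewrite ge0_integralD//; [move=> x _; apply: mf.2|exact: nnmeas_line|
  move=> x _; apply: mg.2|exact: nnmeas_line].
Qed.

Lemma gsmoothZ bs f (k : R) : 0 <= k -> nnmeas f ->
  forall z, (gsmooth bs (fun y => k%:E * f y) z = k%:E * gsmooth bs f z)%E.
Proof.
move=> k0 f0; elim: bs => //= b bs IH z.
have mf := nnmeas_gsmooth bs f0.
under eq_integral do rewrite IH.
by rewrite ge0_integralZl//; [exact: nnmeas_line|move=> x _; apply: mf.2].
Qed.

Lemma gsmooth_cst bs (k : R) z : gsmooth bs (fun=> k%:E) z = k%:E.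
Proof.
elim: bs z => //= b bs IH z; under eq_integral do rewrite IH.
by rewrite (@integral_cst _ _ _ (normal_prob 0 s) setT measurableT) -[X in _ = X]mule1; congr (_ * _)%E; exact: probability_setT.
Qed.

Lemma gsmooth_tadd bs f z h : gsmooth bs (fun y => f (tadd z y)) h = gsmooth bs f (tadd z h).
Proof.
elim: bs h => //= b bs IH h; apply: eq_integral => x _.
by rewrite IH tshift_add.
Qed.

Lemma gsmooth1C b c f : nnmeas f ->
  gsmooth [:: b; c] f = gsmooth [:: c; b] f.
Proof.
move=> [mf f0]; apply/funext => z /=.
have mF : measurable_fun setT (fun p : R * R => f (tshift (tshift z p.1 b) p.2 c)).
  by apply: (measurableT_comp mf); exact: measurable_tshift2.
have F0 (p : R * R) : (0 <= f (tshift (tshift z p.1 b) p.2 c))%E by [].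
have := @fubini_tonelli _ _ mR mR R gam gam _ mF F0.
move=> ->; apply: eq_integral => y _; apply: eq_integral => x _ /=.
by rewrite tshiftC.
Qed.

(** Tonelli for two directions, extended by induction on both lists. Commutation lets small steps be
    regrouped and exchanged one by one. *)
Lemma gsmoothC bs cs f : nnmeas f ->
  gsmooth bs (gsmooth cs f) = gsmooth cs (gsmooth bs f).
Proof.
move=> f0; elim: bs => // b bs IH.
rewrite -[LHS]/(gsmooth [:: b] (gsmooth bs (gsmooth cs f))) IH.
rewrite -[gsmooth (b :: bs) f]/(gsmooth [:: b] (gsmooth bs f)).
have : nnmeas (gsmooth bs f) by exact: nnmeas_gsmooth.
move: (gsmooth bs f) => {IH bs f f0} f f0.
elim: cs => // c cs IH.
rewrite -[gsmooth (c :: cs) f]/(gsmooth [:: c] (gsmooth cs f)).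
rewrite -gsmooth_cat gsmooth1C; last exact: nnmeas_gsmooth.
by rewrite -/([:: c] ++ [:: b]) gsmooth_cat IH.
Qed.

Lemma gsmooth_half1 b f : nnmeas f ->
  let c := fun i => (Num.sqrt 2)^-1 * b i in
  gsmooth [:: c; c] f = gsmooth [:: b] f.
Proof.
move=> f0 c; apply/funext => z /=.
have r2 : Num.sqrt 2 != 0 :> R by rewrite gt_eqF// sqrtr_gt0.
pose G (x : R) := f (tshift z x c).
have mG : measurable_fun setT G by exact: nnmeas_line.
transitivity (\int[gam]_x \int[gam]_y G (x + y)%R)%E.
  apply: eq_integral => x _; apply: eq_integral => y _; congr f.
  by apply: eq_from_tnth => i; rewrite !tnth_mktuple mulrDl addrA.
rewrite ge0_integral_normal_add//; last by move=> x; exact: f0.2.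
apply: eq_integral => x _; congr f.
apply: eq_from_tnth => i; rewrite !tnth_mktuple /c.
by rewrite mulrA [_ * x]mulrC mulfK.
Qed.

Lemma gsmooth_half bs f : nnmeas f ->
  let cs := scale_dirs (Num.sqrt 2)^-1 bs in
  gsmooth cs (gsmooth cs f) = gsmooth bs f.
Proof.
move=> f0 /=; elim: bs => // b bs IH.
pose c := fun i => (Num.sqrt 2)^-1 * b i; pose cs := scale_dirs (Num.sqrt 2)^-1 bs.
rewrite -[scale_dirs _ (b :: bs)]/([:: c] ++ cs) -[in RHS]/([:: b] ++ bs) !gsmooth_cat.
rewrite [gsmooth cs (gsmooth [:: c] _)]gsmoothC; last exact: nnmeas_gsmooth.
rewrite IH -gsmooth_cat /=.
exact/gsmooth_half1/nnmeas_gsmooth.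
Qed.

Lemma scale_dirsM (e e' : R) bs : scale_dirs e (scale_dirs e' bs) = scale_dirs (e * e') bs.
Proof.
by rewrite /scale_dirs -map_comp; apply: eq_map => b /=; apply/funext => i; rewrite mulrA.
Qed.

Lemma scale_dirs1 bs : scale_dirs 1 bs = bs.
Proof.
by rewrite -[RHS]map_id; apply: eq_map => b /=; apply/funext => i; rewrite mul1r.
Qed.

Lemma nnmeas_iter bs f k : nnmeas f -> nnmeas (iter k (gsmooth bs) f).
Proof. by move=> f0; elim: k => // k IH; exact: nnmeas_gsmooth. Qed.

(** The subdivision into small steps: directions scaled by 2^(-j/2) carry the fraction 2^-j of the
    covariance, and 2^j such smoothings compose to the original one by repeated halving. *)
Lemma gsmooth_iter j bs f : nnmeas f ->
  iter (2 ^ j) (gsmooth (scale_dirs (Num.sqrt 2 ^- j) bs)) f = gsmooth bs f.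
Proof.
move=> f0; elim: j => [|j IH]; first by rewrite expr0 invr1 scale_dirs1.
rewrite -{}IH expnS mulnC iterM; elim: (2 ^ j)%N => //= k ->.
rewrite exprS invfM -scale_dirsM gsmooth_half//.
exact: nnmeas_iter.
Qed.

Lemma gsmooth_topp bs f z : nnmeas f ->
  gsmooth bs (fun y => f (topp y)) z = gsmooth bs f (topp z).
Proof.
move=> f0; elim: bs z => //= b bs IH z.
under eq_integral do rewrite IH.
have mf := nnmeas_gsmooth bs f0.
rewrite -[RHS]ge0_integral_normal_opp//; last 2 first.
- exact: nnmeas_line.
- by move=> x; exact: mf.2.
apply: eq_integral => x _; congr gsmooth.
by apply: eq_from_tnth => i; rewrite !tnth_mktuple opprD mulNr.
Qed.

End GaussianSmoothing.

(** * Second moments and quadratic exponentials *)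

Section GaussianMoments.
Context {R : realType} (s : R) (s_gt0 : 0 < s) (N : nat).
Local Notation V := (N.-tuple R).
Local Notation gam := (normal_prob 0 s).
Implicit Types (z h : V) (x : R) (b c : 'I_N -> R) (bs cs : seq ('I_N -> R)).
Implicit Types (f g : V -> \bar R).

Let s_neq0 : s != 0. Proof. by rewrite gt_eqF. Qed.

Lemma ge0_integral_normalZl (k : R) (G : R -> \bar R) : 0 <= k ->
  measurable_fun setT G -> (forall x, (0 <= G x)%E) ->
  (\int[gam]_x (k%:E * G x) = k%:E * \int[gam]_x G x)%E.
Proof. by move=> k0 mG G0; rewrite ge0_integralZl. Qed.

Lemma ge0_integral_normalD (F G : R -> \bar R) :
  measurable_fun setT F -> (forall x, (0 <= F x)%E) ->
  measurable_fun setT G -> (forall x, (0 <= G x)%E) ->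
  (\int[gam]_x (F x + G x) = \int[gam]_x F x + \int[gam]_x G x)%E.
Proof. by move=> mF F0 mG G0; rewrite ge0_integralD. Qed.

Lemma integral_normal_cst (k : R) : (\int[gam]_x k%:E = k%:E)%E.
Proof. exact: (@gsmooth_cst _ s 1 [:: fun=> 0] _ (tzero 1)). Qed.

(** The variance, kept as a symbol: it multiplies the second-order terms on both sides of the
    comparison alike, where its finiteness and sign are what counts. *)
Definition normal_moment2 : R := fine (\int[gam]_x (x ^+ 2)%:E)%E.
Local Notation v := normal_moment2.

Let measurable_sqr (p q : R) : measurable_fun setT (fun x : R => ((p + x * q) ^+ 2)%:E).
Proof.
apply/measurable_EFinP; apply: measurable_funX.
by apply: measurable_funD => //; exact: measurable_funM.
Qed.

Lemma integral_normal_sqr : (\int[gam]_x (x ^+ 2)%:E = v%:E)%E.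
Proof.
(* This choice gives 2 a s^2 = 1/2, so that exp (a x^2), which dominates a x^2, has a finite
   mean. *)
pose a := (4 * s ^+ 2)^-1.
have s2 : 0 < s ^+ 2 by rewrite exprn_gt0.
have a0 : 0 < a by rewrite invr_gt0 mulr_gt0.
have as1 : a * s ^+ 2 *+ 2 < 1.
  rewrite /a (_ : _ *+ 2 = 2^-1); last by field; rewrite gt_eqF.
  by lra.
have mx : measurable_fun setT (fun x : R => (x ^+ 2)%:E).
  by apply/measurable_EFinP; exact: measurable_funX.
have me : measurable_fun setT (fun x : R => (expR (a * x ^+ 2))%:E).
  apply/measurable_EFinP; apply: measurableT_comp => //.
  by apply: measurable_funM => //; exact: measurable_funX.
rewrite /v fineK// ge0_fin_numE; last by apply: integral_ge0 => x _; rewrite lee_fin sqr_ge0.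
apply: (@le_lt_trans _ _ (\int[gam]_x ((a^-1)%:E * (expR (a * x ^+ 2))%:E))%E).
  apply: ge0_le_integral => //.
  - by move=> x _; rewrite lee_fin sqr_ge0.
  - exact: emeasurable_funM.
  - move=> x _; rewrite -EFinM lee_fin mulrC ler_pdivlMr// mulrC.
    by apply: le_trans (expR_ge1Dx _); rewrite lerDr.
rewrite ge0_integral_normalZl//; last by rewrite invr_ge0 ltW.
by rewrite integral_normal_expR_sqr// -EFinM ltry.
Qed.

Lemma normal_moment2_ge0 : 0 <= v.
Proof. by rewrite -lee_fin -integral_normal_sqr; apply: integral_ge0 => x _; rewrite lee_fin sqr_ge0. Qed.

(** The cross term 2 p q x has no sign, so the integrand is added to its reflection at x -> -x,
    where the cross terms cancel. *)
Lemma integral_normal_affine_sqr p q :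
  (\int[gam]_x ((p + x * q) ^+ 2)%:E = (p ^+ 2 + v * q ^+ 2)%:E)%E.
Proof.
set I := (LHS).
have mx : measurable_fun setT (fun x : R => (x ^+ 2)%:E).
  by apply/measurable_EFinP; exact: measurable_funX.
have hI : I = (\int[gam]_x ((p - x * q) ^+ 2)%:E)%E.
  rewrite /I -(@ge0_integral_normal_opp _ s (fun x => ((p + x * q) ^+ 2)%:E))//;
    last by move=> x; rewrite lee_fin sqr_ge0.
  by apply: eq_integral => x _; rewrite mulNr.
have mN : measurable_fun setT (fun x : R => ((p - x * q) ^+ 2)%:E).
  by under eq_fun do rewrite -mulrN; exact: measurable_sqr.
have : (I + I = (2 * (p ^+ 2 + v * q ^+ 2))%:E)%E.
  rewrite [X in (_ + X)%E = _]hI -ge0_integral_normalD//; last 2 first.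
  - by move=> x; rewrite lee_fin sqr_ge0.
  - by move=> x; rewrite lee_fin sqr_ge0.
  transitivity (\int[gam]_x ((2 * p ^+ 2)%:E + (2 * q ^+ 2)%:E * (x ^+ 2)%:E))%E.
    by apply: eq_integral => x _; rewrite -EFinM -!EFinD; congr EFin; ring.
  have sq0 x : (0 <= (x ^+ 2)%:E)%E by rewrite lee_fin sqr_ge0.
  have q0 : 0 <= 2 * q ^+ 2 by rewrite mulr_ge0 ?sqr_ge0.
  have p0 (x : R) : (0 <= cst (2 * p ^+ 2)%:E x)%E by rewrite lee_fin mulr_ge0 ?sqr_ge0.
  have mq := emeasurable_funM (measurable_cst (2 * q ^+ 2)%:E) mx.
  have qx0 (x : R) : (0 <= (2 * q ^+ 2)%:E * (x ^+ 2)%:E)%E by rewrite mule_ge0.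
  rewrite (ge0_integral_normalD (measurable_cst _) p0 mq qx0).
  rewrite (ge0_integral_normalZl q0 mx sq0).
  by rewrite integral_normal_sqr integral_normal_cst -EFinM -EFinD; congr EFin; ring.
have I0 : (0 <= I)%E by apply: integral_ge0 => x _; rewrite lee_fin sqr_ge0.
move=> h; clearbody I; case: I I0 h {hI} => [r|//|//] _.
by rewrite -EFinD => -[] h; congr EFin; lra.
Qed.

Lemma measurable_lin (w : 'I_N -> R) :
  measurable_fun setT (fun z : V => \sum_i w i * tnth z i).
Proof.
apply: measurable_sum => i; apply: measurable_funM => //.
exact: measurable_tnth.
Qed.

Lemma nnmeas_sqr (w : 'I_N -> R) : nnmeas (fun z : V => ((\sum_i w i * tnth z i) ^+ 2)%:E).
Proof.
split=> [|z]; last by rewrite lee_fin sqr_ge0.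
by apply/measurable_EFinP; apply: measurable_funX; exact: measurable_lin.
Qed.

Lemma gsmooth_sqr bs (w : 'I_N -> R) z :
  gsmooth s bs (fun z => ((\sum_i w i * tnth z i) ^+ 2)%:E) z =
  ((\sum_i w i * tnth z i) ^+ 2 + v * \sum_(b <- bs) (\sum_i w i * b i) ^+ 2)%:E.
Proof.
elim: bs z => [|b bs IH] z; first by rewrite big_nil mulr0 addr0.
rewrite /= ; under eq_integral do rewrite IH EFinD.
rewrite ge0_integral_normalD//; last 3 first.
- exact: (nnmeas_line _ _ (nnmeas_sqr w)).
- by move=> x; rewrite lee_fin sqr_ge0.
- move=> x; rewrite lee_fin mulr_ge0 ?normal_moment2_ge0//.
  by apply: sumr_ge0 => *; rewrite sqr_ge0.
rewrite integral_normal_cst.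
transitivity (((\sum_i w i * tnth z i) ^+ 2 + v * (\sum_i w i * b i) ^+ 2)%:E +
   (v * \sum_(b <- bs) (\sum_i w i * b i) ^+ 2)%:E)%E; last first.
  by rewrite -EFinD big_cons mulrDr addrA.
congr (_ + _)%E.
rewrite -integral_normal_affine_sqr; apply: eq_integral => x _; congr ((_ ^+ 2)%:E).
rewrite mulr_sumr -big_split/=; apply: eq_bigr => i _.
by rewrite tnth_mktuple; ring.
Qed.

Definition tshifts z (l : seq (R * ('I_N -> R))) : V :=
  foldl (fun z p => tshift z p.1 p.2) z l.

Lemma tnth_tshifts z l i : tnth (tshifts z l) i = tnth z i + \sum_(p <- l) p.1 * p.2 i.
Proof.
elim: l z => [|p l IH] z /=; first by rewrite big_nil addr0.
by rewrite [LHS]IH big_cons tnth_mktuple addrA.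
Qed.

Lemma gsmooth_le_quad (l : seq (R * ('I_N -> R))) f z (C : R) :
  nnmeas f -> 0 <= C ->
  (forall p, p \in [seq p.1 | p <- l] -> p * s ^+ 2 *+ 2 < 1) ->
  (forall xs : seq R, size xs = size l ->
    (f (tshifts z (zip xs [seq p.2 | p <- l])) <=
     (C * expR (\sum_(p <- zip xs [seq p.1 | p <- l]) p.2 * p.1 ^+ 2))%:E)%E) ->
  (gsmooth s [seq p.2 | p <- l] f z <=
   (C * \prod_(p <- l) (Num.sqrt (1 - p.1 * s ^+ 2 *+ 2))^-1)%:E)%E.
Proof.
move=> f0; elim: l z C => [|[a b] l IH] z C C0 la H /=.
  by rewrite big_nil; have := H [::] erefl; rewrite big_nil expR0.
have mf := nnmeas_gsmooth s [seq p.2 | p <- l] f0.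
pose D : R := \prod_(p <- l) (Num.sqrt (1 - p.1 * s ^+ 2 *+ 2))^-1.
have D0 : 0 <= D by apply: prodr_ge0 => p _; rewrite invr_ge0 sqrtr_ge0.
apply: (@le_trans _ _ (\int[gam]_x ((C * D)%:E * (expR (a * x ^+ 2))%:E))%E).
  apply: ge0_le_integral => //.
  - by move=> x _; exact: mf.2.
  - exact: nnmeas_line.
  - apply: emeasurable_funM => //; apply/measurable_EFinP; apply: measurableT_comp => //.
    by apply: measurable_funM => //; exact: measurable_funX.
  move=> x _; rewrite -EFinM mulrAC; apply: IH.
  - by rewrite mulr_ge0 ?expR_ge0.
  - by move=> p pl; apply: la; rewrite inE pl orbT.
  - move=> xs sxs; have := H (x :: xs); rewrite /= sxs => /(_ erefl) /le_trans; apply.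
    by rewrite big_cons/= expRD mulrA.
have me : measurable_fun setT (fun x : R => (expR (a * x ^+ 2))%:E).
  apply/measurable_EFinP; apply: measurableT_comp => //.
  by apply: measurable_funM => //; exact: measurable_funX.
rewrite (ge0_integral_normalZl (mulr_ge0 C0 D0) me); last first.
  by move=> x; rewrite lee_fin expR_ge0.
rewrite integral_normal_expR_sqr//; last by apply: la; rewrite inE eqxx.
by rewrite -EFinM lee_fin big_cons/= -/D -mulrA [D * _]mulrC.
Qed.

End GaussianMoments.

(** * Slepian's comparison for a soft maximum *)

Section Taylor.
Context {R : realType}.
Implicit Types x y : R.

Lemma expR_sub1_le x : `|expR x - 1| <= `|x| * expR `|x|.
Proof.
have key y : expR y - 1 <= y * expR y.
  have := expR_ge1Dx (- y); rewrite expRN => h.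
  have e0 := expR_gt0 y.
  rewrite -(ler_pM2r e0) mulVf ?gt_eqF// in h; nra.
have [x0|x0] := leP 0 x.
  by rewrite !ger0_norm// ?key// subr_ge0 -expR0 ler_expR.
rewrite !ltr0_norm//; last by rewrite subr_lt0 expR_lt1.
have := expR_ge1Dx x; have := expR_ge1Dx (- x) => h1 h2; nra.
Qed.

Lemma expR_taylor1_ge0 x : 0 <= expR x - 1 - x.
Proof. have := expR_ge1Dx x; lra. Qed.

Lemma expR_taylor1 x : `|expR x - 1 - x| <= `|x| ^+ 2 * expR `|x|.
Proof.
rewrite ger0_norm ?expR_taylor1_ge0//.
have h : expR x - 1 <= x * expR x.
  have := expR_ge1Dx (- x); rewrite expRN => h.
  have e0 := expR_gt0 x.
  rewrite -(ler_pM2r e0) mulVf ?gt_eqF// in h; nra.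
apply: (@le_trans _ _ (x * (expR x - 1))); first lra.
apply: (le_trans (ler_norm _)); rewrite normrM expr2 -mulrA.
by rewrite ler_wpM2l ?expR_sub1_le.
Qed.

(** The mean value theorem for exp y - 1 - y - y^2 / 2, whose derivative is the first-order
    remainder bounded in [expR_taylor1]. *)
Lemma expR_taylor2 x : `|expR x - 1 - x - x ^+ 2 / 2| <= `|x| ^+ 3 * expR `|x|.
Proof.
pose g y := expR y - 1 - y - y ^+ 2 / 2.
have dg y : is_derive y 1 g (expR y - 1 - y).
  rewrite /g; apply: is_derive_eq; rewrite /GRing.scale/=; lra.
have cg a b : {within `[a, b], continuous g}.
  apply: continuous_subspaceT => t; apply: differentiable_continuous.
  by apply/derivable1_diffP; exact: ex_derive.
have g0 : g 0 = 0 by rewrite /g expR0; ring.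
have bnd c : `|c| <= `|x| -> `|expR c - 1 - c| <= `|x| ^+ 2 * expR `|x|.
  move=> cx; apply: (le_trans (expR_taylor1 c)); apply: ler_pM => //.
  - by rewrite ler_pXn2r// nnegrE.
  - by rewrite ler_expR.
rewrite -[X in `|X|]/(g x).
suff [c cx ->] : exists2 c, `|c| <= `|x| & g x = (expR c - 1 - c) * x.
  by rewrite normrM exprSr mulrAC ler_wpM2r// bnd.
have [x0|x0] := leP 0 x.
  have [c /[!in_itv]/= /andP[c0 cx]] := MVT_segment x0 (fun y _ => dg y) (cg _ _).
  rewrite g0 !subr0 => ->; exists c => //.
  by rewrite !ger0_norm.
have [c /[!in_itv]/= /andP[c0 cx]] := MVT_segment (ltW x0) (fun y _ => dg y) (cg _ _).
rewrite g0 !sub0r mulrN => /oppr_inj ->; exists c => //.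
by rewrite !ler0_norm// ?lerN2// ltW.
Qed.

(** Dividing the last hypothesis by exp L gives sum_i p_i exp (y_i - L) = 1. Its first-order
    expansion yields L - m1 = O(rho^2), its second-order one L = m1 + (m2 - m1^2) / 2 + O(rho^3),
    without differentiating a logarithm. *)
Lemma logsumexp_taylor (I : finType) (p y : I -> R) (rho alpha L : R) :
  (forall i, 0 <= p i) -> \sum_i p i = 1 -> (forall i, `|y i| <= rho) ->
  0 <= alpha -> alpha <= 1 -> \sum_i p i * expR (y i) = expR L ->
  `|expR (alpha * L) - (1 + alpha * (\sum_i p i * y i) +
     alpha / 2 * (\sum_i p i * y i ^+ 2 - (1 - alpha) * (\sum_i p i * y i) ^+ 2))|
  <= 17 * rho ^+ 3 * expR (2 * rho).
Proof.
move=> p0 p1 yr a0 a1 LE.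
have r0 : 0 <= rho.
  have [i _|no] := pickP (fun i : I => true); first exact: le_trans (yr i).
  by move: p1; rewrite big_pred0// => /eqP; rewrite eq_sym oner_eq0.
have wavg (u v : I -> R) : (forall i, u i <= v i) -> \sum_i p i * u i <= \sum_i p i * v i.
  by move=> uv; apply: ler_sum => i _; rewrite ler_wpM2l.
have wcst (c : R) : \sum_i p i * c = c by rewrite -mulr_suml p1 mul1r.
have Lr : `|L| <= rho.
  rewrite ler_norml -(ler_expR (- rho)) -(ler_expR L) -LE; apply/andP; split.
    rewrite -[leLHS]wcst; apply: wavg => i; rewrite ler_expR.
    by have := yr i; rewrite ler_norml => /andP[].
  rewrite -[leRHS]wcst; apply: wavg => i; rewrite ler_expR.
  by have := yr i; rewrite ler_norml => /andP[].
set m1 := \sum_i p i * y i; set m2 := \sum_i p i * y i ^+ 2; set e := expR (2 * rho).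
have e1 : 1 <= e by rewrite /e -expR0 ler_expR mulr_ge0.
have yL i : `|y i - L| <= 2 * rho.
  by apply: (le_trans (ler_normB _ _)); rewrite mulrDl mul1r lerD.
have wnorm (u : I -> R) (c : R) : (forall i, `|u i| <= c) -> `|\sum_i p i * u i| <= c.
  move=> uc; apply: (le_trans (ler_norm_sum _ _ _)); rewrite -[leRHS]wcst.
  by apply: ler_sum => i _; rewrite normrM ger0_norm// ler_wpM2l.
have ebd i : expR `|y i - L| <= e by rewrite ler_expR.
have expL : \sum_i p i * expR (y i - L) = 1.
  under eq_bigr do rewrite expRD mulrA.
  by rewrite -mulr_suml LE -expRD subrr expR0.
have LmE : L - m1 = \sum_i p i * (expR (y i - L) - 1 - (y i - L)).
  transitivity (\sum_i (p i * expR (y i - L) - p i * 1 - (p i * y i - p i * L))).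
    by rewrite !sumrB expL !wcst /m1; ring.
  by apply: eq_bigr => i _; ring.
have A : `|L - m1| <= 4 * rho ^+ 2 * e.
  rewrite LmE; apply: wnorm => i; apply: (le_trans (expR_taylor1 _)); apply: ler_pM => //.
  - rewrite (_ : 4 * rho ^+ 2 = (2 * rho) ^+ 2); last by ring.
    by rewrite ler_pXn2r// nnegrE mulr_ge0.
pose B := \sum_i p i * (expR (y i - L) - 1 - (y i - L) - (y i - L) ^+ 2 / 2).
have BE : L - m1 = B + (m2 - 2 * L * m1 + L ^+ 2) / 2.
  have S2 : \sum_i p i * (y i - L) ^+ 2 = m2 - 2 * L * m1 + L ^+ 2.
    rewrite -[in RHS](wcst (L ^+ 2)) /m1 /m2 mulr_sumr -sumrB -big_split/=.
    by apply: eq_bigr => i _; ring.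
  have -> : B = \sum_i p i * (expR (y i - L) - 1 - (y i - L)) - (\sum_i p i * (y i - L) ^+ 2) / 2.
    by rewrite mulr_suml -sumrB; apply: eq_bigr => i _; lra.
  by rewrite LmE S2; lra.
have Bb : `|B| <= 8 * rho ^+ 3 * e.
  apply: wnorm => i; apply: (le_trans (expR_taylor2 _)); apply: ler_pM => //.
  - rewrite (_ : 8 * rho ^+ 3 = (2 * rho) ^+ 3); last by ring.
    by rewrite ler_pXn2r// nnegrE mulr_ge0.
have m1r : `|m1| <= rho by exact: wnorm.
pose C := expR (alpha * L) - 1 - alpha * L - (alpha * L) ^+ 2 / 2.
have Cb : `|C| <= rho ^+ 3 * e.
  have aL : `|alpha * L| <= rho.
    rewrite normrM ger0_norm//; apply: le_trans Lr.
    by rewrite ler_piMl.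
  apply: (le_trans (expR_taylor2 _)); apply: ler_pM => //.
  - by rewrite ler_pXn2r// nnegrE.
  - by rewrite ler_expR; apply: (le_trans aL); rewrite ler_peMl// ler1n.
(* An exact identity; its four terms contribute 1, 8, 4 and 4 to the constant 17. *)
rewrite (_ : expR _ - _ = C + alpha * B + (alpha / 2 * (L - m1) ^+ 2 +
    alpha ^+ 2 / 2 * (L ^+ 2 - m1 ^+ 2))); last first.
  have -> : expR (alpha * L) = C + 1 + alpha * L + (alpha * L) ^+ 2 / 2 by rewrite /C; ring.
  have -> : B = L - m1 - (m2 - 2 * L * m1 + L ^+ 2) / 2 by rewrite BE; ring.
  by field.
have q1 : `|(L - m1) ^+ 2| <= 8 * rho ^+ 3 * e.
  rewrite expr2 normrM (_ : 8 * _ * _ = (4 * rho ^+ 2 * e) * (2 * rho)); last by ring.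
  apply: ler_pM => //; apply: (le_trans (ler_normB _ _)).
  by rewrite mulrDl mul1r lerD.
have q2 : `|L ^+ 2 - m1 ^+ 2| <= 8 * rho ^+ 3 * e.
  rewrite subr_sqr normrM (_ : 8 * _ * _ = (4 * rho ^+ 2 * e) * (2 * rho)); last by ring.
  apply: ler_pM => //; apply: (le_trans (ler_normD _ _)).
  by rewrite mulrDl mul1r lerD.
have aa : alpha ^+ 2 <= 1 by rewrite exprn_ile1.
have -> : 17 * rho ^+ 3 * e = (rho ^+ 3 * e + 1 * (8 * rho ^+ 3 * e)) +
  (1 / 2 * (8 * rho ^+ 3 * e) + 1 / 2 * (8 * rho ^+ 3 * e)) by field.
apply: (le_trans (ler_normD _ _)); apply: lerD.
  apply: (le_trans (ler_normD _ _)); apply: lerD => //.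
  by rewrite normrM ger0_norm//; apply: ler_pM.
apply: (le_trans (ler_normD _ _)); apply: lerD.
  rewrite normrM ger0_norm ?divr_ge0//; apply: ler_pM => //; first by rewrite divr_ge0.
  by rewrite ler_pM2r ?invr_gt0.
rewrite normrM ger0_norm ?divr_ge0 ?exprn_ge0//; apply: ler_pM => //.
  by rewrite divr_ge0// exprn_ge0.
by rewrite ler_pM2r ?invr_gt0.
Qed.

End Taylor.

(** * The soft maximum and its second-order expansion *)

Section SoftMax.
Context {R : realType} (s : R) (s_gt0 : 0 < s) (N : nat) (N_gt0 : (0 < N)%N).
Variables (alpha beta : R) (alpha_gt0 : 0 < alpha) (alpha_le1 : alpha <= 1) (beta_gt0 : 0 < beta).
Local Notation V := (N.-tuple R).
Local Notation v := (normal_moment2 s).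
Implicit Types (z h : V) (x : R) (b : 'I_N -> R) (bs cs : seq ('I_N -> R)).

(* With all weights equal to 1 this is a smooth approximation, up to the factor
   N ^ alpha, of exp (alpha * beta * max_a z_a). *)
Definition softmax (p : 'I_N -> R) z : R :=
  expR (alpha * ln (\sum_a p a * expR (beta * tnth z a))).

Definition gibbs z (a : 'I_N) : R :=
  expR (beta * tnth z a) / \sum_c expR (beta * tnth z c).

Let sum_expR_gt0 z : 0 < \sum_a expR (beta * tnth z a).
Proof.
rewrite (bigD1 (Ordinal N_gt0))//= ltr_wpDr ?expR_gt0//.
by apply: sumr_ge0 => *; exact: expR_ge0.
Qed.

Lemma gibbs_ge0 z a : 0 <= gibbs z a.
Proof. by rewrite divr_ge0 ?expR_ge0// ltW. Qed.

Lemma gibbs_sum z : \sum_a gibbs z a = 1.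
Proof. by rewrite -mulr_suml divff// gt_eqF. Qed.

Lemma nnmeas_softmax p : nnmeas (EFin \o softmax p).
Proof.
split=> [|z]; last by rewrite lee_fin expR_ge0.
apply/measurable_EFinP; apply: measurableT_comp => //.
apply: measurable_funM => //; apply: measurableT_comp; first exact: measurable_ln.
apply: measurable_sum => a; apply: measurable_funM => //.
apply: measurableT_comp => //; apply: measurable_funM => //.
exact: measurable_tnth.
Qed.

(** The exponentials multiply, and normalizing those at z yields Gibbs weights. Every step thus
    restarts at the origin with probability weights, and bounds uniform in such weights become
    relative bounds uniform in z. *)
Lemma softmax_tadd z h :
  softmax (fun=> 1) (tadd z h) = softmax (fun=> 1) z * softmax (gibbs z) h.
Proof.
rewrite /softmax -expRD -mulrDr -lnM.
- congr (expR (_ * ln _)); rewrite mulr_sumr; apply: eq_bigr => a _.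
  rewrite tnth_mktuple mul1r mulrDr expRD /gibbs.
  under eq_bigr do rewrite mul1r.
  by rewrite mulrA mulrCA divff ?mulr1// gt_eqF.
- by rewrite posrE; under eq_bigr do rewrite mul1r.
rewrite posrE (bigD1 (Ordinal N_gt0))//= ltr_wpDr//.
  by apply: sumr_ge0 => a _; rewrite mulr_ge0 ?gibbs_ge0 ?expR_ge0.
by rewrite mulr_gt0 ?expR_gt0// divr_gt0 ?expR_gt0.
Qed.

(** The error of [logsumexp_taylor] with rho = beta times the l1 norm of h, which bounds every |beta
    h_a| and does not depend on the weights. *)
Definition remainder h : R :=
  17 * (beta * \sum_a `|tnth h a|) ^+ 3 * expR (2 * (beta * \sum_a `|tnth h a|)).

Lemma remainder_ge0 h : 0 <= remainder h.
Proof.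
rewrite /remainder mulr_ge0 ?expR_ge0// mulr_ge0// exprn_ge0// mulr_ge0 ?(ltW beta_gt0)//.
by apply: sumr_ge0.
Qed.

Lemma nnmeas_remainder : nnmeas (EFin \o remainder).
Proof.
split=> [|z]; last by rewrite lee_fin remainder_ge0.
have mr : measurable_fun setT (fun h : V => beta * \sum_a `|tnth h a|).
  apply: measurable_funM => //; apply: measurable_sum => a.
  by apply: measurableT_comp => //; exact: measurable_tnth.
apply/measurable_EFinP; apply: measurable_funM.
  by apply: measurable_funM => //; exact: measurable_funX.
by apply: measurableT_comp => //; exact: measurable_funM.
Qed.

Lemma softmax_taylor (p : 'I_N -> R) h : (forall a, 0 <= p a) -> \sum_a p a = 1 ->
  `|softmax p h - (1 + alpha * beta * (\sum_a p a * tnth h a) + alpha * beta ^+ 2 / 2 *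
     (\sum_a p a * tnth h a ^+ 2 - (1 - alpha) * (\sum_a p a * tnth h a) ^+ 2))| <= remainder h.
Proof.
move=> p0 p1.
have hr a : `|beta * tnth h a| <= beta * \sum_a `|tnth h a|.
  rewrite normrM gtr0_norm// ler_pM2l// (bigD1 a)//= lerDl.
  exact: sumr_ge0.
have pos : 0 < \sum_a p a * expR (beta * tnth h a).
  rewrite lt_neqAle; apply/andP; split; last first.
    by apply: sumr_ge0 => a _; rewrite mulr_ge0 ?expR_ge0.
  rewrite eq_sym; apply/negP => /eqP/psumr_eq0P h0.
  move: p1; rewrite big1 => [/eqP|a _]; first by rewrite eq_sym oner_eq0.
  have /eqP := h0 (fun a _ => mulr_ge0 (p0 a) (expR_ge0 _)) a isT.
  by rewrite mulf_eq0 expR_eq0 orbF => /eqP.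
have := @logsumexp_taylor _ _ p (fun a => beta * tnth h a) _ alpha
  (ln (\sum_a p a * expR (beta * tnth h a))) p0 p1 hr (ltW alpha_gt0) alpha_le1.
rewrite lnK// => /(_ erefl); rewrite /remainder; apply: le_trans.
rewrite le_eqVlt; apply/orP; left; apply/eqP; congr (`|_ - _|).
have -> : \sum_i p i * (beta * tnth h i) = beta * \sum_a p a * tnth h a.
  by rewrite mulr_sumr; apply: eq_bigr => a _; ring.
have -> : \sum_i p i * (beta * tnth h i) ^+ 2 = beta ^+ 2 * \sum_a p a * tnth h a ^+ 2.
  by rewrite mulr_sumr; apply: eq_bigr => a _; ring.
by field.
Qed.

(** Adding the values at h and -h removes the linear term, which has no sign and does not fit among
    nonnegative integrands. *)
Lemma softmax_taylor_sym (p : 'I_N -> R) h : (forall a, 0 <= p a) -> \sum_a p a = 1 ->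
  `|(softmax p h + softmax p (topp h)) - (2 + alpha * beta ^+ 2 *
     (\sum_a p a * tnth h a ^+ 2 - (1 - alpha) * (\sum_a p a * tnth h a) ^+ 2))|
  <= 2 * remainder h.
Proof.
move=> p0 p1; have h1 := softmax_taylor h p0 p1; have h2 := softmax_taylor (topp h) p0 p1.
have rN : remainder (topp h) = remainder h.
  by rewrite /remainder; under eq_bigr do rewrite tnth_mktuple normrN.
rewrite rN in h2.
have e1 : \sum_a p a * tnth (topp h) a = - \sum_a p a * tnth h a.
  by rewrite -sumrN; apply: eq_bigr => a _; rewrite tnth_mktuple mulrN.
have e2 : \sum_a p a * tnth (topp h) a ^+ 2 = \sum_a p a * tnth h a ^+ 2.
  by apply: eq_bigr => a _; rewrite tnth_mktuple sqrrN.
rewrite e1 e2 sqrrN in h2.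
rewrite mulr_natl mulr2n; apply: le_trans (lerD h1 h2); apply: le_trans (ler_normD _ _).
rewrite le_eqVlt; apply/orP; left; apply/eqP; congr (`|_|).
move: (softmax p h) (softmax p (topp h)) (\sum_a p a * tnth h a)
  (\sum_a p a * tnth h a ^+ 2) => S1 S2 m1 m2.
by field.
Qed.

(** Times s^2, the covariance matrix of sum_k X_k b_k for independent N(0,s^2) variables X_k. *)
Definition gram bs (a c : 'I_N) : R := \sum_(b <- bs) b a * b c.

Lemma gram_quad bs (p : 'I_N -> R) :
  \sum_(b <- bs) (\sum_a p a * b a) ^+ 2 = \sum_a \sum_c p a * p c * gram bs a c.
Proof.
transitivity (\sum_(b <- bs) \sum_a \sum_c p a * p c * (b a * b c)).
  apply: eq_bigr => b _; rewrite expr2 mulr_suml; apply: eq_bigr => a _.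
  by rewrite mulr_sumr; apply: eq_bigr => c _; ring.
rewrite exchange_big; apply: eq_bigr => a _; rewrite exchange_big; apply: eq_bigr => c _.
by rewrite -mulr_sumr.
Qed.

Lemma gram_scale e bs (a c : 'I_N) : gram (scale_dirs e bs) a c = e ^+ 2 * gram bs a c.
Proof. by rewrite /gram big_map mulr_sumr; apply: eq_bigr => b _; ring. Qed.

Lemma gsmooth_coord_sqr bs (p : 'I_N -> R) : (forall a, 0 <= p a) ->
  (gsmooth s bs (fun h => (\sum_a p a * tnth h a ^+ 2)%:E) (tzero N) =
   (v * \sum_a p a * gram bs a a)%:E)%E.
Proof.
move=> p0.
pose q a : V -> \bar R := fun h => ((\sum_c (if c == a then 1 else 0) * tnth h c) ^+ 2)%:E.
have q0 a : nnmeas (q a) by exact: nnmeas_sqr.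
have qE h : (\sum_a p a * tnth h a ^+ 2)%:E = (\sum_a (p a)%:E * q a h)%E.
  rewrite -sumEFin; apply: eq_bigr => a _; rewrite -EFinM; congr (_ * _ ^+ 2)%:E.
  rewrite (bigD1 a)//= eqxx mul1r big1 ?addr0// => c /negbTE ->.
  by rewrite mul0r.
under eq_fun do rewrite qE.
have -> : forall r : seq 'I_N, gsmooth s bs (fun h => \sum_(a <- r) (p a)%:E * q a h)%E (tzero N) =
   (v * \sum_(a <- r) p a * gram bs a a)%:E; last by [].
elim=> [|a r IH].
  under eq_fun do rewrite big_nil.
  by rewrite big_nil mulr0; exact: gsmooth_cst.
under eq_fun do rewrite big_cons.
have nq c : nnmeas (fun h => (p c)%:E * q c h)%E.
  split=> [|z]; last by apply: mule_ge0; [rewrite lee_fin|exact: (q0 c).2].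
  by apply: emeasurable_funM => //; exact: (q0 c).1.
rewrite gsmoothD//; last first.
  split=> [|z]; last by apply: sume_ge0 => c _; exact: (nq c).2.
  by apply: emeasurable_sum => c; exact: (nq c).1.
rewrite IH gsmoothZ// gsmooth_sqr// -EFinM -EFinD big_cons; congr EFin.
rewrite [RHS]mulrDr; congr (_ + _).
rewrite big1 ?expr0n/= ?add0r; last by move=> c _; rewrite tnth_mktuple mulr0.
rewrite mulrCA; congr (_ * (_ * _)); apply: eq_bigr => b _.
rewrite (bigD1 a)//= eqxx mul1r big1 ?addr0// => c /negbTE ->.
by rewrite mul0r.
Qed.

Lemma gsmooth_lin_sqr bs (p : 'I_N -> R) :
  (gsmooth s bs (fun h => ((\sum_a p a * tnth h a) ^+ 2)%:E) (tzero N) =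
   (v * \sum_a \sum_c p a * p c * gram bs a c)%:E)%E.
Proof.
rewrite gsmooth_sqr// -gram_quad big1 ?expr0n/= ?add0r// => a _.
by rewrite tnth_mktuple mulr0.
Qed.

End SoftMax.

Section RemainderBound.
Context {R : realType} (s : R) (s_gt0 : 0 < s) (N : nat) (N_gt0 : (0 < N)%N).
Variables (alpha beta : R) (alpha_gt0 : 0 < alpha) (alpha_le1 : alpha <= 1) (beta_gt0 : 0 < beta).
Local Notation V := (N.-tuple R).
Local Notation v := (normal_moment2 s).
Local Notation softmax := (softmax alpha beta).
Implicit Types (z h : V) (x : R) (b : 'I_N -> R) (bs cs : seq ('I_N -> R)).

Let l1 b : R := \sum_a `|b a|.
Let l1_ge0 b : 0 <= l1 b. Proof. exact: sumr_ge0. Qed.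

Lemma l1_tshifts (l : seq (R * ('I_N -> R))) z :
  \sum_a `|tnth (tshifts z l) a| <= \sum_a `|tnth z a| + \sum_(p <- l) `|p.1| * l1 p.2.
Proof.
elim: l z => [|[x b] l IH] z /=; first by rewrite big_nil addr0.
apply: (le_trans (IH _)); rewrite big_cons addrA lerD2r/= /l1 mulr_sumr -big_split/=.
by apply: ler_sum => a _; rewrite tnth_mktuple -normrM ler_normD.
Qed.

(** For a displacement with coefficients e x_k, beta times the l1 norm is at most e S with S linear
    in the |x_k|. Since e <= 1, the factor e^3 comes out, and S^3 exp (2 S) <= 6 exp (3 S) is
    dominated by a quadratic exponential of finite Gaussian mean. *)
Lemma gsmooth_remainder_le bs : exists2 C : R, 0 <= C & forall e, 0 < e -> e <= 1 ->
  (gsmooth s (scale_dirs e bs) (EFin \o remainder beta) (tzero N) <= (C * e ^+ 3)%:E)%E.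
Proof.
pose a : R := (4 * s ^+ 2)^-1.
have s2 : 0 < s ^+ 2 by rewrite exprn_gt0.
have a0 : 0 < a by rewrite invr_gt0 mulr_gt0.
have as2 : a * s ^+ 2 *+ 2 = 2^-1 by rewrite /a; field; rewrite gt_eqF.
(* From 3 |x| B <= a x^2 + 9 B^2 / (4 a) in each direction, with B = beta * l1 b. *)
pose D : R := \sum_(b <- bs) 9 * (beta * l1 b) ^+ 2 / (4 * a).
pose K : R := \prod_(b <- bs) (Num.sqrt (1 - a * s ^+ 2 *+ 2))^-1.
have K0 : 0 <= K by apply: prodr_ge0 => *; rewrite invr_ge0 sqrtr_ge0.
(* 102 = 17 * 6, with 17 from [remainder] and 6 = 3! from S^3 <= 6 exp S. *)
exists (102 * expR D * K); first by rewrite !mulr_ge0 ?expR_ge0.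
move=> e e0 e1.
pose l := [seq (a, (fun i => e * b i)) | b <- bs].
have l2 : [seq p.2 | p <- l] = scale_dirs e bs by rewrite /l -map_comp.
have l1E : [seq p.1 | p <- l] = [seq a | b <- bs] by rewrite /l -map_comp.
have E0 : 0 <= 102 * e ^+ 3 * expR D.
  by rewrite mulr_ge0 ?expR_ge0// mulr_ge0// exprn_ge0// ltW.
have la p : p \in [seq p.1 | p <- l] -> p * s ^+ 2 *+ 2 < 1.
  by rewrite l1E => /mapP[b _ ->]; rewrite as2; lra.
rewrite -l2; apply: (le_trans (gsmooth_le_quad s_gt0 (nnmeas_remainder N beta_gt0) E0 la _)); last first.
  rewrite lee_fin big_map /= -/K le_eqVlt; apply/orP; left; apply/eqP.
  by ring.
move=> xs sxs; rewrite lee_fin l2 l1E.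
pose S := \sum_(p <- zip xs bs) `|p.1| * (beta * l1 p.2).
have S0 : 0 <= S by apply: sumr_ge0 => p _; rewrite !mulr_ge0// ltW.
have rS : beta * \sum_i `|tnth (tshifts (tzero N) (zip xs (scale_dirs e bs))) i| <= e * S.
  apply: (@le_trans _ _ (beta * \sum_(p <- zip xs (scale_dirs e bs)) `|p.1| * l1 p.2)).
    rewrite ler_pM2l//; apply: (le_trans (l1_tshifts _ _)).
    by rewrite big1 ?add0r// => i _; rewrite tnth_mktuple normr0.
  rewrite le_eqVlt; apply/orP; left; apply/eqP; rewrite /S.
  elim: xs bs {sxs S S0 D K K0 E0 l l2 l1E la} => [|x xs IH] [|b bs];
    rewrite ?big_nil ?mulr0//= !big_cons/= !mulrDr IH; congr (_ + _).
  have -> : l1 (fun i => e * b i) = e * l1 b.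
    by rewrite /l1 mulr_sumr; apply: eq_bigr => i _; rewrite normrM gtr0_norm.
  by ring.
have h3 : 3 * S <= \sum_(p <- zip xs [seq a | b <- bs]) p.2 * p.1 ^+ 2 + D.
  have : size xs = size bs by rewrite sxs size_map.
  rewrite /S /D.
  elim: xs bs {sxs S S0 D K K0 E0 l l2 l1E la rS} => [|x xs IH] [|b bs]//=;
    first by rewrite !big_nil mulr0 addr0.
  move=> [] /IH {}IH; rewrite !big_cons/= mulrDr.
  rewrite [leRHS]addrACA; apply: lerD IH.
  have : 0 <= (2 * a * `|x| - 3 * (beta * l1 b)) ^+ 2 / (4 * a).
    by rewrite divr_ge0 ?sqr_ge0// mulr_ge0// ltW.
  rewrite -[x ^+ 2]real_normK ?num_real//; move: `|x| (beta * l1 b) => X B.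
  have -> : (2 * a * X - 3 * B) ^+ 2 / (4 * a) = a * X ^+ 2 + 9 * B ^+ 2 / (4 * a) - 3 * (X * B).
    by field; rewrite gt_eqF.
  by rewrite subr_ge0.
have r0 : 0 <= beta * \sum_i `|tnth (tshifts (tzero N) (zip xs (scale_dirs e bs))) i|.
  by rewrite mulr_ge0 ?(ltW beta_gt0)//; exact: sumr_ge0.
have eS : e * S <= S by rewrite ler_piMl.
rewrite /remainder; set rho := beta * _ in rS r0 *.
apply: (@le_trans _ _ (17 * (e * S) ^+ 3 * expR (2 * S))).
  apply: ler_pM.
  - by rewrite mulr_ge0// exprn_ge0.
  - exact: expR_ge0.
  - by rewrite ler_pM2l// ler_pXn2r// nnegrE mulr_ge0// ltW.
  - by rewrite ler_expR ler_pM2l// (le_trans rS).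
have S3 : S ^+ 3 <= 6 * expR S.
  have := expR_ge1Dxn 2 S0; rewrite (_ : 3`!%:R = 6 :> R)// => h.
  rewrite -ler_pdivrMl//; apply: le_trans h; rewrite mulrC; lra.
rewrite exprMn.
apply: (@le_trans _ _ (17 * (e ^+ 3 * (6 * expR S)) * expR (2 * S))).
  by rewrite ler_pM2r ?expR_gt0// ler_pM2l// ler_pM2l ?exprn_gt0.
rewrite (_ : 17 * _ * _ = 102 * e ^+ 3 * (expR S * expR (2 * S))); last by ring.
rewrite -expRD (_ : S + 2 * S = 3 * S); last by ring.
rewrite -[leRHS]mulrA -expRD ler_pM2l ?mulr_gt0 ?exprn_gt0// ler_expR.
by rewrite addrC.
Qed.

End RemainderBound.

(** * Slepian's inequality by small steps *)

Section Slepian.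
Context {R : realType} (s : R) (s_gt0 : 0 < s) (N : nat) (N_gt0 : (0 < N)%N).
Variables (alpha beta : R) (alpha_gt0 : 0 < alpha) (alpha_le1 : alpha <= 1) (beta_gt0 : 0 < beta).
Local Notation V := (N.-tuple R).
Local Notation v := (normal_moment2 s).
Local Notation softmax := (softmax alpha beta).
Local Notation remainder := (remainder beta).
Implicit Types (z h : V) (x : R) (b : 'I_N -> R) (bs cs : seq ('I_N -> R)).

Lemma topp0 : topp (tzero N) = tzero N :> V.
Proof. by apply: eq_from_tnth => i; rewrite !tnth_mktuple oppr0. Qed.

Lemma gsmooth_topp0 bs (f : V -> \bar R) : nnmeas f ->
  gsmooth s bs (fun z => f (topp z)) (tzero N) = gsmooth s bs f (tzero N).
Proof. by move=> f0; rewrite gsmooth_topp// topp0. Qed.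

Lemma nnmeas_sumsqr (p : 'I_N -> R) : (forall a, 0 <= p a) ->
  nnmeas (fun h : V => (\sum_a p a * tnth h a ^+ 2)%:E).
Proof.
move=> p0; split=> [|z].
  apply/measurable_EFinP; apply: measurable_sum => a; apply: measurable_funM => //.
  by apply: measurable_funX; exact: measurable_tnth.
by rewrite lee_fin; apply: sumr_ge0 => a _; rewrite mulr_ge0 ?sqr_ge0.
Qed.

Lemma nnmeasD (f g : V -> \bar R) : nnmeas f -> nnmeas g -> nnmeas (fun z => f z + g z)%E.
Proof.
move=> [mf f0] [mg g0]; split=> [|z]; first exact: emeasurable_funD.
exact: adde_ge0.
Qed.

Lemma nnmeasZ (k : R) (f : V -> \bar R) : 0 <= k -> nnmeas f -> nnmeas (fun z => k%:E * f z)%E.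
Proof.
move=> k0 [mf f0]; split=> [|z]; first exact: emeasurable_funM.
exact: mule_ge0.
Qed.

Lemma nnmeas_cst (k : R) : 0 <= k -> nnmeas (fun _ : V => k%:E).
Proof. by move=> k0; split=> // z; rewrite lee_fin. Qed.

Lemma nnmeas_topp (f : V -> \bar R) : nnmeas f -> nnmeas (fun z => f (topp z)).
Proof.
by move=> [mf f0]; split=> // ; apply: (measurableT_comp mf); exact: measurable_topp.
Qed.

(** The Taylor estimate subtracts a square. Moving [kc * L] to the other side leaves nonnegative
    functions only, and the two-sided estimate is integrated as f1 <= g1 + f2 and g1 <= f1 + f2. *)
Lemma gsmooth_softmax bs (p : 'I_N -> R) (e r : R) :
  (forall a, 0 <= p a) -> \sum_a p a = 1 ->
  (gsmooth s (scale_dirs e bs) (EFin \o remainder) (tzero N) <= r%:E)%E ->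
  exists2 x : R, gsmooth s (scale_dirs e bs) (EFin \o softmax p) (tzero N) = x%:E &
  `|x - (1 + alpha * beta ^+ 2 * v * e ^+ 2 / 2 *
     (\sum_a p a * gram bs a a - (1 - alpha) * \sum_a \sum_c p a * p c * gram bs a c))| <= r.
Proof.
move=> p0 p1 hr; set ES := gsmooth _ _ (EFin \o softmax p) _.
pose k : R := alpha * beta ^+ 2; pose kc : R := k * (1 - alpha).
have k0 : 0 <= k by rewrite mulr_ge0 ?sqr_ge0// ltW.
have kc0 : 0 <= kc by rewrite mulr_ge0// subr_ge0.
pose Fm : V -> \bar R := EFin \o softmax p.
pose L : V -> \bar R := fun h => ((\sum_a p a * tnth h a) ^+ 2)%:E.
pose Q : V -> \bar R := fun h => (\sum_a p a * tnth h a ^+ 2)%:E.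
have nF : nnmeas Fm := nnmeas_softmax _ _ p.
have nFt : nnmeas (fun z => Fm (topp z)) := nnmeas_topp nF.
have nL : nnmeas L := nnmeas_sqr _.
have nQ : nnmeas Q := nnmeas_sumsqr p0.
have nR : nnmeas (EFin \o remainder : V -> \bar R) := nnmeas_remainder N beta_gt0.
have n2 : nnmeas (fun _ : V => 2%:E) by exact: nnmeas_cst.
set bse := scale_dirs e bs in hr ES *.
pose f1 z := ((Fm z + Fm (topp z)) + kc%:E * L z)%E.
pose g1 z := ((2%:E + k%:E * Q z) : \bar R)%E.
pose f2 z := (2%:E * (EFin \o remainder) z : \bar R)%E.
have nf1 : nnmeas f1 by apply: nnmeasD; [exact: nnmeasD|exact: nnmeasZ].
have ng1 : nnmeas g1 by apply: nnmeasD => //; exact: nnmeasZ.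
have nf2 : nnmeas f2 by exact: nnmeasZ.
pose X := \sum_a p a * gram bs a a.
pose Y := \sum_a \sum_c p a * p c * gram bs a c.
have Ef1 : gsmooth s bse f1 (tzero N) = ((ES + ES) + (kc * (v * (e ^+ 2 * Y)))%:E)%E.
  have El : gsmooth s bse (fun z => kc%:E * L z)%E (tzero N) = (kc * (v * (e ^+ 2 * Y)))%:E.
    apply: (etrans (gsmoothZ s bse kc0 nL _)).
    apply: (etrans (f_equal (fun u => kc%:E * u)%E (gsmooth_lin_sqr s_gt0 _ _))).
    rewrite -EFinM; congr ((_ * (_ * _))%:E).
    rewrite /Y mulr_sumr; apply: eq_bigr => a _; rewrite mulr_sumr; apply: eq_bigr => c _.
    by rewrite gram_scale; ring.
  apply: (etrans (gsmoothD s bse (nnmeasD nF nFt) (nnmeasZ kc0 nL) _)).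
  apply: (f_equal2 (fun u w => u + w)%E _ El).
  apply: (etrans (gsmoothD s bse nF nFt _)).
  exact: (f_equal (fun u => ES + u)%E (gsmooth_topp0 bse nF)).
have Eg1 : gsmooth s bse g1 (tzero N) = (2 + k * (v * (e ^+ 2 * X)))%:E.
  apply: (etrans (gsmoothD s bse n2 (nnmeasZ k0 nQ) _)).
  apply: (etrans (f_equal2 (fun u w => u + w)%E (gsmooth_cst s bse 2 _) (gsmoothZ s bse k0 nQ _))).
  apply: (etrans (f_equal (fun u => 2%:E + k%:E * u)%E (gsmooth_coord_sqr s_gt0 _ p0))).
  rewrite -EFinM -EFinD; congr ((_ + _ * (_ * _))%:E).
  rewrite /X mulr_sumr; apply: eq_bigr => a _.
  by rewrite gram_scale; ring.
have Ef2 : (gsmooth s bse f2 (tzero N) <= (2 * r)%:E)%E.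
  by rewrite gsmoothZ// EFinM lee_pmul2l.
have i1 : (gsmooth s bse f1 (tzero N) <= gsmooth s bse g1 (tzero N) + gsmooth s bse f2 (tzero N))%E.
  rewrite -gsmoothD//; apply: gsmooth_le => //; first exact: nnmeasD.
  move=> z; rewrite /f1 /g1 /f2 /= -!EFinM -!EFinD lee_fin.
  have := softmax_taylor_sym alpha_gt0 alpha_le1 beta_gt0 z p0 p1.
  rewrite ler_norml -/k => /andP[_].
  move: (softmax p z) (softmax p (topp z)) (\sum_a p a * tnth z a)
    (\sum_a p a * tnth z a ^+ 2) (remainder z) => S1 S2 m1 m2 Rz; rewrite /kc; lra.
have i2 : (gsmooth s bse g1 (tzero N) <= gsmooth s bse f1 (tzero N) + gsmooth s bse f2 (tzero N))%E.
  rewrite -gsmoothD//; apply: gsmooth_le => //; first exact: nnmeasD.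
  move=> z; rewrite /f1 /g1 /f2 /= -!EFinM -!EFinD lee_fin.
  have := softmax_taylor_sym alpha_gt0 alpha_le1 beta_gt0 z p0 p1.
  rewrite ler_norml -/k => /andP[+ _].
  move: (softmax p z) (softmax p (topp z)) (\sum_a p a * tnth z a)
    (\sum_a p a * tnth z a ^+ 2) (remainder z) => S1 S2 m1 m2 Rz; rewrite /kc; lra.
have j1 := le_trans i1 (leeD2l _ Ef2).
have j2 := le_trans i2 (leeD2l _ Ef2).
rewrite Ef1 Eg1 in j1 j2.
have ES0 : (0 <= ES)%E by exact: (nnmeas_gsmooth s bse nF).2.
(* [j1] bounds twice [ES] by a finite number and [ES0] excludes -oo, so the mean is finite. *)
clearbody ES; clear Ef1 Eg1 Ef2 i1 i2; case: ES ES0 j1 j2 => [x|//|//] _ j1 j2.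
exists x => //.
rewrite -!EFinD !lee_fin in j1 j2.
rewrite -/X -/Y ler_norml; rewrite /kc /k in j1 j2.
clearbody X Y; clear kc0 f1 g1 nf1 ng1.
set w := alpha * beta ^+ 2 in j1 j2 *; move: w X Y j1 j2 => w X Y j1 j2.
have -> : w * v * e ^+ 2 / 2 * (X - (1 - alpha) * Y) =
  (w * (v * (e ^+ 2 * X)) - w * (1 - alpha) * (v * (e ^+ 2 * Y))) / 2 by field.
move: (w * (v * (e ^+ 2 * X))) (w * (1 - alpha) * (v * (e ^+ 2 * Y))) j1 j2 => A B j1 j2.
by apply/andP; split; lra.
Qed.

Variables (bsS bsT : seq ('I_N -> R)).
Hypothesis gram_diag : forall a, gram bsS a a = gram bsT a a.
Hypothesis gram_le : forall a c, gram bsT a c <= gram bsS a c.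

(** With the value at z factored out, the second-order terms differ only in the off-diagonal
    covariances, which enter with coefficient -(1 - alpha) <= 0: larger correlations give a smaller
    mean. The mean for [bsT] is at least 1/2, so the additive error 2 r is at most the relative
    error 4 r. *)
Lemma slepian_step : exists2 C : R, 0 <= C & forall e, 0 < e -> e <= 1 -> C * e ^+ 3 <= 1 / 2 ->
  forall z, (gsmooth s (scale_dirs e bsS) (EFin \o softmax (fun=> 1%R)) z <=
    (1 + 4 * (C * e ^+ 3))%R%:E * gsmooth s (scale_dirs e bsT) (EFin \o softmax (fun=> 1%R)) z)%E.
Proof.
have [C1 C10 h1] := gsmooth_remainder_le s_gt0 beta_gt0 bsS.
have [C2 C20 h2] := gsmooth_remainder_le s_gt0 beta_gt0 bsT.
exists (C1 + C2); first exact: addr_ge0.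
move=> e e0 e1 Ce z; set r := (C1 + C2) * e ^+ 3 in Ce *.
have e3 : 0 <= e ^+ 3 by rewrite exprn_ge0// ltW.
have r1 : (gsmooth s (scale_dirs e bsS) (EFin \o remainder) (tzero N) <= r%:E)%E.
  by apply: (le_trans (h1 e e0 e1)); rewrite lee_fin ler_wpM2r// lerDl.
have r2 : (gsmooth s (scale_dirs e bsT) (EFin \o remainder) (tzero N) <= r%:E)%E.
  by apply: (le_trans (h2 e e0 e1)); rewrite lee_fin ler_wpM2r// lerDr.
have r0 : 0 <= r by rewrite mulr_ge0// addr_ge0.
pose p := gibbs beta z.
have p0 : forall a, 0 <= p a := gibbs_ge0 N_gt0 beta z.
have p1 : \sum_a p a = 1 := gibbs_sum N_gt0 beta z.
have fac bs : gsmooth s bs (EFin \o softmax (fun=> 1%R)) z =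
    ((softmax (fun=> 1%R) z)%:E * gsmooth s bs (EFin \o softmax p) (tzero N))%E.
  rewrite -gsmoothZ ?expR_ge0//; last exact: nnmeas_softmax.
  rewrite -[in LHS](tadd0 z) -gsmooth_tadd; congr gsmooth.
  by apply/funext => h /=; rewrite softmax_tadd.
rewrite !fac.
have [x1 -> b1] := gsmooth_softmax p0 p1 r1.
have [x2 -> b2] := gsmooth_softmax p0 p1 r2.
rewrite -!EFinM lee_fin mulrCA ler_pM2l ?expR_gt0//.
have Xeq : \sum_a p a * gram bsS a a = \sum_a p a * gram bsT a a.
  by apply: eq_bigr => a _; rewrite gram_diag.
rewrite Xeq in b1.
set X := \sum_a p a * gram bsT a a in b1 b2.
set YS := \sum_a \sum_c _ in b1; set YT := \sum_a \sum_c _ in b2.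
have YY : YT <= YS.
  apply: ler_sum => a _; apply: ler_sum => c _; apply: ler_wpM2l => //.
  by rewrite mulr_ge0.
(* X - YT is the variance of the directions under the Gibbs weights, summed over [bsT]. Hence the
   second-order term of [bsT] is nonnegative and x2 >= 1 - r >= 1/2. *)
have XY : YT <= X.
  rewrite /YT -gram_quad /X /gram.
  under [leRHS]eq_bigr do rewrite mulr_sumr.
  rewrite exchange_big/=; apply: ler_sum => b _.
  set m := \sum_a p a * b a.
  rewrite -subr_ge0 (_ : _ - _ = \sum_a p a * (b a - m) ^+ 2); last first.
    transitivity (\sum_a (p a * (b a * b a) - 2 * m * (p a * b a) + p a * m ^+ 2)).
      rewrite big_split/= sumrB -mulr_sumr -/m -mulr_suml p1; ring.
    by apply: eq_bigr => a _; ring.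
  by apply: sumr_ge0 => a _; rewrite mulr_ge0 ?sqr_ge0.
have YT0 : 0 <= YT by rewrite /YT -gram_quad; apply: sumr_ge0 => b _; exact: sqr_ge0.
set k := alpha * beta ^+ 2 * v * e ^+ 2 / 2 in b1 b2.
have k0 : 0 <= k.
  by rewrite divr_ge0// mulr_ge0 ?sqr_ge0// mulr_ge0 ?normal_moment2_ge0// mulr_ge0 ?sqr_ge0// ltW.
have a1 : 0 <= 1 - alpha by rewrite subr_ge0.
have w1 : k * (X - (1 - alpha) * YS) <= k * (X - (1 - alpha) * YT).
  by apply: ler_wpM2l => //; rewrite lerD2l lerN2 ler_wpM2l.
have w2 : 0 <= k * (X - (1 - alpha) * YT).
  apply: mulr_ge0 => //; rewrite subr_ge0; apply: le_trans XY.
  by rewrite ler_piMl// gerBl ltW.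
move: w1 w2 b1 b2; move: (k * (X - (1 - alpha) * YS)) (k * (X - (1 - alpha) * YT)) => WS WT.
rewrite !ler_norml => w1 w2 /andP[b11 b12] /andP[b21 b22].
have x2r : 1 / 2 <= x2 by lra.
by nra.
Qed.

Lemma iter_gsmooth k bs (f : V -> \bar R) :
  iter k (gsmooth s bs) f = gsmooth s (flatten (nseq k bs)) f.
Proof. by elim: k => //= k ->; rewrite gsmooth_cat. Qed.

(** The steps are exchanged one at a time. The hypothesis concerns a single step applied to f
    itself, so commutation is used to move the step to be exchanged innermost. *)
Lemma gsmooth_iter_le (cs ds : seq ('I_N -> R)) (f : V -> \bar R) (c : R) : 0 <= c -> nnmeas f ->
  (forall z, (gsmooth s cs f z <= c%:E * gsmooth s ds f z)%E) ->
  forall k z, (iter k (gsmooth s cs) f z <= (c ^+ k)%:E * iter k (gsmooth s ds) f z)%E.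
Proof.
move=> c0 f0 h; elim=> [|k IH] z; first by rewrite expr0 mul1e.
have ni k' bs : nnmeas (iter k' (gsmooth s bs) f) by exact: nnmeas_iter.
have ck0 : 0 <= c ^+ k by rewrite exprn_ge0.
apply: (@le_trans _ _ ((c ^+ k)%:E * gsmooth s cs (iter k (gsmooth s ds) f) z)%E).
  rewrite iterS -gsmoothZ//; apply: gsmooth_le => //; exact: nnmeasZ.
rewrite exprSr EFinM -muleA; apply: lee_wpmul2l; first by rewrite lee_fin.
rewrite iterSr !iter_gsmooth gsmoothC// -gsmoothZ//; last exact: nnmeas_gsmooth.
by apply: gsmooth_le => //; [exact: nnmeas_gsmooth|apply: nnmeasZ => //; exact: nnmeas_gsmooth].
Qed.

Lemma slepian z :
  (gsmooth s bsS (EFin \o softmax (fun=> 1%R)) z <= gsmooth s bsT (EFin \o softmax (fun=> 1%R)) z)%E.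
Proof.
have [C C0 step] := slepian_step.
have nF : nnmeas (EFin \o softmax (fun=> 1%R) : V -> \bar R) := nnmeas_softmax _ _ _.
apply/lee_mul01Pr; first exact: (nnmeas_gsmooth s bsS nF).2.
move=> t /andP[t0 t1].
have lt0 : 0 < - ln t by rewrite oppr_gt0 ln_lt0// t0.
(* With K >= M and e = K^-1, the first term ensures C e <= 1/2, as [slepian_step] requires, and the
   second makes the accumulated factor exp (4 C e) at most t^-1. *)
pose M := 2 * C + 4 * C / - ln t.
pose j := Num.truncn M; pose K : R := 2 ^+ j.
have K0 : 0 < K by rewrite exprn_gt0.
have MK : M <= K.
  apply: (le_trans (ltW (truncnS_gt _))).
  by rewrite /K -natrX ler_nat ltn_expl.
have M1 : 0 <= 4 * C / - ln t by rewrite divr_ge0 ?mulr_ge0// ltW.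
have CK1 : C <= K / 2 by move: MK M1; rewrite /M; lra.
have CK2 : 4 * C <= K * - ln t.
  by rewrite -ler_pdivrMr//; apply: le_trans MK; rewrite /M lerDr mulr_ge0.
pose e := Num.sqrt 2 ^- (2 * j) : R.
have eK : e = K^-1 by rewrite /e exprM sqr_sqrtr.
have e0 : 0 < e by rewrite eK invr_gt0.
have e1 : e <= 1 by rewrite eK invf_le1// exprn_ege1// ler1n.
have Ce : C * e <= 1 / 2 by rewrite eK ler_pdivrMr//; lra.
have Ce3 : C * e ^+ 3 <= 1 / 2.
  have e2 : e ^+ 2 <= 1 := exprn_ile1 _ (ltW e0) e1.
  by apply: le_trans Ce; apply: ler_wpM2l => //; rewrite exprS ler_piMr// ltW.
have c0 : 0 <= 1 + 4 * (C * e ^+ 3) by apply: addr_ge0 => //; do 2!apply: mulr_ge0 => //; exact: exprn_ge0 _ (ltW e0).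
have := gsmooth_iter_le c0 nF (step e e0 e1 Ce3) (2 ^ (2 * j)) z.
rewrite !(gsmooth_iter s_gt0)// => h.
apply: (@le_trans _ _ (t%:E * ((1 + 4 * (C * e ^+ 3)) ^+ (2 ^ (2 * j)))%R%:E *
   gsmooth s bsT (EFin \o softmax (fun=> 1%R)) z)%E).
  by rewrite -muleA lee_pmul2l.
rewrite -[leRHS]mul1e lee_wpmul2r//; first exact: (nnmeas_gsmooth s bsT nF).2.
rewrite -EFinM lee_fin -ler_pdivlMl// mulr1.
have -> : t^-1 = expR (- ln t) by rewrite expRN lnK// posrE.
apply: (@le_trans _ _ (expR (4 * (C * e ^+ 3)) ^+ (2 ^ (2 * j)))).
  by rewrite ler_pXn2r ?expn_gt0// ?nnegrE ?expR_ge0// expR_ge1Dx.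
rewrite -expRM_natl ler_expR.
have -> : (2 ^ (2 * j))%:R = K ^+ 2 :> R by rewrite natrX mulnC exprM.
rewrite (_ : K ^+ 2 * _ = 4 * C * (e * K) ^+ 2 * e); last by ring.
rewrite eK mulVf ?gt_eqF// expr1n mulr1.
by rewrite ler_pdivrMr// [leRHS]mulrC.
Qed.

End Slepian.

(** * Chevet's inequality *)

Section Chi.
Context {R : realType}.

(* With k = 1 this is E exp(lam |g|) <= exp(lam s + lam^2 s^2 / 2), obtained from
   lam |g| <= a |g|^2 + lam^2 / (4 a) for the optimal a. *)
Lemma chi_constant (k : nat) (lam s : R) : (0 < k)%N -> 0 < lam -> 0 < s ->
  exists a : R, [/\ 0 < a, a * s ^+ 2 *+ 2 < 1 &
    expR (lam ^+ 2 / (4 * a)) * (Num.sqrt (1 - a * s ^+ 2 *+ 2))^-1 ^+ k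
    <= expR (lam * s * Num.sqrt k%:R + lam ^+ 2 * s ^+ 2 / 2)].
Proof.
move=> k0 l0 s0; set w := Num.sqrt k%:R.
have w0 : 0 < w by rewrite sqrtr_gt0 ltr0n.
have w2 : w ^+ 2 = k%:R by rewrite sqr_sqrtr.
pose x := lam * s / w.
have x0 : 0 < x by rewrite divr_gt0// mulr_gt0.
(* Stationarity in a reads lam^2 (1 - 2 a s^2) = 4 k a^2 s^2. With x = lam s / sqrt k and y the
   positive root of y^2 - x y = 1, it is solved by a = lam / (2 s sqrt k y), for which 1 - 2 a s^2 =
   y^-2. *)
pose y := (x + Num.sqrt (x ^+ 2 + 4)) / 2.
have sq : Num.sqrt (x ^+ 2 + 4) ^+ 2 = x ^+ 2 + 4 by rewrite sqr_sqrtr// addr_ge0// sqr_ge0.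
have s2 : 2 < Num.sqrt (x ^+ 2 + 4).
  rewrite -(@ltr_pXn2r _ 2)// ?nnegrE ?sqrtr_ge0// sq.
  have := exprn_gt0 2 x0; lra.
have y1 : 1 < y by rewrite /y; lra.
have y0 : 0 < y by lra.
have yx : y ^+ 2 - x * y = 1 by rewrite /y; move: sq; set t := Num.sqrt _ => sq; nra.
pose r := Num.sqrt y.
have r0 : 0 < r by rewrite sqrtr_gt0.
have r2 : r ^+ 2 = y by rewrite sqr_sqrtr// ltW.
pose a := lam / (2 * s * w * y).
have a0 : 0 < a by rewrite /a divr_gt0// ?mulr_gt0//; nra.
have as2 : 1 - a * s ^+ 2 *+ 2 = y^-1 ^+ 2.
  have -> : a * s ^+ 2 *+ 2 = x / y by rewrite /a /x; field; rewrite !gt_eqF.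
  have -> : x = (y ^+ 2 - 1) / y by apply: (mulIf (lt0r_neq0 y0)); rewrite divfK ?gt_eqF//; lra.
  by field; rewrite gt_eqF.
exists a; split => //.
  by rewrite -subr_gt0 as2 exprn_gt0// invr_gt0.
rewrite as2 sqrtr_sqr gtr0_norm ?invr_gt0// invrK.
have -> : lam ^+ 2 / (4 * a) = k%:R * (x * y / 2).
  by rewrite -w2 /a /x; field; rewrite !gt_eqF.
have -> : lam * s * w + lam ^+ 2 * s ^+ 2 / 2 = k%:R * (x + x ^+ 2 / 2).
  by rewrite -w2 /x; field; rewrite gt_eqF.
have yy := ltW y0.
rewrite !expRM_natl -exprMn ler_pXn2r//; last first.
  by rewrite nnegrE expR_ge0.
  by rewrite nnegrE mulr_ge0// expR_ge0.
(* This is ln y <= 2 (sqrt y - 1). The exponents then differ by (r - 1)^2 times a rational function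
   of r = sqrt y with positive coefficients. *)
have yr : y <= expR (2 * (r - 1)).
  rewrite -r2 -[X in expR (X * _)]/(2%:R) expRM_natl ler_pXn2r ?nnegrE ?expR_ge0 ?(ltW r0)//.
  by have := expR_ge1Dx (r - 1); rewrite addrC subrK.
apply: (@le_trans _ _ (expR (x * y / 2) * expR (2 * (r - 1)))).
  by rewrite ler_pM2l ?expR_gt0.
rewrite -expRD ler_expR -subr_ge0.
have xE : x = r ^+ 2 - r ^- 2.
  by rewrite r2; apply: (mulIf (lt0r_neq0 y0)); rewrite mulrBl mulVf ?gt_eqF//; lra.
rewrite -r2 xE (_ : _ - _ = (r - 1) ^+ 2 * (2 * r ^+ 4 + r ^+ 2 + 2 * r + 1) / (2 * r ^+ 4)); last first.
  by field; rewrite gt_eqF.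
have rr := ltW r0; have r4 : 0 <= 2 * r ^+ 4 by rewrite mulr_ge0// exprn_ge0.
apply: divr_ge0 => //; apply: mulr_ge0; first exact: sqr_ge0.
by rewrite addr_ge0// addr_ge0 ?mulr_ge0// addr_ge0// sqr_ge0.
Qed.

End Chi.

Section Chevet.
Context {R : realType} (s : R) (s_gt0 : 0 < s) (N : nat) (N_gt0 : (0 < N)%N).
Variables (alpha beta : R) (alpha_gt0 : 0 < alpha) (alpha_le1 : alpha <= 1) (beta_gt0 : 0 < beta).
Local Notation V := (N.-tuple R).
Local Notation softmax := (softmax alpha beta).
Local Notation lam := (alpha * beta).
Implicit Types (z h : V) (x : R) (b : 'I_N -> R) (bs cs : seq ('I_N -> R)).

Let lam_gt0 : 0 < lam. Proof. exact: mulr_gt0. Qed.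

Let sum_expR_gt0 z : 0 < \sum_a 1 * expR (beta * tnth z a).
Proof.
rewrite (bigD1 (Ordinal N_gt0))//= mul1r ltr_wpDr ?expR_gt0//.
by apply: sumr_ge0 => *; rewrite mul1r; exact: expR_ge0.
Qed.

Lemma softmax_le z D : (forall a, lam * tnth z a <= D) ->
  softmax (fun=> 1) z <= expR (alpha * ln N%:R) * expR D.
Proof.
move=> zD; rewrite -expRD ler_expR -[D in leRHS](divfK (lt0r_neq0 alpha_gt0)).
rewrite [D / _ * _]mulrC -mulrDr ler_pM2l// -[D / alpha]expRK -lnM ?posrE ?ltr0n ?expR_gt0//.
rewrite ler_ln ?posrE ?mulr_gt0 ?ltr0n ?expR_gt0//.
have -> : N%:R * expR (D / alpha) = \sum_(a < N) expR (D / alpha).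
  by rewrite sumr_const card_ord mulr_natl.
apply: ler_sum => a _; rewrite mul1r ler_expR ler_pdivlMr//.
by rewrite mulrC mulrA.
Qed.

Lemma le_softmax z a : expR (lam * tnth z a) <= softmax (fun=> 1) z.
Proof.
rewrite ler_expR -mulrA ler_pM2l// -[X in X <= _]expRK ler_ln ?posrE ?expR_gt0//.
rewrite (bigD1 a)//= mul1r lerDl.
by apply: sumr_ge0 => *; rewrite mul1r; exact: expR_ge0.
Qed.

(** In each direction lam x b <= c x^2 + lam^2 b^2 / (4 c). The second terms sum to at most W
    whatever the coordinate a, which is how the maximum over a disappears. *)
Lemma gsmooth_softmax_le (l : seq (R * ('I_N -> R))) (W : R) :
  (forall p, p \in [seq p.1 | p <- l] -> 0 < p /\ p * s ^+ 2 *+ 2 < 1) ->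
  (forall a, \sum_(p <- l) lam ^+ 2 * p.2 a ^+ 2 / (4 * p.1) <= W) ->
  (gsmooth s [seq p.2 | p <- l] (EFin \o softmax (fun=> 1%R)) (tzero N) <=
   (expR (alpha * ln N%:R) * expR W * \prod_(p <- l) (Num.sqrt (1 - p.1 * s ^+ 2 *+ 2))^-1)%:E)%E.
Proof.
move=> la lW; apply: gsmooth_le_quad => //.
- exact: nnmeas_softmax.
- by move=> p /la[].
move=> xs sxs; rewrite lee_fin -mulrA -expRD; apply: softmax_le => a.
rewrite tnth_tshifts tnth_mktuple add0r addrC; apply: le_trans (lerD (lexx _) (lW a)).
elim: l xs la {lW} sxs => [|[c b] l IH] [|x xs] la //=; first by rewrite !big_nil mulr0 addr0.
move=> [] /IH {}IH; rewrite !big_cons/= mulrDr addrACA.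
have [c0 _] := la c (mem_head _ _).
apply: lerD; last by apply: IH => p pl; apply: la; rewrite inE pl orbT.
rewrite -subr_ge0 (_ : _ - _ = (2 * c * x - lam * b a) ^+ 2 / (4 * c)).
  by rewrite divr_ge0 ?sqr_ge0// mulr_ge0// ltW.
by field; rewrite gt_eqF.
Qed.

Variables (q n : nat) (q_gt0 : (0 < q)%N) (n_gt0 : (0 < n)%N).
Variables (u : 'I_N -> 'I_q -> R) (w : 'I_N -> 'I_n -> R).
Hypothesis u_unit : forall a, \sum_i u a i ^+ 2 = 1.
Hypothesis w_unit : forall a, \sum_j w a j ^+ 2 = 1.

(** The direction [u^~ i] lists the i-th coordinates of all u_a, so smoothing along [bsT] adds <g,
    u_a> + <h, w_a> to coordinate a. *)
Let bsT := [seq u^~ i | i <- index_enum 'I_q] ++ [seq w^~ j | j <- index_enum 'I_n].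

Let gramT a c : gram bsT a c = \sum_i u a i * u c i + \sum_j w a j * w c j.
Proof. by rewrite /gram /bsT big_cat !big_map. Qed.

Lemma dot_le1 (I : finType) (f g : I -> R) : \sum_i f i ^+ 2 = 1 -> \sum_i g i ^+ 2 = 1 ->
  \sum_i f i * g i <= 1.
Proof.
move=> f1 g1; have : 0 <= \sum_i (f i - g i) ^+ 2 by apply: sumr_ge0 => *; exact: sqr_ge0.
under eq_bigr do rewrite sqrrB.
by rewrite big_split/= sumrB f1 g1 sumrMnl; lra.
Qed.

(** Each of the blocks g and h contributes lam s sqrt k + lam^2 s^2 / 2 through [chi_constant], with
    k = q and k = n; as u_a and w_a are unit vectors, the terms lam^2 / (4 a) do not depend on the
    pair. *)
Lemma gsmooth_bsT_le : (gsmooth s bsT (EFin \o softmax (fun=> 1%R)) (tzero N) <=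
  (expR (alpha * ln N%:R) * expR (lam * s * (Num.sqrt n%:R + Num.sqrt q%:R) + lam ^+ 2 * s ^+ 2))%:E)%E.
Proof.
have [a1 [a10 a11 h1]] := chi_constant q_gt0 lam_gt0 s_gt0.
have [a2 [a20 a21 h2]] := chi_constant n_gt0 lam_gt0 s_gt0.
pose l := [seq (a1, u^~ i) | i <- index_enum 'I_q] ++ [seq (a2, w^~ j) | j <- index_enum 'I_n].
have l2 : [seq p.2 | p <- l] = bsT by rewrite /l map_cat -!map_comp.
rewrite -l2; apply: (le_trans (gsmooth_softmax_le (W := lam ^+ 2 / (4 * a1) + lam ^+ 2 / (4 * a2)) _ _)).
- move=> p /mapP[[c b]] /=; rewrite /l mem_cat => /orP[] /mapP[i _ [-> _ ->]] //.
- move=> a; rewrite /l big_cat !big_map.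
  rewrite le_eqVlt; apply/orP; left; apply/eqP; congr (_ + _).
    by rewrite -[RHS]mulr1 -(u_unit a) mulr_sumr; apply: eq_bigr => i _; rewrite mulrAC.
  by rewrite -[RHS]mulr1 -(w_unit a) mulr_sumr; apply: eq_bigr => i _; rewrite mulrAC.
rewrite lee_fin -mulrA ler_pM2l ?expR_gt0// /l big_cat !big_map/=.
rewrite !prodr_const !card_ord expRD mulrACA.
apply: (le_trans (ler_pM _ _ h1 h2)).
- by rewrite mulr_ge0 ?expR_ge0// exprn_ge0// invr_ge0 sqrtr_ge0.
- by rewrite mulr_ge0 ?expR_ge0// exprn_ge0// invr_ge0 sqrtr_ge0.
by rewrite -expRD ler_expR le_eqVlt; apply/orP; left; apply/eqP; field.
Qed.

Variable bsE : seq ('I_N -> R).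
Hypothesis gramE : forall a c, gram bsE a c = (\sum_i u a i * u c i) * (\sum_j w a j * w c j).

(* Slepian's comparison of u_a^T G w_a + g0 with <g, u_a> + <h, w_a>; the extra
   variable g0 equalises the variances and is then integrated out exactly. *)
Lemma chevet : (gsmooth s bsE (EFin \o softmax (fun=> 1%R)) (tzero N) <=
  (expR (alpha * ln N%:R) * expR (lam * s * (Num.sqrt n%:R + Num.sqrt q%:R) + lam ^+ 2 * s ^+ 2 / 2))%:E)%E.
Proof.
have nF : nnmeas (EFin \o softmax (fun=> 1%R) : V -> \bar R) := nnmeas_softmax _ _ _.
pose one : 'I_N -> R := fun=> 1.
(* A common shift by x multiplies the soft maximum by exp (lam x), whose mean is exp (lam^2 s^2 /
   2). *)
have shift1 : gsmooth s [:: one] (EFin \o softmax (fun=> 1%R)) =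
    (fun z => (expR (lam ^+ 2 * s ^+ 2 / 2))%:E * (EFin \o softmax (fun=> 1%R)) z)%E.
  apply/funext => z /=.
  have me : measurable_fun setT (fun x : R => (expR (lam * x))%:E).
    by apply/measurable_EFinP; apply: measurableT_comp => //; exact: measurable_funM.
  have e0 (x : R) : (0 <= (expR (lam * x))%:E)%E by rewrite lee_fin expR_ge0.
  rewrite muleC -integral_normal_expR_mul ?gt_eqF//.
  rewrite -(ge0_integral_normalZl s (expR_ge0 _) me e0).
  apply: eq_integral => x _; rewrite -EFinM; congr EFin.
  rewrite -expRD; congr expR.
  have -> : \sum_a 1 * expR (beta * tnth (tshift z x one) a) =
     expR (beta * x) * \sum_a 1 * expR (beta * tnth z a).
    rewrite mulr_sumr; apply: eq_bigr => a _.
    by rewrite tnth_mktuple !mul1r mulr1 mulrDr addrC expRD.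
  by rewrite lnM ?posrE ?expR_gt0// expRK; ring.
have gE a c : gram (one :: bsE) a c = 1 + (\sum_i u a i * u c i) * (\sum_j w a j * w c j).
  by rewrite /gram big_cons mulr1 -gramE.
have := @slepian R s s_gt0 N N_gt0 alpha beta alpha_gt0 alpha_le1 beta_gt0 (one :: bsE) bsT _ _ (tzero N).
have gd a : gram (one :: bsE) a a = gram bsT a a.
  rewrite gE gramT.
  have -> : \sum_i u a i * u a i = 1 by rewrite -(u_unit a); apply: eq_bigr => i _; rewrite expr2.
  have -> : \sum_i w a i * w a i = 1 by rewrite -(w_unit a); apply: eq_bigr => i _; rewrite expr2.
  by rewrite mulr1.
(* The difference is (1 - t) (1 - t') for the two inner products t and t', which are at most 1. *)
have gl a c : gram bsT a c <= gram (one :: bsE) a c.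
  rewrite gE gramT.
  have := dot_le1 (u_unit a) (u_unit c); have := dot_le1 (w_unit a) (w_unit c).
  move: (\sum_j w a j * w c j) (\sum_i u a i * u c i) => t t'; nra.
move=> /(_ gd gl) /le_trans /(_ gsmooth_bsT_le).
rewrite -[one :: bsE]/([:: one] ++ bsE) gsmooth_cat gsmoothC// shift1 gsmoothZ ?expR_ge0//.
rewrite -lee_pdivlMl ?expR_gt0// -EFinM => /le_trans; apply.
rewrite lee_fin mulrCA ler_pM2l ?expR_gt0// -expRN -expRD ler_expR le_eqVlt.
by apply/orP; left; apply/eqP; field.
Qed.

End Chevet.

(** * The norm of a Gaussian matrix *)

Section Independence.
Context {d : measure_display} {T : measurableType d} {R : realType}.
Variable P : probability T R.

Lemma ge0_integral_indep d' (V : measurableType d') (Z : {mfun T >-> V}) (X : {RV P >-> R})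
    (G : V * R -> \bar R) :
  (forall A B, measurable A -> measurable B ->
     P (Z @^-1` A `&` X @^-1` B) = (P (Z @^-1` A) * P (X @^-1` B))%E) ->
  measurable_fun setT G -> (forall p, (0 <= G p)%E) ->
  (\int[P]_w G (Z w, X w) = \int[distribution P X]_x \int[P]_w G (Z w, x))%E.
Proof.
move=> indep mG G0.
have mZX : measurable_fun setT (fun w => (Z w, X w)).
  by apply/measurable_fun_pairP; split.
pose mixin := isMeasurableFun.Build _ _ _ _ _ mZX.
pose ZX : {mfun T >-> (V * R)%type} := HB.pack (fun w => (Z w, X w)) mixin.
transitivity (\int[distribution P ZX]_p G p)%E.
  by rewrite ge0_integral_distribution.
transitivity (\int[(distribution P Z \x distribution P X)%E]_p G p)%E.
  by apply: eq_measure_integral => A mA _; apply/esym/product_measure_unique.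
rewrite fubini_tonelli2//; apply: eq_integral => x _; rewrite /fubini_G.
rewrite ge0_integral_distribution//.
by apply: (measurableT_comp mG); exact: measurable_pair2.
Qed.

Variables (I : finType) (E : I -> {RV P >-> R}).
Hypothesis indepE : mutually_independent E.

(** [mutually_independent] speaks of rectangles only. These are stable under intersection, and the
    events independent of [E i] form a Dynkin system, so independence extends to the sigma-algebra
    generated by the coordinates in J, for which Z is measurable. *)
Lemma indep_coords (J : {set I}) (i : I) (N : nat) (b : I -> 'I_N -> R) (r : seq I) :
  i \notin J -> {subset r <= J} ->
  forall A B, measurable A -> measurable B ->
  let Z w := [tuple \sum_(j <- r) E j w * b j a | a < N] in
  P (Z @^-1` A `&` E i @^-1` B) = (P (Z @^-1` A) * P (E i @^-1` B))%E.
Proof.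
move=> iJ rJ A B mA mB Z.
pose DD : set (set T) := [set S | exists2 C : I -> set R, (forall j, measurable (C j)) &
  S = [set w | forall j, j \in J -> C j (E j w)]].
have DDm S : DD S -> measurable S.
  move=> [C mC ->].
  rewrite (_ : mkset _ = \bigcap_(j in [set j | j \in J]) (E j @^-1` C j)); last first.
    by apply/seteqP; split => w h j; exact: h.
  apply: fin_bigcap_measurable; first exact: finite_finset.
  by move=> j _; rewrite -[X in measurable X]setTI; exact: measurable_funP.
pose T' := g_sigma_algebraType DD.
have sub S : @measurable _ T' S -> @measurable _ T S.
  by move=> /(_ measurable); apply; split => //; exact: sigma_algebra_measurable.
have mE j : j \in J -> measurable_fun [set: T'] (E j : T' -> R).
  move=> jJ _ C mC; rewrite setTI; apply: sub_gen_smallest.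
  exists (fun k => if k == j then C else setT).
    by move=> k; case: ifP.
  apply/seteqP; split => w /=; last by move/(_ j jJ); rewrite eqxx.
  by move=> h k _; case: eqP => // ->.
have mZ : measurable_fun [set: T'] (Z : T' -> N.-tuple R).
  apply/measurable_fun_tnthP => a.
  rewrite (_ : _ \o _ = fun w : T' => \sum_(j <- r) E j w * b j a); last first.
    by apply/funext => w /=; rewrite tnth_mktuple.
  (* Terms outside J are set to 0: the sum is unchanged because r lies in J, and every summand
     becomes measurable for the smaller sigma-algebra. *)
  rewrite (_ : (fun w : T' => _) = fun w : T' =>
      \sum_(j <- r) (if j \in J then E j w else 0) * b j a); last first.
    by apply/funext => w; apply: eq_big_seq => j jr; rewrite rJ.
  apply: measurable_sum => j; apply: measurable_funM => //.
  by case jJ: (j \in J); [exact: mE|exact: measurable_cst].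
pose ind S := P (S `&` E i @^-1` B) = (P S * P (E i @^-1` B))%E.
have mEB : measurable (E i @^-1` B).
  by rewrite -[X in measurable X]setTI; exact: measurable_funP.
have indD S : DD S -> ind S.
  move=> [C mC ->]; rewrite /ind.
  (* The constraint on coordinate i is appended to the rectangle, and independence is applied to i
     |: J and to J. *)
  pose C' j := if j == i then B else C j.
  have mC' j : measurable (C' j) by rewrite /C'; case: ifP.
  have C'J j : j \in J -> C' j = C j.
    by move=> jJ; rewrite /C'; case: eqP => // ji; rewrite ji (negbTE iJ) in jJ.
  have C'i : C' i = B by rewrite /C' eqxx.
  have := indepE (i |: J) mC'; rewrite big_setU1//= C'i => h.
  have -> : [set w | forall j, j \in J -> C j (E j w)] `&` E i @^-1` B =
      [set w | forall j, j \in i |: J -> C' j (E j w)].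
    apply/seteqP; split => w /=.
      move=> [h1 h2] j /setU1P[->|jJ]; first by rewrite C'i.
      by rewrite C'J//; exact: h1.
    move=> h1; split; last by have := h1 i (setU11 _ _); rewrite C'i.
    by move=> j jJ; rewrite -C'J//; apply: h1; rewrite inE jJ orbT.
  rewrite h muleC; congr (_ * _)%E.
  by rewrite indepE//; apply: eq_bigr => j jJ; rewrite C'J.
have indT' S : @measurable _ T' S -> ind S.
  have lt1 S' : @measurable _ T S' -> (P S' < +oo)%E.
    by move=> mS'; apply: (le_lt_trans (probability_le1 P mS')); rewrite ltry.
  move=> mS; apply: (@dynkin_induction _ T' DD) mS => // {S}.
  - move=> S1 S2 [C1 m1 ->] [C2 m2 ->]; exists (fun j => C1 j `&` C2 j).
      by move=> j; exact: measurableI.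
    apply/seteqP; split => w /=.
      by move=> [h1 h2] j jJ; split; [exact: h1|exact: h2].
    by move=> h; split=> j jJ; have [] := h j jJ.
  - by rewrite /ind setTI probability_setT mul1e.
  - move=> S mS indS; rewrite /ind.
    have {}indS : (P (@setI T S (E i @^-1` B)) = P S * P (E i @^-1` B))%E := indS.
    have mS' : @measurable _ T S := sub S mS.
    rewrite setIC -setDE measureD//; last exact: lt1.
    rewrite [X in (_ - P X)%E]setIC [X in (_ - X)%E]indS probability_setC// muleBl//; last first.
      exact: fin_num_measure.
    by rewrite mul1e.
  - move=> F mF tF indF; rewrite /ind setI_bigcupl.
    have mF' n : @measurable _ T (F n) := sub _ (mF n).
    rewrite measure_bigcup//; last 2 first.
    - by move=> n _; exact: measurableI.
    - exact: trivIset_setIr.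
    rewrite measure_bigcup//.
    rewrite -[P (E i @^-1` B)]fineK ?fin_num_measure// muleC -nneseriesZl//.
    by apply: eq_eseriesr => n _; rewrite fineK ?fin_num_measure// muleC; exact: indF.
apply: indT'; rewrite -[X in measurable X]setTI; exact: mZ.
Qed.

Definition rv_comb (N : nat) (b : I -> 'I_N -> R) (r : seq I) (w : T) : N.-tuple R :=
  [tuple \sum_(j <- r) E j w * b j a | a < N].

Lemma measurable_rv_comb N (b : I -> 'I_N -> R) r : measurable_fun setT (rv_comb b r).
Proof.
apply/measurable_fun_tnthP => a.
rewrite (_ : _ \o _ = fun w => \sum_(j <- r) E j w * b j a); last first.
  by apply/funext => w /=; rewrite tnth_mktuple.
by apply: measurable_sum => j; apply: measurable_funM.
Qed.

Variables (s : R) (s_gt0 : 0 < s).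
Hypothesis lawE : forall i B, measurable B -> distribution P (E i) B = normal_prob 0 s B.

(* normal_prob lives on [measurableTypeR R], the law of E i on [R]: same sets,
   different displays. *)
Lemma ge0_integral_law i (H : R -> \bar R) : measurable_fun setT H ->
  (forall x, (0 <= H x)%E) ->
  (\int[distribution P (E i)]_x H x = \int[normal_prob 0 s]_x H x)%E.
Proof.
move=> mH H0.
pose phi (x : measurableTypeR R) : R := x.
have mphi : measurable_fun setT phi by move=> _ B mB; rewrite setTI.
have := @ge0_integral_pushforward _ _ (measurableTypeR R) R R phi mphi (normal_prob 0 s) setT H
  measurableT mH (fun x _ => H0 x).
rewrite preimage_setT => <-.
by apply: eq_measure_integral => A mA _; exact: lawE.
Qed.

(** By [uniq r], the head variable does not occur in the tail, hence is independent of the tail's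
    combination; integrating it out gives one layer of [gsmooth]. *)
Lemma integral_rv_comb N (b : I -> 'I_N -> R) r (f : N.-tuple R -> \bar R) z :
  uniq r -> nnmeas f ->
  (\int[P]_w f (tadd z (rv_comb b r w)) = gsmooth s [seq b i | i <- r] f z)%E.
Proof.
move=> + [mf f0]; elim: r z => [|i r IH] z /=.
  move=> _; transitivity (\int[P]_w (cst (f z) w))%E; last first.
    by rewrite (@integral_cst _ _ _ P setT measurableT) [X in (_ * X)%E](probability_setT P) mule1.
  apply: eq_integral => w _; congr f; rewrite -[RHS]tadd0; congr tadd.
  by apply: eq_from_tnth => a; rewrite !tnth_mktuple big_nil.
move=> /andP[ir ur].
pose mixin := isMeasurableFun.Build _ _ _ _ _ (measurable_rv_comb b r).
pose Z : {mfun T >-> N.-tuple R} := HB.pack (rv_comb b r) mixin.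
pose G (p : N.-tuple R * R) := f (tshift (tadd z p.1) p.2 (b i)).
have mG : measurable_fun setT G.
  apply: (measurableT_comp mf).
  rewrite (_ : (fun p => _) = fun p : N.-tuple R * R => tadd z (tshift p.1 p.2 (b i))); last first.
    by apply/funext => p; rewrite tshift_add.
  by apply: (measurableT_comp (measurable_tadd z)); exact: measurable_tshift.
transitivity (\int[P]_w G (Z w, E i w))%E.
  apply: eq_integral => w _; congr f; rewrite tshift_add; congr tadd.
  apply: eq_from_tnth => a; rewrite !tnth_mktuple big_cons/=.
  by rewrite addrC.
have G0 p : (0 <= G p)%E by exact: f0.
rewrite (@ge0_integral_indep _ _ Z (E i) G _ mG G0); last first.
  move=> A B mA mB.
  apply: (@indep_coords [set j in r] i N b r) => //; first by rewrite inE.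
  by move=> j; rewrite inE.
pose H (x : R) := (\int[P]_w G (Z w, x))%E.
have mH : measurable_fun setT H.
  have mG' : measurable_fun setT (fun p : R * T => G (Z p.2, p.1)).
    apply: (measurableT_comp mG); apply: measurable_fun_pair => //.
    by apply: measurableT_comp.
  exact: (measurable_fun_fubini_tonelli_F (m2 := P) _ mG').
have H0 x : (0 <= H x)%E by exact: integral_ge0.
transitivity (\int[normal_prob 0 s]_x H x)%E.
  exact: ge0_integral_law.
apply: eq_integral => x _; rewrite -IH//; apply: eq_integral => w _.
by rewrite /G; congr f; apply: eq_from_tnth => a; rewrite !tnth_mktuple addrAC.
Qed.

End Independence.

(** * Tail of the largest bilinear form *)

Section GaussianMatrixTail.
Context {d : measure_display} {T : measurableType d} {R : realType}.
Variables (P : probability T R) (m n q : nat) (s : R) (s_gt0 : 0 < s).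
Variables (E : 'I_m * 'I_n -> {RV P >-> R}) (noiseE : gaussian_noise s E).
Variables (Q : 'M[R]_(m, q)) (QTQ : Q^T *m Q = 1%:M).
Hypotheses (q_gt0 : (0 < q)%N) (n_gt0 : (0 < n)%N).

(** The coefficient of E_ij in u^T Q^T E v. The matrix Q^T E enters only through these linear forms
    in the entries of E, whose Gram matrix follows from Q^T Q = 1. *)
Definition bilin_dir (u : 'I_q -> R) (v : 'I_n -> R) (ij : 'I_m * 'I_n) : R :=
  (\sum_l Q ij.1 l * u l) * v ij.2.

Definition bilin (u : 'I_q -> R) (v : 'I_n -> R) (w : T) : R :=
  \sum_ij E ij w * bilin_dir u v ij.

Lemma measurable_bilin u v : measurable_fun setT (bilin u v).
Proof. by apply: measurable_sum => ij; apply: measurable_funM. Qed.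

Lemma dot_isometry (u u' : 'I_q -> R) :
  \sum_i (\sum_l Q i l * u l) * (\sum_l Q i l * u' l) = \sum_l u l * u' l.
Proof.
transitivity (\sum_l \sum_k u l * u' k * (Q^T *m Q) l k).
  under eq_bigr do rewrite mulr_suml.
  rewrite exchange_big/=; apply: eq_bigr => l _.
  under eq_bigr do rewrite mulr_sumr.
  rewrite exchange_big/=; apply: eq_bigr => k _.
  rewrite mxE mulr_sumr; apply: eq_bigr => i _.
  by rewrite mxE; ring.
apply: eq_bigr => l _; rewrite (bigD1 l)//= QTQ mxE eqxx mulr1 big1 ?addr0// => k kl.
by rewrite mxE eq_sym (negbTE kl) mulr0.
Qed.

Section Finite.
Variables (N : nat) (N_gt0 : (0 < N)%N).
Variables (u : 'I_N -> 'I_q -> R) (v : 'I_N -> 'I_n -> R).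
Hypothesis u_unit : forall a, \sum_i u a i ^+ 2 = 1.
Hypothesis v_unit : forall a, \sum_j v a j ^+ 2 = 1.

Let dirs (ij : 'I_m * 'I_n) (a : 'I_N) : R := bilin_dir (u a) (v a) ij.

Let gramE a c : gram [seq dirs ij | ij <- index_enum ('I_m * 'I_n)%type] a c =
  (\sum_i u a i * u c i) * (\sum_j v a j * v c j).
Proof.
rewrite /gram big_map -dot_isometry mulr_suml.
under [RHS]eq_bigr do rewrite mulr_sumr.
rewrite pair_big/=; apply: eq_bigr => -[i j] _.
by rewrite /dirs /bilin_dir/=; ring.
Qed.

Lemma bilin_max_tail_alpha (lam t alpha : R) : 0 < lam -> 0 < alpha -> alpha <= 1 ->
  ((expR (lam * t))%:E * P (\bigcup_(a in [set: 'I_N]) [set w | t < bilin (u a) (v a) w]%R) <=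
   (expR (alpha * ln N%:R) *
    expR (lam * s * (Num.sqrt n%:R + Num.sqrt q%:R) + lam ^+ 2 * s ^+ 2 / 2))%:E)%E.
Proof.
move=> l0 a0 a1; set A := \bigcup_(a in _) _.
have mA : measurable A.
  apply: fin_bigcup_measurable; first exact: finite_finset.
  move=> a _; rewrite -[X in measurable X]setTI.
  rewrite (_ : [set w | _] = bilin (u a) (v a) @^-1` `]t, +oo[); last first.
    by apply/seteqP; split => w /=; rewrite in_itv/= andbT.
  by apply: measurable_bilin.
pose beta := lam / alpha.
have b0 : 0 < beta by rewrite divr_gt0.
have ab : alpha * beta = lam by rewrite mulrC divfK// gt_eqF.
pose F : N.-tuple R -> \bar R := EFin \o softmax alpha beta (fun=> 1%R).
have nF : nnmeas F := nnmeas_softmax _ _ _.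
have := chevet s_gt0 N_gt0 a0 a1 b0 q_gt0 n_gt0 u_unit v_unit gramE.
rewrite ab; apply: le_trans.
rewrite -/F -(integral_rv_comb noiseE.1 noiseE.2 dirs (tzero N) (index_enum_uniq _) nF).
have -> : P A = (\int[P]_w (\1_A w)%:E)%E by rewrite integral_indic// setIT.
have m1A : measurable_fun setT (fun w => (\1_A w)%:E : \bar R).
  by apply/measurable_EFinP.
rewrite -ge0_integralZl//.
have mZ := measurable_rv_comb E dirs (index_enum ('I_m * 'I_n)%type).
apply: ge0_le_integral => //.
- exact: emeasurable_funM.
- by apply: (measurableT_comp nF.1); apply: (measurableT_comp (measurable_tadd _)).
move=> w _; rewrite -EFinM lee_fin.
rewrite indicE; case: (boolP (w \in A)) => [/set_mem [a _ /= ta]|_]; last by rewrite mulr0 expR_ge0.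
rewrite mulr1.
have := le_softmax N_gt0 beta a0 (tadd (tzero N) (rv_comb E dirs (index_enum ('I_m * 'I_n)%type) w)) a.
apply: le_trans; rewrite ler_expR ab ler_pM2l// !tnth_mktuple add0r; exact: ltW.
Qed.

(** The factor N^alpha is removed by taking alpha small: it suffices to prove the bound after
    multiplying the probability by an arbitrary r < 1. *)
Lemma bilin_max_tail (lam t : R) : 0 < lam ->
  (P (\bigcup_(a in [set: 'I_N]) [set w | t < bilin (u a) (v a) w]%R) <=
   (expR (- (lam * t) + (lam * s * (Num.sqrt n%:R + Num.sqrt q%:R) + lam ^+ 2 * s ^+ 2 / 2)))%:E)%E.
Proof.
move=> l0; set A := \bigcup_(a in _) _; set D := _ + _ / 2.
apply/lee_mul01Pr => // r /andP[r0 r1].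
have lr : 0 < - ln r by rewrite oppr_gt0 ln_lt0// r0.
have lN : 0 <= ln (N%:R : R) by rewrite ln_ge0// ler1n.
(* Chosen so that N^alpha <= r^-1; the summand 1 keeps the denominator positive when N = 1. *)
pose alpha : R := Num.min 1 (- ln r / (1 + ln N%:R)).
have N1 : 0 < 1 + ln (N%:R : R) by rewrite ltr_pwDl.
have a0 : 0 < alpha by rewrite lt_min ltr01 divr_gt0.
have a1 : alpha <= 1 by rewrite ge_min lexx.
have aN : alpha * ln N%:R <= - ln r.
  apply: (@le_trans _ _ (alpha * (1 + ln N%:R))); first by rewrite ler_pM2l// lerDr.
  by rewrite -ler_pdivlMr// ge_min lexx orbT.
have := bilin_max_tail_alpha t l0 a0 a1; rewrite -/A -/D.
move=> h; have {}h : (P A <= (expR (lam * t))^-1%:E * (expR (alpha * ln N%:R) * expR D)%:E)%E.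
  by rewrite lee_pdivlMl ?expR_gt0.
have r0' : (0 <= r%:E)%E by rewrite lee_fin ltW.
apply: (le_trans (lee_wpmul2l r0' h)).
have -> : r = expR (ln r) by rewrite lnK// posrE.
by rewrite -!EFinM lee_fin -expRN -!expRD ler_expR; lra.
Qed.

End Finite.

Section Countable.
Variables (u : nat -> 'I_q -> R) (v : nat -> 'I_n -> R).
Hypothesis u_unit : forall k, \sum_i u k i ^+ 2 = 1.
Hypothesis v_unit : forall k, \sum_j v k j ^+ 2 = 1.

Let measurable_gt t k : measurable [set w | t < bilin (u k) (v k) w]%R.
Proof.
rewrite -[X in measurable X]setTI.
rewrite (_ : [set w | _] = bilin (u k) (v k) @^-1` `]t, +oo[); last first.
  by apply/seteqP; split => w /=; rewrite in_itv/= andbT.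
exact: measurable_bilin.
Qed.

Lemma measurable_bilin_sup t : measurable (\bigcup_k [set w | t < bilin (u k) (v k) w]%R).
Proof. by apply: bigcup_measurable => k _; exact: measurable_gt. Qed.

(** The bound for finitely many pairs does not involve their number, so it passes to the countable
    union by continuity from below. *)
Lemma bilin_sup_tail (theta : R) : 0 < theta ->
  (P (\bigcup_k [set w | s * (Num.sqrt n%:R + Num.sqrt q%:R) + theta * s * Num.sqrt (n + q)%:R
       < bilin (u k) (v k) w]%R) <= (tail_bound theta (n + q))%:E)%E.
Proof.
move=> th0; set t := _ + _; set A := fun k => [set w | t < bilin (u k) (v k) w].
pose F k := \bigcup_(a in [set: 'I_k.+1]) A a.
have mF k : measurable (F k) by apply: fin_bigcup_measurable => [|a _]; [exact: finite_finset|exact: measurable_gt].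
have ndF : {homo F : a b / (a <= b)%N >-> (a <= b)%O}.
  move=> a b ab; apply/subsetPset => w [i _ Aw].
  by exists (widen_ord (ab : (a.+1 <= b.+1)%N) i).
have UF : \bigcup_k A k = \bigcup_k F k.
  apply/seteqP; split => w [k _ h]; last by case: h => i _ h; exists i.
  by exists k => //; exists ord_max.
rewrite UF.
have cv : P (F k) @[k --> \oo] --> P (\bigcup_k F k).
  by apply: nondecreasing_cvg_mu => //; exact: bigcup_measurable.
have N0 : 0 < Num.sqrt ((n + q)%:R : R) by rewrite sqrtr_gt0 ltr0n addn_gt0 n_gt0.
have N2 : Num.sqrt ((n + q)%:R : R) ^+ 2 = (n + q)%:R by rewrite sqr_sqrtr.
apply: (cvge_to_le cv); apply: nearW => k.
pose lam := theta * Num.sqrt (n + q)%:R / s.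
have l0 : 0 < lam by rewrite divr_gt0// mulr_gt0.
apply: (le_trans (bilin_max_tail (ltn0Sn k) (u := fun a => u a) (v := fun a => v a) _ _ _ l0)) => //.
rewrite lee_fin ler_expR /tail_bound le_eqVlt; apply/orP; left; apply/eqP.
rewrite /t /lam; set rt := Num.sqrt (n + q)%:R in N0 N2 *; rewrite -N2.
by field; rewrite gt_eqF.
Qed.

End Countable.
End GaussianMatrixTail.

(** * Singular values *)

Section Spectral.
Variable R : rcfType.

(** Over the complex numbers the matrix is Hermitian, hence unitarily diagonalizable with real
    spectrum; a real root of the complexified characteristic polynomial is a root over R. *)
Lemma symmetric_eigenvalue n (A : 'M[R]_n.+1) : A^T = A -> exists x, eigenvalue A x.
Proof.
move=> Asym.
pose iota : {rmorphism R -> complex R} := real_complex R.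
pose AC := map_mx iota A.
have ACreal : AC \is a mxOver Num.real.
  apply/mxOverP => i j; rewrite mxE; apply/complex_realP; by exists (A i j).
have ACsym : AC \is symmetricmx.
  by apply/is_hermitianmxP; rewrite expr0 scale1r map_mx_id// /AC map_trmx Asym.
have ACherm := realsym_hermsym ACsym ACreal.
have /mxOverP/(_ 0 0)/complex_realP[x xE] := hermitian_spectral_diag_real ACherm.
have /orthomx_spectralP AE := hermitian_normalmx ACherm.
exists x; rewrite eigenvalue_root_char -(fmorph_root iota) map_char_poly -/AC.
rewrite -eigenvalue_root_char; apply/eigenvalueP.
have Pu := spectral_unit AC.
exists (row 0 (spectralmx AC)); rewrite -?row_mul.
  have -> : spectralmx AC *m AC = diag_mx (spectral_diag AC) *m spectralmx AC.
    by rewrite {2}AE -mulmxA mulKVmx.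
  apply/rowP => j.
  by rewrite mxE mul_diag_mx !mxE xE.
apply/eqP => r0; have := mulmxV Pu => /(congr1 (row 0)); rewrite row_mul r0 mul0mx.
by move=> /rowP/(_ 0); rewrite !mxE eqxx => /eqP; rewrite eq_sym oner_eq0.
Qed.

Lemma dot_ge0 n (x : 'rV[R]_n) : 0 <= (x *m x^T) 0 0.
Proof. by rewrite mxE; apply: sumr_ge0 => i _; rewrite mxE -expr2 sqr_ge0. Qed.

Lemma dot_eq0 n (x : 'rV[R]_n) : ((x *m x^T) 0 0 == 0) = (x == 0).
Proof.
apply/idP/eqP => [|->]; last by rewrite mul0mx mxE.
rewrite mxE => /eqP/psumr_eq0P h; apply/rowP => i; rewrite mxE; apply/eqP.
have := h (fun j _ => _) i isT; rewrite mxE -expr2 => h2.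
rewrite -sqrf_eq0; apply/eqP/h2 => j.
by rewrite mxE -expr2 sqr_ge0.
Qed.

(* The reflection exchanging v and the first vector of the canonical basis. *)
Lemma orthogonal_with_row0 n (v : 'rV[R]_n.+1) : (v *m v^T) 0 0 = 1 ->
  exists2 H : 'M[R]_n.+1, H *m H^T = 1%:M & row 0 H = v.
Proof.
move=> v1; pose e : 'rV[R]_n.+1 := row 0 1%:M.
have eT (w : 'rV[R]_n.+1) : e *m w^T = (w 0 0)%:M.
  rewrite [LHS]mx11_scalar -row_mul mul1mx; congr _%:M.
  by rewrite !mxE.
have [ve|ve] := eqVneq v e; first by exists 1%:M; rewrite ?trmx1 ?mulmx1// ve.
pose u := e - v; pose c := (u *m u^T) 0 0.
have uu : u *m u^T = c%:M by rewrite [LHS]mx11_scalar.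
have c0 : c != 0 by rewrite dot_eq0 subr_eq0 eq_sym.
have cE : c = 2 * (1 - v 0 0).
  have vv : v *m v^T = 1%:M by rewrite [LHS]mx11_scalar v1.
  have ve' : v *m e^T = (v 0 0)%:M by rewrite -[LHS]trmxK trmx_mul trmxK eT tr_scalar_mx.
  rewrite /c /u linearB/= mulmxBl !mulmxBr vv ve' !eT !mxE !eqxx !mulr1n; ring.
have u0 : u 0 0 = 1 - v 0 0 by rewrite !mxE eqxx.
have uE j : e 0 j - u 0 j = v 0 j by rewrite !mxE; ring.
clearbody u c.
pose H := 1%:M - (2 / c) *: (u^T *m u).
have HT : H^T = H by rewrite /H linearB/= trmx1 linearZ/= trmx_mul trmxK.
exists H.
  rewrite HT /H mulmxBl !mulmxBr !mul1mx !mulmx1 -!scalemxAl -!scalemxAr.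
  rewrite [u^T *m u *m _]mulmxA -(mulmxA u^T) uu mul_mx_scalar -scalemxAl !scalerA.
  rewrite (_ : 2 / c * (2 / c) * c = 2 / c + 2 / c); last by field.
  rewrite scalerDl; move: ((2 / c) *: _) => Z.
  have -> : Z - (Z + Z) = - Z by rewrite opprD addrA subrr sub0r.
  by rewrite opprK subrK.
rewrite /H; apply/rowP => j; rewrite !mxE.
rewrite big_ord_recl big_ord0 addr0 mxE u0.
have -> : 2 / c * ((1 - v 0 0) * u 0 j) = u 0 j.
  by rewrite mulrA -[2 / c * _]mulrAC -cE divff// mul1r.
by rewrite -uE !mxE.
Qed.

(** Deflation: a unit eigenvector becomes the first row of an orthogonal H, and by symmetry H A H^T
    is block diagonal with the eigenvalue as its first block. *)
Lemma real_spectral n (A : 'M[R]_n) : A^T = A ->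
  exists V : 'M[R]_n, exists l : 'rV[R]_n, V *m V^T = 1%:M /\ A = V^T *m diag_mx l *m V.
Proof.
elim: n A => [|n IH] A Asym.
  by exists 1%:M, 0; split; [rewrite trmx1 mulmx1|apply/matrixP => -[]].
have [x /eigenvalueP[v0 vA v00]] := symmetric_eigenvalue Asym.
pose v := (Num.sqrt ((v0 *m v0^T) 0 0))^-1 *: v0.
have d0 : 0 < (v0 *m v0^T) 0 0 by rewrite lt_neqAle dot_ge0 andbT eq_sym dot_eq0.
have v1 : (v *m v^T) 0 0 = 1.
  rewrite /v linearZ/= -scalemxAl -scalemxAr scalerA mxE -invfM -expr2 sqr_sqrtr ?ltW//.
  by rewrite mulVf// gt_eqF.
have {}vA : v *m A = x *: v by rewrite /v -scalemxAl vA !scalerA mulrC.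
have [H HHT H0] := orthogonal_with_row0 v1.
have HTH : H^T *m H = 1%:M by exact: mulmx1C.
pose B : 'M[R]_(1 + n) := H *m A *m H^T.
have BT : B^T = B by rewrite /B !trmx_mul trmxK Asym mulmxA.
have B0 : row 0 B = x *: row 0 1%:M.
  by rewrite /B !row_mul H0 vA -scalemxAl -H0 -row_mul HHT.
have Bur : ursubmx B = 0.
  apply/matrixP => i j; rewrite ord1 !mxE.
  have /rowP/(_ (rshift 1 j)) := B0; rewrite !mxE (_ : lshift n 0 = 0) => [->|]; last exact/val_inj.
  by rewrite mulr0n mulr0.
have Bul : ulsubmx B = x%:M.
  apply/matrixP => i j; rewrite !ord1 !mxE.
  have /rowP/(_ (lshift n 0)) := B0; rewrite !mxE (_ : lshift n 0 = 0) => [->|]; last exact/val_inj.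
  by rewrite eqxx mulr1.
have Bdl : dlsubmx B = 0 by rewrite -[B]BT -trmx_ursub Bur trmx0.
have BE : B = block_mx x%:M 0 0 (drsubmx B) by rewrite -[LHS]submxK Bur Bul Bdl.
have [V' [l' [V1 DE]]] : exists V : 'M[R]_n, exists l : 'rV[R]_n, V *m V^T = 1%:M /\ drsubmx B = V^T *m diag_mx l *m V.
  by apply: IH; rewrite trmx_drsub BT.
pose W : 'M[R]_(1 + n) := block_mx 1%:M 0 0 V'.
have WW : W *m W^T = 1%:M.
  rewrite /W tr_block_mx mulmx_block.
  by rewrite !trmx0 !trmx1 !mulmx0 !mul0mx !mulmx1 !addr0 add0r V1 -scalar_mx_block.
pose L : 'rV[R]_(1 + n) := row_mx x%:M l'.
have WLW : W^T *m diag_mx L *m W = B.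
  rewrite BE diag_mx_row /W tr_block_mx !mulmx_block !trmx0 !trmx1.
  rewrite !mulmx0 !mul0mx !mul1mx !mulmx1 !addr0 !add0r DE.
  congr block_mx; last by rewrite mul0mx.
  by apply/matrixP => i j; rewrite !ord1 !mxE eqxx !mulr1n.
exists (W *m H), L; split.
  by rewrite trmx_mul mulmxA -(mulmxA W) HHT mulmx1.
have -> : A = H^T *m B *m H by rewrite /B !mulmxA HTH mul1mx -mulmxA HTH mulmx1.
by rewrite trmx_mul -WLW !mulmxA.
Qed.

End Spectral.

Section SqNorm.
Variables (R : rcfType) (n : nat).
Implicit Types x y : 'rV[R]_n.

Definition sqnorm x : R := (x *m x^T) 0 0.

Lemma sqnormE x : sqnorm x = \sum_i x 0 i ^+ 2.
Proof. by rewrite /sqnorm mxE; apply: eq_bigr => i _; rewrite mxE expr2. Qed.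

Lemma sqnorm_ge0 x : 0 <= sqnorm x. Proof. exact: dot_ge0. Qed.

Lemma sqnorm_eq0 x : (sqnorm x == 0) = (x == 0). Proof. exact: dot_eq0. Qed.

Lemma sqnorm_gt0 x : x != 0 -> 0 < sqnorm x.
Proof. by move=> x0; rewrite lt_neqAle sqnorm_ge0 andbT eq_sym sqnorm_eq0. Qed.

Definition nrm x : R := Num.sqrt (sqnorm x).

Lemma nrm_ge0 x : 0 <= nrm x. Proof. exact: sqrtr_ge0. Qed.

Lemma nrm_sqr x : nrm x ^+ 2 = sqnorm x. Proof. by rewrite sqr_sqrtr ?sqnorm_ge0. Qed.

Lemma nrm0 : nrm 0 = 0.
Proof. by rewrite /nrm sqnormE big1 ?sqrtr0// => i _; rewrite mxE expr0n. Qed.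

Lemma nrm_gt0 x : x != 0 -> 0 < nrm x. Proof. by move=> x0; rewrite sqrtr_gt0 sqnorm_gt0. Qed.

End SqNorm.

Section CauchySchwarz.
Variable R : rcfType.

Lemma sum_cauchy_schwarz (I : finType) (a b : I -> R) :
  (\sum_i a i * b i) ^+ 2 <= (\sum_i a i ^+ 2) * (\sum_i b i ^+ 2).
Proof.
set A := \sum_i a i ^+ 2; set B := \sum_i b i ^+ 2; set C := \sum_i a i * b i.
have B0 : 0 <= B by apply: sumr_ge0 => i _; exact: sqr_ge0.
have : 0 <= \sum_i (B * a i - C * b i) ^+ 2 by apply: sumr_ge0 => i _; exact: sqr_ge0.
have -> : \sum_i (B * a i - C * b i) ^+ 2 = B * (A * B - C ^+ 2).
  transitivity (\sum_i (B ^+ 2 * a i ^+ 2 - 2 * B * C * (a i * b i) + C ^+ 2 * b i ^+ 2)).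
    by apply: eq_bigr => i _; ring.
  by rewrite big_split/= sumrB -!mulr_sumr -/A -/B -/C; ring.
move=> h; move: (B0); rewrite le_eqVlt => /orP[/eqP B00|B00]; last first.
  by rewrite pmulr_rge0 in h; rewrite // -subr_ge0.
suff -> : C = 0 by rewrite expr0n/= mulr_ge0// sumr_ge0// => i _; exact: sqr_ge0.
rewrite /C big1// => i _.
have /psumr_eq0P h0 := esym B00.
have /eqP := h0 (fun j _ => sqr_ge0 (b j)) i isT.
by rewrite sqrf_eq0 => /eqP ->; rewrite mulr0.
Qed.

Lemma nrmD n (x y : 'rV[R]_n) : nrm (x + y) <= nrm x + nrm y.
Proof.
rewrite -(@ler_pXn2r _ 2)// ?nnegrE ?addr_ge0 ?nrm_ge0//.
rewrite sqrrD !nrm_sqr !sqnormE.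
have cs := sum_cauchy_schwarz (fun i => x 0 i) (fun i => y 0 i).
have xy : \sum_i x 0 i * y 0 i <= nrm x * nrm y.
  apply: (le_trans (ler_norm _)).
  rewrite -(@ler_pXn2r _ 2)// ?nnegrE ?mulr_ge0 ?nrm_ge0//.
  by rewrite real_normK ?num_real// exprMn !nrm_sqr !sqnormE.
under eq_bigr do rewrite mxE sqrrD.
rewrite !big_split/=; lra.
Qed.

Lemma nrmN n (x : 'rV[R]_n) : nrm (- x) = nrm x.
Proof. by rewrite /nrm !sqnormE; under eq_bigr do rewrite mxE sqrrN. Qed.

Lemma nrmB n (x y : 'rV[R]_n) : nrm x - nrm y <= nrm (x + y).
Proof. by rewrite lerBlDr -{1}(addrK y x) (le_trans (nrmD _ _))// nrmN. Qed.

End CauchySchwarz.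

Lemma char_poly_conj (R : comNzRingType) n (V W A : 'M[R]_n) : W *m V = 1%:M ->
  char_poly (W *m A *m V) = char_poly A.
Proof.
move=> WV; rewrite /char_poly.
have -> : char_poly_mx (W *m A *m V) = map_mx polyC W *m char_poly_mx A *m map_mx polyC V.
  rewrite /char_poly_mx mulmxBr mulmxBl -!map_mxM; congr (_ - _).
  by rewrite mul_mx_scalar -scalemxAl -map_mxM WV map_scalar_mx/= scalemx1.
rewrite !det_mulmx mulrAC -det_mulmx -map_mxM WV map_scalar_mx/= det1 mul1r.
by [].
Qed.

Section GramEigenvalues.
Variable R : realType.

Lemma perm_roots_mup (s : seq R) (p := \prod_(x <- s) ('X - x%:P)) :
  perm_eq (flatten [seq nseq (mup x p) x | x <- rootsR p]) s.
Proof.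
have p0 : p != 0 by rewrite monic_neq0// monic_prod_XsubC.
apply/allP => x _ /=; apply/eqP; rewrite count_flatten -map_comp.
rewrite -(mu_prod_XsubC x s) -/p.
transitivity (\sum_(y <- rootsR p) (if y == x then mup x p else 0))%N.
  rewrite sumnE big_map; apply: eq_bigr => y _ /=; rewrite count_nseq/=.
  by case: eqP => [->|_]; rewrite ?mul1n ?mul0n.
have [xr|xr] := boolP (x \in rootsR p).
  rewrite (bigD1_seq x)//= ?uniq_roots// eqxx big1 ?addn0// => y /negbTE ->.
  by [].
rewrite big1_seq => [|y /= yr]; last by case: eqP => // yx; rewrite -yx yr in xr.
apply/esym/mupNroot; apply: contraNN xr => xr.
by have := roots_on_rootsR p0 => /(_ x); rewrite inE/= xr.
Qed.

(** Links the definition by the characteristic polynomial to an orthonormal eigenbasis: conjugation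
    preserves that polynomial, which for a diagonal matrix splits with roots l. Each l_i is the
    squared norm of [row i V *m C^T]. *)
Lemma gram_spectral m n (C : 'M[R]_(m, n)) :
  exists V : 'M[R]_n, exists l : 'rV[R]_n, [/\ V *m V^T = 1%:M,
    C^T *m C = V^T *m diag_mx l *m V, forall i, 0 <= l 0 i &
    perm_eq (gram_eigenvalues C) [seq l 0 i | i <- index_enum 'I_n]].
Proof.
have [V [l [VV CE]]] : exists V : 'M[R]_n, exists l : 'rV[R]_n, V *m V^T = 1%:M /\
    C^T *m C = V^T *m diag_mx l *m V.
  by apply: real_spectral; rewrite trmx_mul trmxK.
exists V, l; split => //.
- move=> i; have -> : l 0 i = sqnorm (row i V *m C^T).
    have e1 : row i V *m V^T = row i 1%:M by rewrite -row_mul VV.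
    have e2 : V *m (row i V)^T = (row i 1%:M)^T by rewrite -e1 trmx_mul trmxK.
    rewrite /sqnorm trmx_mul trmxK mulmxA -(mulmxA _ C^T) CE !mulmxA e1 -(mulmxA _ V) e2.
    rewrite -row_mul mul1mx mxE (bigD1 i)//= !mxE eqxx mulr1 mulr1n.
    by rewrite big1 ?addr0// => j ji; rewrite !mxE [i == j]eq_sym (negbTE ji) mulr0n mul0r.
  exact: sqnorm_ge0.
rewrite /gram_eigenvalues perm_sort CE char_poly_conj ?(mulmx1C VV)//.
rewrite char_poly_trig ?is_diag_mx_is_trig ?diag_mx_is_diag//.
have -> : \prod_(i < n) ('X - (diag_mx l i i)%:P) = \prod_(x <- [seq l 0 i | i <- index_enum 'I_n]) ('X - x%:P).
  by rewrite big_map; apply: eq_bigr => i _; rewrite mxE eqxx mulr1n.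
exact: perm_roots_mup.
Qed.

End GramEigenvalues.

Section SingularSubspaces.
Variable R : realType.

Lemma count_singular_values m n (C : 'M[R]_(m, n)) (l : 'rV[R]_n) (p : pred R) :
  perm_eq (gram_eigenvalues C) [seq l 0 i | i <- index_enum 'I_n] ->
  count p (singular_values C) = #|[pred i | p (Num.sqrt (l 0 i))]|.
Proof.
move=> /permP h; rewrite /singular_values count_map h count_map -sum1_count -sum1_card.
by [].
Qed.

Lemma size_singular_values m n (C : 'M[R]_(m, n)) : size (singular_values C) = n.
Proof.
have [V [l [_ _ _ /perm_size h]]] := gram_spectral C.
by rewrite /singular_values size_map h size_map -[RHS]card_ord cardT enumT.
Qed.

(** On the span of the right singular vectors whose singular value satisfies [p], both quadratic
    forms are diagonal: [f] holds the squared coordinates of x and [d] the singular values. *)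
Lemma sv_subspace m n (C : 'M[R]_(m, n)) (p : pred R) :
  exists k, exists2 U : 'M[R]_(k, n), k = count p (singular_values C) /\ row_free U &
  forall x : 'rV[R]_n, (x <= U)%MS -> exists f d : 'I_k -> R,
   [/\ forall i, 0 <= f i, forall i, 0 <= d i /\ p (d i),
       sqnorm x = \sum_i f i & sqnorm (x *m C^T) = \sum_i d i ^+ 2 * f i].
Proof.
have [V [l [VV CE l0 /(count_singular_values p) cE]]] := gram_spectral C.
pose a := [pred i | p (Num.sqrt (l 0 i))].
pose ev : 'I_#|a| -> 'I_n := enum_val.
pose U := rowsub ev V.
have UV : U *m V^T = rowsub ev 1%:M by rewrite -VV mul_rowsub_mx.
have UU : U *m U^T = 1%:M.
  apply/matrixP => i j; have /matrixP/(_ (ev i) (ev j)) := VV.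
  rewrite !mxE (inj_eq enum_val_inj) => <-.
  by apply: eq_bigr => k _; rewrite !mxE.
exists #|a|, U; first by split => //; apply/row_freeP; exists U^T.
move=> x /submxP[z ->].
exists (fun i => z 0 i ^+ 2), (fun i => Num.sqrt (l 0 (ev i))); split.
- by move=> i; exact: sqr_ge0.
- by move=> i; rewrite sqrtr_ge0; split => //; have := enum_valP i; rewrite inE.
- by rewrite -sqnormE /sqnorm trmx_mul mulmxA -(mulmxA z) UU mulmx1.
rewrite /sqnorm !trmx_mul trmxK !mulmxA -(mulmxA _ C^T C) CE.
have -> : z *m U *m (V^T *m diag_mx l *m V) *m U^T *m z^T =
   z *m (U *m V^T *m diag_mx l *m (U *m V^T)^T) *m z^T.
  by rewrite trmx_mul trmxK !mulmxA.
have -> : U *m V^T *m diag_mx l *m (U *m V^T)^T = diag_mx (\row_i l 0 (ev i)).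
  apply/matrixP => i j; rewrite UV mul_mx_diag mxE (bigD1 (ev i))//= big1 ?addr0 => [|k ki].
    by rewrite !mxE eqxx mul1r (inj_eq enum_val_inj) eq_sym mulr_natr.
  by rewrite !mxE eq_sym (negbTE ki) !mul0r.
rewrite mul_mx_diag mxE; apply: eq_bigr => i _.
by rewrite !mxE sqr_sqrtr// expr2 mulrAC mulrC.
Qed.

Lemma subspace_sv_ge m n (C : 'M[R]_(m, n)) (c : R) : 0 <= c ->
  exists k, exists2 U : 'M[R]_(k, n),
    k = count (fun d => (c <= d)%R) (singular_values C) /\ row_free U &
  forall x : 'rV[R]_n, (x <= U)%MS -> c * nrm x <= nrm (x *m C^T).
Proof.
move=> c0; have [k [U kU h]] := sv_subspace C (fun d => (c <= d)%R).
exists k, U => // x /h[f [d [f0 d0 xE yE]]].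
rewrite -(@ler_pXn2r _ 2)// ?nnegrE ?mulr_ge0 ?nrm_ge0// exprMn !nrm_sqr xE yE.
rewrite mulr_sumr; apply: ler_sum => i _; have [di ci] := d0 i.
by rewrite ler_wpM2r// ler_pXn2r// nnegrE.
Qed.

Lemma subspace_sv_le m n (C : 'M[R]_(m, n)) (c : R) : 0 <= c ->
  exists k, exists2 U : 'M[R]_(k, n),
    k = count (fun d => (d <= c)%R) (singular_values C) /\ row_free U &
  forall x : 'rV[R]_n, (x <= U)%MS -> nrm (x *m C^T) <= c * nrm x.
Proof.
move=> c0; have [k [U kU h]] := sv_subspace C (fun d => (d <= c)%R).
exists k, U => // x /h[f [d [f0 d0 xE yE]]].
rewrite -(@ler_pXn2r _ 2)// ?nnegrE ?mulr_ge0 ?nrm_ge0// exprMn !nrm_sqr xE yE.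
rewrite mulr_sumr; apply: ler_sum => i _; have [di ci] := d0 i.
by rewrite ler_wpM2r// ler_pXn2r// nnegrE.
Qed.

Lemma subspace_sv_lt m n (C : 'M[R]_(m, n)) (c : R) : 0 <= c ->
  exists k, exists2 U : 'M[R]_(k, n),
    k = count (fun d => (d < c)%R) (singular_values C) /\ row_free U &
  forall x : 'rV[R]_n, (x <= U)%MS -> x != 0 -> nrm (x *m C^T) < c * nrm x.
Proof.
move=> c0; have [k [U kU h]] := sv_subspace C (fun d => (d < c)%R).
exists k, U => // x /h[f [d [f0 d0 xE yE]]] x0.
rewrite -(@ltr_pXn2r _ 2)// ?nnegrE ?mulr_ge0 ?nrm_ge0// exprMn !nrm_sqr xE yE.
rewrite mulr_sumr -subr_gt0 -sumrB.
have t0 i : 0 <= c ^+ 2 * f i - d i ^+ 2 * f i.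
  have [di ci] := d0 i; rewrite subr_ge0 ler_wpM2r// ler_pXn2r ?nnegrE//.
  exact: ltW.
rewrite lt_neqAle sumr_ge0 ?andbT// eq_sym; apply: contraNN x0 => /eqP/psumr_eq0P h0.
rewrite -sqnorm_eq0 xE big1// => i _.
have := h0 (fun j _ => t0 j) i isT; rewrite -mulrBl => /eqP; rewrite mulf_eq0 => /orP[|/eqP//].
have [di ci] := d0 i.
by rewrite subr_eq0 eqrXn2// => /eqP cd; rewrite cd ltxx in ci.
Qed.

Lemma subspaces_meet n k1 k2 (U1 : 'M[R]_(k1, n)) (U2 : 'M[R]_(k2, n)) :
  row_free U1 -> row_free U2 -> (n < k1 + k2)%N ->
  exists2 x : 'rV[R]_n, x != 0 & (x <= U1)%MS && (x <= U2)%MS.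
Proof.
move=> /eqP r1 /eqP r2 nk.
have rk := mxrank_sum_cap U1 U2; rewrite r1 r2 in rk.
have le := rank_leq_col (U1 + U2)%MS.
have cap0 : (U1 :&: U2)%MS != 0 by rewrite -mxrank_eq0; lia.
have /rowV0Pn[x xU x0] := cap0.
by exists x; rewrite // -sub_capmx.
Qed.

(** One half of the Courant-Fischer principle: were k larger, U would by dimension meet the span of
    the right singular vectors with values below c, where the opposite strict inequality holds. *)
Lemma count_sv_lower m n (C : 'M[R]_(m, n)) (c : R) k (U : 'M[R]_(k, n)) : 0 <= c ->
  row_free U -> (forall x, (x <= U)%MS -> c * nrm x <= nrm (x *m C^T)) ->
  (k <= count (fun d => (c <= d)%R) (singular_values C))%N.
Proof.
move=> c0 Uf h; rewrite leqNgt; apply/negP => lt_k.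
have [k' [W [kE Wf] hW]] := subspace_sv_lt C c0.
have cn : (count (fun d => (c <= d)%R) (singular_values C) + k' = n)%N.
  rewrite kE -[RHS](size_singular_values C) -(count_predC (fun d => (c <= d)%R)); congr addn.
  by apply: eq_count => d /=; rewrite ltNge.
have [|x x0 /andP[xU xW]] := subspaces_meet Uf Wf; first by lia.
by have := hW x xW x0; rewrite ltNge h.
Qed.

(* Weyl's inequality, in the form of a comparison of counting functions. *)
Lemma count_sv_perturb m n (M G : 'M[R]_(m, n)) (c t : R) : 0 <= c -> 0 <= t ->
  (forall x, nrm (x *m G^T) <= t * nrm x) ->
  (count (fun d => (c + t <= d)%R) (singular_values M) <=
   count (fun d => (c <= d)%R) (singular_values (M + G)))%N.
Proof.
move=> c0 t0 hG.
have [k [U [<- Uf] hU]] := subspace_sv_ge M (addr_ge0 c0 t0).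
apply: (count_sv_lower c0 Uf) => x xU.
have := hU x xU; have := hG x; have := nrmB (x *m M^T) (x *m G^T).
rewrite linearD/= mulmxDr mulrDl; lra.
Qed.

(** The unperturbed side is counted with [<]: for delta = 1 the threshold c is 0, and counting with
    [<=] would give all n singular values. The strict bound on G pays for this. *)
Lemma count_sv_perturb_strict m n (M G : 'M[R]_(m, n)) (c t : R) : 0 <= c -> 0 <= t ->
  (forall x, x != 0 -> nrm (x *m G^T) < t * nrm x) ->
  (count (fun d => (c + t <= d)%R) (singular_values (M + G)) <=
   count (fun d => (c < d)%R) (singular_values M))%N.
Proof.
move=> c0 t0 hG; rewrite leqNgt; apply/negP => lt_k.
have [k [U [kE Uf] hU]] := subspace_sv_ge (M + G) (addr_ge0 c0 t0).
have [k' [W [kE' Wf] hW]] := subspace_sv_le M c0.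
have cn : (count (fun d => (c < d)%R) (singular_values M) + k' = n)%N.
  rewrite kE' -[RHS](size_singular_values M) -(count_predC (fun d => (c < d)%R)); congr addn.
  by apply: eq_count => d /=; rewrite leNgt.
have [|x x0 /andP[xU xW]] := subspaces_meet Uf Wf; first by rewrite -cn ltn_add2r kE.
have := hU x xU; have := hW x xW; have := hG x x0; have := nrmD (x *m M^T) (x *m G^T).
rewrite linearD/= mulmxDr mulrDl; lra.
Qed.

(** [~~ p 0] makes the equality valid past the end of the list, where [nth] returns 0. *)
Lemma nth_sorted_count (p : pred R) (s : seq R) i :
  sorted >=%R s -> {homo p : x y / x <= y >-> x ==> y} -> ~~ p 0 ->
  p s`_i = (i < count p s)%N.
Proof.
move=> + pmono p0; elim: s i => [|x s IH] i; first by rewrite nth_nil (negbTE p0).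
move=> /= xs; have ss := path_sorted xs.
have cnt0 : ~~ p x -> count p s = 0%N.
  move=> px; apply/eqP; rewrite -leqn0 leqNgt -has_count; apply/hasPn => y ys.
  have /allP/(_ y ys) yx := order_path_min (rev_trans le_trans) xs.
  by apply: contraNN px => py; have := pmono _ _ yx; rewrite py.
case: i => [|i] /=; case px : (p x) => /=.
- by rewrite add1n.
- by rewrite cnt0 ?px.
- by rewrite IH// add1n ltnS.
- by rewrite IH// cnt0 ?px.
Qed.

Lemma sorted_singular_values m n (C : 'M[R]_(m, n)) : sorted >=%R (singular_values C).
Proof.
rewrite /singular_values sorted_map.
apply: (@sub_sorted _ >=%R) => [x y xy|]; first exact: ler_wsqrtr.
by apply: sort_sorted => x y; rewrite /= le_total.
Qed.

Lemma sing_val_geP m n (C : 'M[R]_(m, n)) (c : R) j : 0 < c -> (1 <= j)%N ->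
  (c <= sing_val C j) = (j <= count (fun d => (c <= d)%R) (singular_values C))%N.
Proof.
move=> c0 j1; rewrite -(ltn_predK j1).
apply: (@nth_sorted_count (fun d => c <= d)); first exact: sorted_singular_values.
  by move=> x y xy; apply/implyP => /le_trans; apply.
by rewrite -ltNge.
Qed.

Lemma sing_val_gtP m n (C : 'M[R]_(m, n)) (c : R) j : 0 <= c -> (1 <= j)%N ->
  (c < sing_val C j) = (j <= count (fun d => (c < d)%R) (singular_values C))%N.
Proof.
move=> c0 j1; rewrite -(ltn_predK j1).
apply: (@nth_sorted_count (fun d => c < d)); first exact: sorted_singular_values.
  by move=> x y xy; apply/implyP => /lt_le_trans; apply.
by rewrite -leNgt.
Qed.

End SingularSubspaces.

(** * Rank penalized least squares *)

Section ColumnProjection.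
Variables (R : realType) (m p : nat) (X : 'M[R]_(m, p)).
Local Notation P := (col_proj X).

Let cap0 : (<<X^T>> :&: kermx X)%MS = 0.
Proof.
apply/eqP; rewrite -submx0; apply/rV_subP => x; rewrite sub_capmx genmxE.
move=> /andP[/submxP[z xE] /sub_kermxP xX].
suff /eqP -> : x == 0 by exact: sub0mx.
by rewrite -dot_eq0 {2}xE trmx_mul trmxK mulmxA xX mul0mx mxE.
Qed.

Let addE : (1%:M <= <<X^T>> + kermx X)%MS.
Proof.
rewrite sub1mx /row_full eqn_leq rank_leq_col/=.
have := mxrank_sum_cap <<X^T>>%MS (kermx X).
rewrite cap0 mxrank0 addn0 => ->; rewrite genmxE mxrank_tr mxrank_ker.
by rewrite subnKC// rank_leq_row.
Qed.

Lemma col_proj_mulX : P *m X = X.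
Proof.
apply: trmx_inj; rewrite trmx_mul trmxK proj_mx_id ?cap0//.
by rewrite genmxE.
Qed.

Lemma col_proj_factor : exists K : 'M[R]_(p, m), P = X *m K.
Proof.
have : (proj_mx <<X^T>> (kermx X) <= X^T)%MS.
  by rewrite -(genmxE X^T) -[X in (X <= _)%MS]mul1mx proj_mx_sub.
by move=> /submxP[K E]; exists K^T; rewrite /col_proj E trmx_mul trmxK.
Qed.

Let tr_col_proj_mulX : P^T *m X = X.
Proof.
have := proj_mx_compl_sub addE; rewrite mul1mx => /sub_kermxP.
by rewrite mulmxBl mul1mx trmxK => /eqP; rewrite subr_eq0 => /eqP.
Qed.

Lemma col_proj_sym : P^T = P.
Proof.
have PP : P^T *m P = P.
  by have [K PE] := col_proj_factor; rewrite {2 3}PE mulmxA tr_col_proj_mulX.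
by rewrite -{1}PP trmx_mul (trmxK P) PP.
Qed.

Lemma col_proj_idem : P *m P = P.
Proof. by have [K PE] := col_proj_factor; rewrite {2 3}PE mulmxA col_proj_mulX. Qed.

Lemma rank_col_proj : \rank P = \rank X.
Proof.
apply/eqP; rewrite eqn_leq; apply/andP; split.
  by have [K ->] := col_proj_factor; exact: mxrankM_maxl.
by rewrite -{1}col_proj_mulX; exact: mxrankM_maxl.
Qed.

(** The eigenvalues of a symmetric idempotent are 0 or 1, and the eigenvectors for 1 are the columns
    of Q. *)
Lemma col_proj_basis : exists q, exists2 Q : 'M[R]_(m, q),
  q = \rank X & Q^T *m Q = 1%:M /\ P = Q *m Q^T.
Proof.
have [V [l [VV PE]]] := real_spectral col_proj_sym.
have VTV := mulmx1C VV.
have ll i : l 0 i = 0 \/ l 0 i = 1.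
  have /matrixP/(_ i i) : diag_mx l *m diag_mx l = diag_mx l.
    have DE : diag_mx l = V *m P *m V^T by rewrite PE !mulmxA VV mul1mx -mulmxA VV mulmx1.
    rewrite {1 2}DE !mulmxA -(mulmxA _ V^T) VTV mulmx1 -(mulmxA V P P) col_proj_idem.
    by rewrite DE.
  rewrite mul_diag_mx !mxE eqxx mulr1n => /eqP.
  rewrite -subr_eq0 -{3}[l 0 i]mulr1 -mulrBr mulf_eq0 subr_eq0.
  by move=> /orP[]/eqP; [left|right].
pose a := [pred i | l 0 i == 1].
pose ev : 'I_#|a| -> 'I_m := enum_val.
pose U := rowsub ev V.
have UU : U *m U^T = 1%:M.
  apply/matrixP => i j; have /matrixP/(_ (ev i) (ev j)) := VV.
  rewrite !mxE (inj_eq enum_val_inj) => <-.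
  by apply: eq_bigr => k _; rewrite !mxE.
have PU : P = U^T *m U.
  rewrite PE; apply/matrixP => i j; rewrite mul_mx_diag !mxE.
  rewrite (bigID a)/= [X in _ + X]big1 ?addr0.
    rewrite (eq_bigl (mem a))// big_enum_val/=; apply: eq_bigr => k _.
    by have /eqP lk : a (ev k) := enum_valP k; rewrite !mxE lk mulr1.
  by move=> k; rewrite !mxE; have [->|->] := ll k; rewrite ?eqxx// mulr0 mul0r.
exists #|a|, U^T; last by rewrite trmxK.
apply/eqP; rewrite -rank_col_proj eqn_leq; apply/andP; split.
  rewrite -{1}[#|a|](mxrank1 R) -[1%:M]mulmx1 -{1 2}UU -mulmxA (mulmxA U^T) -PU.
  by apply: leq_trans (mxrankM_maxr _ _) (mxrankM_maxl _ _).
by rewrite PU; apply: leq_trans (mxrankM_maxr _ _) (rank_leq_row _).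
Qed.

Lemma tr_col_proj : \tr P = (\rank X)%:R.
Proof.
have [q [Q <- [QQ ->]]] := col_proj_basis.
by rewrite mxtrace_mulC QQ mxtrace1.
Qed.

End ColumnProjection.

(** * Existence of a minimizer of the prescribed rank *)

Section EckartYoung.
Variable R : realType.

Definition frob2 m n (C : 'M[R]_(m, n)) : R := \tr (C^T *m C).

Lemma frob2E m n (C : 'M[R]_(m, n)) : frob2 C = \sum_i \sum_j C i j ^+ 2.
Proof.
rewrite exchange_big; apply: eq_bigr => j _.
by rewrite mxE; apply: eq_bigr => i _; rewrite mxE expr2.
Qed.

Lemma frob_sqr m n (C : 'M[R]_(m, n)) : frob C ^+ 2 = frob2 C.
Proof.
rewrite sqr_sqrtr ?frob2E//.
by apply: sumr_ge0 => i _; apply: sumr_ge0 => j _; exact: sqr_ge0.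
Qed.

Lemma frob2_ge0 m n (C : 'M[R]_(m, n)) : 0 <= frob2 C.
Proof. by rewrite -frob_sqr sqr_ge0. Qed.

Lemma frob2D_orth m n (C D : 'M[R]_(m, n)) : \tr (C^T *m D) = 0 ->
  frob2 (C + D) = frob2 C + frob2 D.
Proof.
move=> CD; rewrite /frob2 [(C + D)^T]linearD/= mulmxDl !mulmxDr !linearD/= CD.
have -> : \tr (D^T *m C) = 0 by rewrite -mxtrace_tr trmx_mul trmxK.
by rewrite addr0 add0r.
Qed.

Lemma frob2_mul_proj m n (C : 'M[R]_(m, n)) (S : 'M[R]_n) : S^T = S -> S *m S = S ->
  frob2 (C *m S) = \tr (C^T *m C *m S).
Proof.
move=> ST SS; rewrite /frob2 trmx_mul ST -mulmxA mxtrace_mulC -!mulmxA (mulmxA S) SS.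
by rewrite mxtrace_mulC -mulmxA mxtrace_mulC mulmxA.
Qed.

Lemma frob2_mul_proj_le m n (C : 'M[R]_(m, n)) (S : 'M[R]_n) : S^T = S -> S *m S = S ->
  frob2 (C *m S) <= frob2 C.
Proof.
move=> ST SS.
rewrite -[C in leRHS]mulmx1 -[1%:M](subrK S) mulmxDr frob2D_orth; first by rewrite lerDr frob2_ge0.
rewrite trmx_mul linearB/= trmx1 ST -mulmxA mxtrace_mulC -!mulmxA mulmxBr mulmx1 SS subrr.
by rewrite !mulmx0 mxtrace0.
Qed.

(** S_ii is the sum of the squares in row i, one of which is S_ii^2. *)
Lemma proj_diag_bounds n (S : 'M[R]_n) i : S^T = S -> S *m S = S -> 0 <= S i i <= 1.
Proof.
move=> ST SS.
have SE : S i i = \sum_j S i j ^+ 2.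
  rewrite -{1}SS mxE; apply: eq_bigr => j _.
  by rewrite -{2}ST mxE expr2.
have s0 : 0 <= S i i by rewrite SE; apply: sumr_ge0 => j _; exact: sqr_ge0.
have : S i i ^+ 2 <= S i i.
  by rewrite [leRHS]SE (bigD1 i)//= lerDl; apply: sumr_ge0 => j _; exact: sqr_ge0.
rewrite s0 /=; have [->|s1] := eqVneq (S i i) 0; first by rewrite ler01.
rewrite expr2 -[leRHS]mulr1 ler_pM2l// lt_neqAle s0 eq_sym s1.
by [].
Qed.

Variables (m p n : nat) (mu : R) (mu_gt0 : 0 < mu) (X : 'M[R]_(m, p)) (Y : 'M[R]_(m, n)).
Local Notation P := (col_proj X).
Let M := P *m Y.

(** Pythagoras: M - X B lies in the column space of X and Y - M is orthogonal to it. *)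
Let crit_split (B : 'M[R]_(p, n)) :
  rsc_criterion mu X Y B = frob2 (Y - M) + (frob2 (M - X *m B) + mu * (\rank B)%:R).
Proof.
have eM : M - X *m B = P *m (Y - X *m B) by rewrite mulmxBr (mulmxA P X) col_proj_mulX.
have orth : \tr ((Y - M)^T *m (M - X *m B)) = 0.
  have PM : P *m (Y - M) = 0 by rewrite mulmxBr /M (mulmxA P P) col_proj_idem subrr.
  by rewrite eM mulmxA -{1}col_proj_sym -trmx_mul PM trmx0 mul0mx mxtrace0.
by rewrite /rsc_criterion frob_sqr addrA -(frob2D_orth orth) addrA subrK.
Qed.

(** Eckart-Young with the penalty built in: sum_i min (l_i, mu) bounds the penalized fit of every B
    from below, and truncating M = P Y to the right singular vectors with l_i >= mu attains it. *)
Lemma rsc_minimizer_exists : exists2 B, rsc_minimizer mu X Y B & \rank B = rsc_rank mu X Y.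
Proof.
have [V [l [VV ME l0 perm]]] := gram_spectral M.
have VTV := mulmx1C VV.
pose a := [pred i | Num.sqrt mu <= Num.sqrt (l 0 i)].
have aE i : (i \in a) = (mu <= l 0 i).
  by rewrite inE ler_sqrt// lt0r_neq0.
have rE : rsc_rank mu X Y = #|a| by rewrite /rsc_rank (count_singular_values _ perm).
have lower (B : 'M[R]_(p, n)) : \sum_i Num.min (l 0 i) mu <= frob2 (M - X *m B) + mu * (\rank B)%:R.
  (* The projection onto the complement of the row space of B. It annihilates B, so the residual is
     at least frob2 (M S). *)
  pose S := 1%:M - col_proj B^T.
  have ST : S^T = S by rewrite /S linearB/= trmx1 col_proj_sym.
  have SS : S *m S = S.
    by rewrite /S mulmxBr mulmx1 mulmxBl mul1mx col_proj_idem subrr subr0.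
  have BS : B *m S = 0.
    have := col_proj_mulX B^T => /(congr1 trmx); rewrite trmx_mul col_proj_sym (trmxK B) => BP.
    by rewrite /S mulmxBr mulmx1 BP subrr.
  pose W := V *m S *m V^T.
  have WT : W^T = W by rewrite /W !trmx_mul trmxK ST mulmxA.
  have WW : W *m W = W.
    by rewrite /W !mulmxA -(mulmxA _ V^T) VTV mulmx1 -(mulmxA V S S) SS.
  have trW : \sum_i W i i = n%:R - (\rank B)%:R.
    rewrite -/(mxtrace W) /W mxtrace_mulC mulmxA VTV mul1mx /S linearB/= mxtrace1 tr_col_proj.
    by rewrite mxrank_tr.
  have f1 : frob2 (M *m S) = \sum_i l 0 i * W i i.
    rewrite frob2_mul_proj// ME -!mulmxA mxtrace_mulC -!mulmxA /mxtrace.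
    apply: eq_bigr => i _; rewrite mul_diag_mx mxE /W.
    by rewrite mulmxA.
  have f2 : \sum_i l 0 i * W i i <= frob2 (M - X *m B).
    have MS : (M - X *m B) *m S = M *m S by rewrite mulmxBl -(mulmxA X) BS mulmx0 subr0.
    by rewrite -f1 -MS frob2_mul_proj_le.
  apply: (@le_trans _ _ (\sum_i l 0 i * W i i + mu * (\rank B)%:R)); last by rewrite lerD2r.
  (* The penalty is shared out as mu (1 - W_ii) in the eigenbasis; since W_ii lies in [0, 1], each
     term is a convex combination of l_i and mu, hence at least their minimum. *)
  have -> : (\rank B)%:R = \sum_i (1 - W i i).
    by rewrite sumrB trW sumr_const card_ord; ring.
  rewrite mulr_sumr -big_split/=; apply: ler_sum => i _.
  have /andP[w0 w1] := proj_diag_bounds i WT WW.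
  have : Num.min (l 0 i) mu <= l 0 i /\ Num.min (l 0 i) mu <= mu by rewrite !ge_min !lexx orbT.
  move: (Num.min (l 0 i) mu) (l 0 i) (W i i) w0 w1 => c b w w0 w1 [cb cm]; nra.
have [K PK] := col_proj_factor X.
pose ev : 'I_#|a| -> 'I_n := enum_val.
pose U := rowsub ev V.
have UU : U *m U^T = 1%:M.
  apply/matrixP => i j; have /matrixP/(_ (ev i) (ev j)) := VV.
  rewrite !mxE (inj_eq enum_val_inj) => <-.
  by apply: eq_bigr => k _; rewrite !mxE.
pose S := U^T *m U.
have ST : S^T = S by rewrite /S trmx_mul trmxK.
have SS : S *m S = S by rewrite /S mulmxA -(mulmxA _ U) UU mulmx1.
(* P = X K and P M = M give X B = M S, so the truncation of M is realized by a coefficient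
   matrix. *)
pose B := K *m M *m S.
have PM : P *m M = M by rewrite /M mulmxA col_proj_idem.
have XB : X *m B = M *m S by rewrite /B (mulmxA X) (mulmxA X K M) -PK PM.
have UMMU : U *m (M^T *m M) *m U^T = diag_mx (\row_i l 0 (ev i)).
  have UV : U *m V^T = rowsub ev 1%:M.
    by rewrite -VV; apply/matrixP => i j; rewrite !mxE; apply: eq_bigr => k _; rewrite !mxE.
  rewrite ME !mulmxA -(mulmxA _ V) -[V *m U^T]trmxK trmx_mul trmxK UV.
  apply/matrixP => i j; rewrite mul_mx_diag mxE (bigD1 (ev i))//= big1 ?addr0 => [|k ki].
    by rewrite !mxE eqxx mul1r (inj_eq enum_val_inj) eq_sym mulr_natr.
  by rewrite !mxE eq_sym (negbTE ki) !mul0r.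
have lev i : mu <= l 0 (ev i) by rewrite -aE; exact: enum_valP.
have rB : \rank B = #|a|.
  apply/eqP; rewrite eqn_leq; apply/andP; split.
    by rewrite /B /S mulmxA; apply: leq_trans (mxrankM_maxr _ _) (rank_leq_row _).
  (* An invertible diagonal matrix of size #|a| factors through B, so the rank of B is not
     smaller. *)
  have : \rank (U *m (M^T *m M) *m U^T) = #|a|.
    rewrite UMMU; apply: mxrank_unit; rewrite unitmxE det_diag unitfE prodf_seq_neq0.
    by apply/allP => i _ /=; rewrite mxE gt_eqF// (lt_le_trans mu_gt0).
  move=> {1}<-.
  have -> : U *m (M^T *m M) *m U^T = U *m M^T *m X *m B *m U^T.
    have SU : S *m U^T = U^T by rewrite /S -mulmxA UU mulmx1.
    rewrite -(mulmxA _ X B) XB (mulmxA U M^T M) -(mulmxA _ (M *m S)) -(mulmxA M S) SU.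
    by rewrite -(mulmxA _ M).
  by apply: leq_trans (mxrankM_maxl _ _) (mxrankM_maxr _ _).
exists B; last by rewrite rE.
move=> B'; rewrite !crit_split lerD2l; apply: le_trans (lower B').
rewrite XB rB.
have -> : M - M *m S = M *m (1%:M - S) by rewrite mulmxBr mulmx1.
rewrite frob2_mul_proj; first last.
- by rewrite mulmxBr mulmx1 mulmxBl mul1mx SS subrr subr0.
- by rewrite linearB/= trmx1 ST.
rewrite mulmxBr mulmx1 linearB/=.
have -> : \tr (M^T *m M) = \sum_i l 0 i.
  by rewrite ME -mulmxA mxtrace_mulC -mulmxA VV mulmx1 mxtrace_diag.
have -> : \tr (M^T *m M *m S) = \sum_(i in a) l 0 i.
  rewrite /S mulmxA mxtrace_mulC mulmxA UMMU mxtrace_diag. rewrite [RHS]big_enum_val.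
  by apply: eq_bigr => i _; rewrite mxE.
rewrite [X in X - _](bigID (mem a))/= [X in X - _]addrC addrK.
rewrite [leRHS](bigID (mem a))/= addrC lerD//.
  by apply: ler_sum => i; rewrite aE -ltNge => li; rewrite le_min lexx ltW.
rewrite -sum1_card natr_sum mulr_sumr; apply: ler_sum => i ia.
by rewrite mulr1 le_min lexx -aE ia.
Qed.

Lemma rsc_estimate_rank (B : 'M[R]_(p, n)) : rsc_estimate mu X Y B -> \rank B = rsc_rank mu X Y.
Proof. by move=> [_]; apply; exact: rsc_minimizer_exists. Qed.

End EckartYoung.

(** * Reduction to countably many directions *)

Section RationalDirections.
Variable R : realType.

Lemma rat_sequence (x : R) : exists a : nat -> rat, ratr (a k) @[k --> \oo] --> x.
Proof.
have ex k : exists a : rat, `|ratr a - x| <= k.+1%:R^-1.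
  set e := k.+1%:R^-1; have [|a] := @rat_in_itvoo _ (x - e) (x + e).
    by rewrite ltrD2l gtrN// invr_gt0.
  rewrite in_itv/= => /andP[a1 a2]; exists a; clearbody e; rewrite ler_norml; apply/andP; split; lra.
have [a aE] := choice ex; exists a.
apply/cvgrPdistC_le => e e0; near=> k; apply: (le_trans (aE k)).
near: k; by apply: filterS (near_infty_natSinv_lt (PosNum e0)) => k /ltW.
Unshelve. all: by end_near.
Qed.

(** The zero tuple is sent to the basis vector i0, so that every code yields a unit vector. *)
Definition normalize q (i0 : 'I_q) (f : {ffun 'I_q -> rat}) (i : 'I_q) : R :=
  if \sum_j (ratr (f j) : R) ^+ 2 == 0 then (i == i0)%:R
  else ratr (f i) / Num.sqrt (\sum_j (ratr (f j) : R) ^+ 2).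

Lemma normalize_unit q (i0 : 'I_q) f : \sum_i normalize i0 f i ^+ 2 = 1.
Proof.
rewrite /normalize; have [_|s0] := eqVneq.
  by rewrite (bigD1 i0)//= eqxx expr1n big1 ?addr0// => i /negbTE ->; rewrite expr0n.
under eq_bigr do rewrite exprMn exprVn.
by rewrite -mulr_suml sqr_sqrtr ?mulfV// sumr_ge0// => i _; exact: sqr_ge0.
Qed.

Lemma normalizeE q (i0 : 'I_q) (f : {ffun 'I_q -> rat}) i :
  ratr (f i) = Num.sqrt (\sum_j (ratr (f j) : R) ^+ 2) * normalize i0 f i.
Proof.
rewrite /normalize; have [s0|s0] := eqVneq.
  have /psumr_eq0P/(_ i isT)/eqP := s0; rewrite sqrf_eq0 => h.
  by rewrite s0 sqrtr0 mul0r; apply/eqP/h => j _; exact: sqr_ge0.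
rewrite mulrC mulfVK// gt_eqF// sqrtr_gt0 lt_neqAle eq_sym s0.
by apply: sumr_ge0 => j _; exact: sqr_ge0.
Qed.

(** The inequality is strict and continuous in (y, x), so it holds at nearby rational vectors, and
    homogeneous, so those may then be divided by their norms. *)
Lemma dense_directions q n : (0 < q)%N -> (0 < n)%N ->
  exists u : nat -> 'I_q -> R, exists v : nat -> 'I_n -> R,
  [/\ forall k, \sum_i u k i ^+ 2 = 1, forall k, \sum_j v k j ^+ 2 = 1 &
   forall (c : 'I_q -> 'I_n -> R) (y : 'I_q -> R) (x : 'I_n -> R) t,
     t * (Num.sqrt (\sum_i y i ^+ 2) * Num.sqrt (\sum_j x j ^+ 2)) <
       \sum_i \sum_j c i j * (y i * x j) ->
     exists k, t < \sum_i \sum_j c i j * (u k i * v k j)].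
Proof.
move=> q0 n0; pose i0 := Ordinal q0; pose j0 := Ordinal n0.
pose D := ({ffun 'I_q -> rat} * {ffun 'I_n -> rat})%type.
pose dir k : D := odflt ([ffun=> 0], [ffun=> 0]) (unpickle k).
exists (fun k => normalize i0 (dir k).1), (fun k => normalize j0 (dir k).2).
split=> [k|k|c y x t txy]; [exact: normalize_unit|exact: normalize_unit|].
have [a aE] := choice (fun i => rat_sequence (y i)).
have [b bE] := choice (fun j => rat_sequence (x j)).
pose sa k := \sum_i (ratr (a i k) : R) ^+ 2.
pose sb k := \sum_j (ratr (b j k) : R) ^+ 2.
pose B k := \sum_i \sum_j c i j * ((ratr (a i k) : R) * ratr (b j k)).
have cva : sa k @[k --> \oo] --> \sum_i y i ^+ 2.
  by apply: cvg_big => [|i _]; [exact: add_continuous|rewrite expr2; under eq_fun do rewrite expr2; exact: cvgM].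
have cvb : sb k @[k --> \oo] --> \sum_j x j ^+ 2.
  by apply: cvg_big => [|i _]; [exact: add_continuous|rewrite expr2; under eq_fun do rewrite expr2; exact: cvgM].
have cvB : B k @[k --> \oo] --> \sum_i \sum_j c i j * (y i * x j).
  apply: cvg_big => [|i _]; first exact: add_continuous.
  apply: cvg_big => [|j _]; first exact: add_continuous.
  by apply: cvgMr; exact: cvgM.
have cvt : t * (Num.sqrt (sa k) * Num.sqrt (sb k)) - B k @[k --> \oo] -->
    t * (Num.sqrt (\sum_i y i ^+ 2) * Num.sqrt (\sum_j x j ^+ 2)) -
      \sum_i \sum_j c i j * (y i * x j).
  apply: cvgB => //; apply: cvgMr; apply: cvgM.
    by apply: (continuous_cvg _ _ cva); exact: sqrt_continuous.
  by apply: (continuous_cvg _ _ cvb); exact: sqrt_continuous.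
rewrite -subr_lt0 in txy.
have [k0 _ /(_ k0 (leqnn _))] := cvgr_lt _ cvt _ txy.
rewrite /= subr_lt0 => hk.
pose f := [ffun i => a i k0]; pose g := [ffun j => b j k0].
exists (pickle (f, g)); rewrite /dir pickleK/=.
have aN i : ratr (a i k0) = Num.sqrt (sa k0) * normalize i0 f i.
  rewrite -[sa k0](_ : \sum_i (ratr (f i) : R) ^+ 2 = _) -?normalizeE ?ffunE//.
  by apply: eq_bigr => j _; rewrite ffunE.
have bN j : ratr (b j k0) = Num.sqrt (sb k0) * normalize j0 g j.
  rewrite -[sb k0](_ : \sum_i (ratr (g i) : R) ^+ 2 = _) -?normalizeE ?ffunE//.
  by apply: eq_bigr => i _; rewrite ffunE.
have BE : B k0 = Num.sqrt (sa k0) * Num.sqrt (sb k0) *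
    \sum_i \sum_j c i j * (normalize i0 f i * normalize j0 g j).
  rewrite mulr_sumr; apply: eq_bigr => i _; rewrite mulr_sumr; apply: eq_bigr => j _.
  by rewrite aN bN; ring.
move: hk; rewrite BE mulrC.
have : 0 <= Num.sqrt (sa k0) * Num.sqrt (sb k0) by rewrite mulr_ge0 ?sqrtr_ge0.
(* If a norm vanished, the strict inequality would read 0 < 0. *)
rewrite le_eqVlt => /orP[/eqP <-|S0]; first by rewrite !mul0r ltxx.
by rewrite ltr_pM2l.
Qed.

End RationalDirections.

Section DenseApproximation.
Variable R : realType.

Lemma dense_bilin_dir m n q (Q : 'M[R]_(m, q)) : Q^T *m Q = 1%:M -> (0 < q)%N -> (0 < n)%N ->
  exists u : nat -> 'I_q -> R, exists v : nat -> 'I_n -> R,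
  [/\ forall k, \sum_i u k i ^+ 2 = 1, forall k, \sum_j v k j ^+ 2 = 1 &
   forall (G : 'M[R]_(m, n)) (x : 'rV[R]_n) t t', x != 0 -> 0 < t -> t' < t ->
     t * nrm x <= nrm (x *m (Q *m Q^T *m G)^T) ->
     exists k, t' < \sum_ij G ij.1 ij.2 * bilin_dir Q (u k) (v k) ij].
Proof.
move=> QQ q0 n0; have [u [v [u1 v1 uv]]] := dense_directions R q0 n0.
exists u, v; split=> // G x t t' x0 t0 tt' xt.
(* For fixed x this is the best left direction: the bilinear form at (y, x) is |y|^2. *)
pose y := x *m G^T *m Q.
have ny : nrm (x *m (Q *m Q^T *m G)^T) = nrm y.
  have -> : x *m (Q *m Q^T *m G)^T = y *m Q^T by rewrite !trmx_mul trmxK !mulmxA.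
  by rewrite /nrm /sqnorm trmx_mul trmxK mulmxA -(mulmxA y) QQ mulmx1.
have nx0 := nrm_gt0 x0; rewrite ny in xt.
have ny0 : 0 < nrm y by apply: lt_le_trans xt; rewrite mulr_gt0.
pose c l j := (Q^T *m G) l j.
have cE (a : 'I_q -> R) (b : 'I_n -> R) :
    \sum_l \sum_j c l j * (a l * b j) = \sum_ij G ij.1 ij.2 * bilin_dir Q a b ij.
  rewrite -(pair_bigA _ (fun i j => G i j * bilin_dir Q a b (i, j)))/=.
  under eq_bigr => l _. under eq_bigr => j _.
    rewrite /c mxE mulr_suml.
    over. rewrite exchange_big/=. over.
  rewrite exchange_big/=; apply: eq_bigr => i _.
  rewrite exchange_big/=; apply: eq_bigr => j _.
  rewrite /bilin_dir/= mulr_suml mulr_sumr; apply: eq_bigr => l _.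
  by rewrite mxE; ring.
have [|k hk] := uv c (fun l => y 0 l) (fun j => x 0 j) t'; last by exists k; rewrite -cE.
have -> : \sum_l \sum_j c l j * (y 0 l * x 0 j) = nrm y ^+ 2.
  rewrite nrm_sqr sqnormE; apply: eq_bigr => l _; rewrite expr2.
  have {3}-> : y 0 l = (x *m (G^T *m Q)) 0 l by rewrite mulmxA.
  rewrite [(x *m _) 0 l]mxE mulr_sumr; apply: eq_bigr => j _.
  have -> : (G^T *m Q) j l = c l j by rewrite /c -[G in RHS]trmxK -trmx_mul [RHS]mxE.
  by ring.
rewrite -!sqnormE -/(nrm y) -/(nrm x) expr2 mulrCA ltr_pM2l//.
by apply: lt_le_trans xt; rewrite ltr_pM2r.
Qed.

Lemma nrm_mul_frob m n (D : 'M[R]_(m, n)) (x : 'rV[R]_n) e : 0 <= e -> frob2 D <= e ^+ 2 ->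
  nrm (x *m D^T) <= e * nrm x.
Proof.
move=> e0 De; rewrite -(@ler_pXn2r _ 2)// ?nnegrE ?mulr_ge0 ?nrm_ge0// exprMn !nrm_sqr.
apply: (@le_trans _ _ (frob2 D * sqnorm x)); last by rewrite ler_wpM2r// sqnorm_ge0.
rewrite frob2E mulr_suml [leLHS]sqnormE; apply: ler_sum => i _.
have -> : (x *m D^T) 0 i = \sum_j D i j * x 0 j.
  by rewrite mxE; apply: eq_bigr => j _; rewrite mxE mulrC.
by have := sum_cauchy_schwarz (fun j => D i j) (fun j => x 0 j); rewrite -sqnormE.
Qed.

Lemma rat_matrix_approx m n (M : 'M[R]_(m, n)) e : 0 < e ->
  exists M' : 'M[rat]_(m, n), frob2 (M - map_mx ratr M') < e.
Proof.
move=> e0; have [a aE] := choice (fun ij : 'I_m * 'I_n => rat_sequence (M ij.1 ij.2)).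
have cv : (\sum_i \sum_j (M i j - ratr (a (i, j) k)) ^+ 2) @[k --> \oo] --> 
    \sum_i \sum_j (M i j - M i j) ^+ 2.
  apply: cvg_big => [|i _]; first exact: add_continuous.
  apply: cvg_big => [|j _]; first exact: add_continuous.
  have cij : M i j - ratr (a (i, j) k) @[k --> \oo] --> M i j - M i j.
    by apply: cvgB; [exact: cvg_cst|exact: (aE (i, j))].
  rewrite expr2; under eq_fun do rewrite expr2.
  exact: cvgM.
rewrite big1 in cv => [|i _]; last by rewrite big1// => j _; rewrite subrr expr0n.
have [k _ /(_ k (leqnn _))/= hk] := cvgr_lt _ cv _ e0.
exists (\matrix_(i, j) a (i, j) k); rewrite frob2E.
by under eq_bigr => i _ do under eq_bigr => j _ do rewrite !mxE.
Qed.

Lemma count_gap (s : seq R) c : exists2 e, 0 < e & forall e', 0 <= e' -> e' < e ->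
  count (fun d => c - e' <= d) s = count (fun d => (c <= d)%R) s.
Proof.
elim: s => [|x s [e e0 IH]]; first by exists 1.
have [cx|xc] := leP c x.
  exists e => // e' e'0 e'e; rewrite /= IH// cx (le_trans _ cx)//.
  by rewrite gerBl.
exists (Num.min e (c - x)); first by rewrite lt_min e0 subr_gt0.
move=> e' e'0; rewrite lt_min => /andP[e'e e'c]; rewrite /= IH//.
by rewrite [c <= x]leNgt xc [c - e' <= x]leNgt ltrBrDl addrC -ltrBrDl e'c.
Qed.

(** A matrix error e is absorbed by lowering the threshold by e, in both directions by Weyl's
    inequality. For the existence of M' the count of M must not change when c is lowered by 2 e,
    which [count_gap] provides for small e. *)
Lemma count_sv_ltP m n (M : 'M[R]_(m, n)) (c : R) k : 0 < c ->
  (count (fun d => (c <= d)%R) (singular_values M) < k)%N <->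
  exists N : nat, exists M' : 'M[rat]_(m, n), let e : R := N.+1%:R^-1 in
    [/\ e <= c, frob2 (M - map_mx ratr M') <= e ^+ 2 &
    (count (fun d => (c - e <= d)%R) (singular_values (map_mx ratr M' : 'M[R]_(m, n))) < k)%N].
Proof.
move=> c0; split=> [ck|[N [M' [ec fM]]]].
  have [e1 e10 h1] := count_gap (singular_values M) c.
  have e20 : 0 < Num.min e1 c / 2 by rewrite divr_gt0// lt_min e10 c0.
  have [N _ /(_ N (leqnn _))/= hN] := near_infty_natSinv_lt (PosNum e20).
  set e := N.+1%:R^-1 in hN.
  have e0 : 0 < e by rewrite invr_gt0.
  have [ee1 ec] : e * 2 < e1 /\ e * 2 < c.
    by move: hN; rewrite ltr_pdivlMr// lt_min => /andP[].
  have [M' hM'] := rat_matrix_approx M (exprn_gt0 2 e0).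
  exists N, M'; split; [by rewrite -/e; lra|exact: ltW|].
  apply: leq_ltn_trans ck; rewrite -(h1 (e * 2)); [|by rewrite mulr_ge0// ltW|by []].
  have <- : map_mx ratr M' + (M - map_mx ratr M') = M by rewrite addrC subrK.
  rewrite -/e (_ : c - e = c - e * 2 + e); last by ring.
  apply: count_sv_perturb; [by lra|exact: ltW|].
  by move=> x; apply: nrm_mul_frob; exact: ltW.
apply: leq_ltn_trans.
rewrite -[X in (_ <= count _ (singular_values X))%N](_ : M + (map_mx ratr M' - M) = _); last first.
  by rewrite addrC subrK.
have {1}-> : c = c - N.+1%:R^-1 + N.+1%:R^-1 by rewrite subrK.
apply: count_sv_perturb; [by rewrite subr_ge0|by []|].
move=> x; apply: nrm_mul_frob; first by [].
rewrite -opprB; apply: le_trans fM; rewrite !frob2E.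
by apply: ler_sum => i _; apply: ler_sum => j _; rewrite [in leLHS]mxE sqrrN.
Qed.

End DenseApproximation.

Section MeasurableCount.
Context {d : measure_display} {T : measurableType d} {R : realType}.

(** [count_sv_ltP] makes the set a countable union, over precisions and rational matrices, of events
    that M w lies in a Frobenius ball. *)
Lemma measurable_count_sv m n (M : T -> 'M[R]_(m, n)) (c : R) k : 0 < c ->
  (forall i j, measurable_fun setT (fun w => M w i j)) ->
  measurable [set w | (count (fun d => (c <= d)%R) (singular_values (M w)) < k)%N].
Proof.
move=> c0 mM.
have -> : [set w | (count (fun d => (c <= d)%R) (singular_values (M w)) < k)%N] =
    \bigcup_N \bigcup_l [set w | exists2 M' : 'M[rat]_(m, n), unpickle l = Some M' &
     let e : R := N.+1%:R^-1 in [/\ e <= c, frob2 (M w - map_mx ratr M') <= e ^+ 2 &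
    (count (fun d => (c - e <= d)%R) (singular_values (map_mx ratr M' : 'M[R]_(m, n))) < k)%N]].
  apply/seteqP; split=> w /=.
    move=> /(count_sv_ltP _ _ c0)[N [M' h]].
    by exists N => //; exists (pickle M') => //=; exists M' => //; rewrite pickleK.
  by move=> [N _ [l _ /= [M' _ h]]]; apply/(count_sv_ltP _ _ c0); exists N, M'.
apply: bigcup_measurable => N _; apply: bigcup_measurable => l _.
case E : (unpickle l) => [M'|]; last first.
  by rewrite (_ : [set _ | _] = set0)//; apply/seteqP; split=> w //= [].
set e : R := N.+1%:R^-1.
have [[ec ck]|nh] := pselect (e <= c /\
   (count (fun d => (c - e <= d)%R) (singular_values (map_mx ratr M' : 'M[R]_(m, n))) < k)%N).
  rewrite (_ : [set _ | _] = (fun w => frob2 (M w - map_mx ratr M')) @^-1` `]-oo, e ^+ 2]).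
    rewrite -[X in measurable X]setTI.
    suff : measurable_fun setT (fun w => frob2 (M w - map_mx ratr M')) by apply.
    rewrite (_ : (fun w => _) = (fun w => \sum_i \sum_j (M w i j - ratr (M' i j)) ^+ 2)).
      apply: measurable_sum => i; apply: measurable_sum => j.
      by apply: measurable_funX; apply: measurable_funB.
    apply/funext => w; rewrite frob2E.
    by under eq_bigr => i _ do under eq_bigr => j _ do rewrite !mxE.
  apply/seteqP; split=> w /=; rewrite in_itv/=; first by move=> [_ [<-] []].
  by move=> h; exists M'.
rewrite (_ : [set _ | _] = set0)//; apply/seteqP; split=> w //= [_ [<-] [h1 _ h2]].
by apply: nh.
Qed.

End MeasurableCount.

Lemma tail_bound_cvg0 (R : realType) (theta : R) : 0 < theta ->
  tail_bound theta N @[N --> \oo] --> (0 : R).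
Proof.
move=> th0; pose z := expR (- (2^-1 * theta ^+ 2)).
have -> : tail_bound theta = (fun N => z ^+ N).
  apply/funext => N; rewrite /tail_bound /z -expRM_natl; congr expR; ring.
apply: cvg_expr; rewrite ger0_norm ?expR_ge0// -expR0 ltr_expR oppr_lt0.
by rewrite mulr_gt0// exprn_gt0.
Qed.

(** Otherwise a subspace of dimension at least j > rank C, on which C^T is bounded below, would meet
    the kernel of C^T, of dimension n - rank C. *)
Lemma sing_val_rank (R : realType) m n (C : 'M[R]_(m, n)) j : (\rank C < j)%N -> sing_val C j <= 0.
Proof.
move=> rj; have j1 : (1 <= j)%N by apply: leq_ltn_trans rj.
rewrite leNgt; apply/negP => c0.
have := sing_val_geP C c0 j1; rewrite lexx => /esym; apply/negP; rewrite -ltnNge.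
have [k [U [<- Uf] hU]] := subspace_sv_ge C (ltW c0).
rewrite ltnNge; apply/negP => jk; have rk := leq_trans rj jk.
have [|x x0 /andP[xU xK]] := subspaces_meet Uf (row_base_free (kermx C^T)).
  by rewrite mxrank_ker mxrank_tr; have := rank_leq_col C; lia.
have := hU x xU; rewrite eq_row_base in xK; move/sub_kermxP: xK => ->.
by rewrite leNgt nrm0 mulr_gt0 ?nrm_gt0.
Qed.

(** * Consistency of the selected rank *)

Section RankConsistency.
Variables (R : realType) (m p n : nat) (X : 'M[R]_(m, p)) (A : 'M[R]_(p, n)).
Variables (mu delta : R) (s : nat).
Hypotheses (mu_gt0 : 0 < Num.sqrt mu) (delta_gt0 : 0 < delta) (delta_le1 : delta <= 1).
Hypotheses (s_gt0 : (1 <= s)%N).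
Hypothesis sv_s : (1 + delta) * Num.sqrt mu <= sing_val (X *m A) s.
Hypothesis sv_s1 : sing_val (X *m A) s.+1 <= (1 - delta) * Num.sqrt mu.

(** P X = X, so projecting the response alters only the noise. The hypotheses on d_s and d_(s+1)
    keep both at distance at least delta sqrt mu from the threshold sqrt mu. *)
Lemma rsc_rank_stable (G : 'M[R]_(m, n)) :
  (forall x, x != 0 ->
    nrm (x *m (col_proj X *m G)^T) < delta * Num.sqrt mu * nrm x) ->
  rsc_rank mu X (X *m A + G) = s.
Proof.
move=> hG; rewrite /rsc_rank mulmxDr mulmxA col_proj_mulX.
set H := col_proj X *m G in hG *.
have t0 : 0 < delta * Num.sqrt mu by rewrite mulr_gt0.
have c0 : 0 <= (1 - delta) * Num.sqrt mu by rewrite mulr_ge0 ?subr_ge0// ltW.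
apply/eqP; rewrite eqn_leq; apply/andP; split.
  have := count_sv_perturb_strict (X *m A) c0 (ltW t0) hG.
  rewrite -mulrDl subrK mul1r => /leq_trans; apply.
  by rewrite leqNgt -sing_val_gtP// -leNgt.
have hG' x : nrm (x *m H^T) <= delta * Num.sqrt mu * nrm x.
  have [->|/hG/ltW//] := eqVneq x 0.
  by rewrite mul0mx !nrm0 mulr0.
have := count_sv_perturb (X *m A) (ltW mu_gt0) (ltW t0) hG'.
apply: leq_trans; rewrite -sing_val_geP//; last by rewrite addr_gt0.
by rewrite -{1}[Num.sqrt mu]mul1r -mulrDl.
Qed.

End RankConsistency.

Section RankTail.
Context {d : measure_display} {T : measurableType d} {R : realType}.
Variables (P : probability T R) (m p n : nat) (X : 'M[R]_(m, p)) (A : 'M[R]_(p, n)).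
Variables (E : 'I_m * 'I_n -> {RV P >-> R}) (sigma : R).
Hypotheses (sigma_gt0 : 0 < sigma) (noiseE : gaussian_noise sigma E).
Let q := \rank X.

(** Serves both parts of the theorem, the second with delta = 1, where (1 - delta) sqrt mu = 0;
    hence the weak inequality at s + 1. *)
Lemma rsc_rank_tail theta delta mu s Ahat :
  0 < theta -> 0 < delta -> delta <= 1 -> 
  delta * Num.sqrt mu = (1 + theta) * sigma * (Num.sqrt n%:R + Num.sqrt q%:R) ->
  (0 < n)%N -> (1 <= s)%N ->
  (1 + delta) * Num.sqrt mu < sing_val (X *m A) s ->
  sing_val (X *m A) s.+1 <= (1 - delta) * Num.sqrt mu ->
  (forall w, rsc_estimate mu X (response X A E w) (Ahat w)) ->
  (P [set w | \rank (Ahat w) <> s] <= (tail_bound theta (n + q))%:E)%E.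
Proof.
move=> th0 d0 d1 muE n0 s1 svs svs1 est.
have sn0 : 0 < Num.sqrt n%:R :> R by rewrite sqrtr_gt0 ltr0n.
have smu0 : 0 < Num.sqrt mu.
  rewrite -(pmulr_rgt0 _ d0) muE mulr_gt0//; first by rewrite mulr_gt0// addr_gt0.
  by rewrite ltr_pwDl// sqrtr_ge0.
have mu0 : 0 < mu by rewrite -sqrtr_gt0.
have XA0 : X *m A != 0.
  apply: contraTneq svs => XA; rewrite -leNgt; apply: (@le_trans _ _ 0).
    by apply: sing_val_rank; rewrite XA mxrank0.
  by rewrite mulr_ge0 ?addr_ge0 ?ltW.
have q0 : (0 < q)%N.
  rewrite lt0n mxrank_eq0; apply: contraNN XA0 => /eqP ->; by rewrite mul0mx.
have sq0 : 0 < Num.sqrt q%:R :> R by rewrite sqrtr_gt0 ltr0n.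
have [q' [Q q'E [QQ PE]]] := col_proj_basis X.
rewrite -/q in q'E; subst q'.
have [u [v [u1 v1 uv]]] := dense_bilin_dir QQ q0 n0.
pose t := sigma * (Num.sqrt n%:R + Num.sqrt q%:R) + theta * sigma * Num.sqrt (n + q)%:R.
(* Strict because n and q are positive; the gap is what [dense_bilin_dir] needs. *)
have tt : t < delta * Num.sqrt mu.
  have : Num.sqrt (n + q)%:R < Num.sqrt n%:R + Num.sqrt q%:R :> R.
    rewrite -(@ltr_pXn2r _ 2)// ?nnegrE ?addr_ge0 ?sqrtr_ge0//.
    rewrite sqrrD !sqr_sqrtr// natrD.
    by have := mulr_gt0 sn0 sq0; lra.
  rewrite muE /t -(ltr_pM2l (mulr_gt0 th0 sigma_gt0)); lra.
apply: (le_trans _ (bilin_sup_tail sigma_gt0 noiseE QQ q0 n0 u1 v1 th0)).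
have rk w := rsc_estimate_rank mu0 (est w).
have mY i j : measurable_fun setT (fun w => (col_proj X *m response X A E w) i j).
  rewrite (_ : (fun w => _) = (fun w => \sum_l col_proj X i l * ((X *m A) l j + E (l, j) w))).
    apply: measurable_sum => l; apply: measurable_funM => //.
    by apply: measurable_funD.
  by apply/funext => w; rewrite mxE; apply: eq_bigr => l _; congr (_ * _); rewrite /response mxE; congr (_ + _); rewrite mxE.
apply: le_measure.
(* A count different from s is below s or not below s + 1, and both events are measurable. *)
- rewrite inE (_ : [set w | _] = [set w | (rsc_rank mu X (response X A E w) < s)%N] `|`
    ~` [set w | (rsc_rank mu X (response X A E w) < s.+1)%N]).
    by apply: measurableU; [|apply: measurableC]; exact: measurable_count_sv.
  apply/seteqP; split=> w /=; rewrite rk ltnS => h; last by move=> rs; case: h; rewrite rs ?ltnn ?leqnn.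
  by case: ltngtP h => //; [left|right].
- by rewrite inE; exact: measurable_bilin_sup.
move=> w /= h.
have [x x0 hx] : exists2 x, x != 0 & delta * Num.sqrt mu * nrm x <= 
    nrm (x *m (col_proj X *m \matrix_(i, j) E (i, j) w)^T).
  apply: contrapT => nex; apply: h; rewrite rk.
  apply: (rsc_rank_stable smu0 d0 d1 s1 (ltW svs) svs1) => x x0.
  by rewrite ltNge; apply/negP => hx; apply: nex; exists x.
rewrite PE in hx.
have [k hk] := uv _ x _ _ x0 (mulr_gt0 d0 smu0) tt hx.
exists k => //=; apply: lt_le_trans hk _; rewrite /bilin le_eqVlt; apply/orP; left; apply/eqP.
by apply: eq_bigr => -[i j] _; rewrite mxE.
Qed.
End RankTail.

Theorem corollary4 (R : realType) (d : measure_display) (T : measurableType d)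
    (P : probability T R) (m p n : nat)
    (X : 'M[R]_(m, p)) (A : 'M[R]_(p, n))
    (E : 'I_m * 'I_n -> {RV P >-> R}) (sigma : R)
    (sigma_gt0 : 0 < sigma) (noiseE : gaussian_noise sigma E)
    (rankA : (1 <= \rank A)%N) :
  let r := \rank A in
  let q := \rank X in
  (forall (theta delta mu : R) (s : nat) (Ahat : T -> 'M[R]_(p, n)),
      0 < theta -> 0 < delta -> delta <= 1 ->
      mu = (1 + theta) ^+ 2 * sigma ^+ 2
           * (Num.sqrt n%:R + Num.sqrt q%:R) ^+ 2 / delta ^+ 2 ->
      (1 <= s)%N -> (s <= r)%N ->
      (1 + delta) * Num.sqrt mu < sing_val (X *m A) s ->
      sing_val (X *m A) s.+1 < (1 - delta) * Num.sqrt mu ->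
      (forall w, rsc_estimate mu X (response X A E w) (Ahat w)) ->
      (P [set w | \rank (Ahat w) <> s] <= (tail_bound theta (n + q))%:E)%E
      /\ tail_bound theta N @[N --> \oo] --> (0 : R))
  /\
  (forall (theta mu : R) (Ahat : T -> 'M[R]_(p, n)),
      0 < theta ->
      Num.sqrt mu = (1 + theta) * sigma * (Num.sqrt n%:R + Num.sqrt q%:R) ->
      2 * Num.sqrt mu < sing_val (X *m A) r ->
      (forall w, rsc_estimate mu X (response X A E w) (Ahat w)) ->
      (P [set w | \rank (Ahat w) <> r] <= (tail_bound theta (n + q))%:E)%E
      /\ tail_bound theta N @[N --> \oo] --> (0 : R)).
Proof.
move=> r q; have n0 : (0 < n)%N by apply: leq_trans rankA (rank_leq_col _).
split=> [theta delta mu s Ahat th0 d0 d1 muE s1 _ svs svs1 est|theta mu Ahat th0 muE svs est];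
  (split; last exact: tail_bound_cvg0).
  apply: (rsc_rank_tail sigma_gt0 noiseE th0 d0 d1 _ n0 s1 svs (ltW svs1) est).
  (* The value of sqrt mu. *)
  pose c := (1 + theta) * sigma * (Num.sqrt n%:R + Num.sqrt q%:R) / delta.
  have -> : mu = c ^+ 2 by rewrite muE /c; field; rewrite gt_eqF.
  rewrite sqrtr_sqr ger0_norm; first by rewrite /c mulrC divfK ?gt_eqF.
  by rewrite divr_ge0 ?(ltW d0)// !mulr_ge0 ?addr_ge0 ?sqrtr_ge0// ltW.
(* For delta = 1 the lower threshold is 0, and X A has rank at most r. *)
have svs1 : sing_val (X *m A) r.+1 <= (1 - 1) * Num.sqrt mu.
  by rewrite subrr mul0r; apply: sing_val_rank; rewrite ltnS mxrankM_maxr.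
by apply: (rsc_rank_tail sigma_gt0 noiseE th0 ltr01 (lexx 1) _ n0 rankA svs svs1 est); rewrite mul1r.
Qed.
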